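(* Let $p\ge0$ be a fixed integer and let $V:S^1\to\mathbb{R}$ be of class $C^{k-1,1}(S^1)$ for some $k\ge 2p+2$. For each $n$, let $\pi_n$ be the monic polynomial of degree $n$ orthogonal on the unit circle with respect to the weight $\phi(\theta)=e^{-nV(\theta)}$. If $\kappa'(\theta)>0$ for all $\theta$, then for each $\rho>1$ there is a constant $K_{p,\rho}>0$ such that \[ \sup_{|z|\ge\rho}\left|\frac{d^p}{dz^p}\left[\pi_n(z)z^{-n}e^{-nN(z)}-1\right]\right|\le K_{p,\rho}\frac{\log(n)}{n^{2(k-1)}} \] for all sufficiently large $n$.
   Context: $C^{k-1,1}(S^1)$: functions on the circle whose periodic extension has $k-1$ Lipschitz continuous derivatives. Orthogonality: $\langle \pi_n,z^j\rangle_\phi=0$ for $0\le j<n$, with $\langle f,g\rangle_\phi=\frac{1}{2\pi}\int_{-\pi}^{\pi}f(e^{i\theta})\overline{g(e^{i\theta})}\phi(\theta)d\theta$ (note the weight depends on $n$, the same $n$ as the degree). $V_j=\frac{1}{2\pi}\int_{-\pi}^\pi V(\theta)e^{-ij\theta}d\theta$, $N(z)=\sum_{j\ge1}V_{-j}z^{-j}$ for $|z|\ge1$, $\Omega(\theta)=2\,\mathrm{Im}\,N(e^{i\theta})$ and $\kappa(\theta)=\theta+\Omega(\theta)$. *)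

(* Defs.v *)
From Stdlib Require Import Reals.
From Coquelicot Require Import Coquelicot.
Open Scope R_scope.

Definition Cexp (w : C) : C := (exp (fst w) * cos (snd w), exp (fst w) * sin (snd w)).
Definition eith (t : R) : C := (cos t, sin t).

Definition CRInt (f : R -> C) (a b : R) : C :=
  (RInt (fun t => fst (f t)) a b, RInt (fun t => snd (f t)) a b).

(* V : S^1 -> R, represented as a 2pi-periodic function R -> R *)
Definition periodic2pi (V : R -> R) : Prop := forall t, V (t + 2 * PI) = V t.

Definition C_Lip (m : nat) (V : R -> R) : Prop :=
  exists d : nat -> R -> R,
    (forall t, d 0%nat t = V t) /\
    (forall j t, (j < m)%nat -> is_derive (d j) t (d (S j) t)) /\
    (exists L, forall x y, Rabs (d m x - d m y) <= L * Rabs (x - y)).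

Definition fourier (V : R -> R) (j : Z) : C :=
  Cmult (/ (2 * PI))
    (CRInt (fun t => Cmult (V t) (eith (- IZR j * t))) (- PI) PI).

Definition Nterm (V : R -> R) (z : C) (j : nat) : C :=
  Cmult (fourier V (- Z.of_nat (S j))) (Cinv (pow_n z (S j))).
Definition Nfun (V : R -> R) (z : C) : C :=
  (Series (fun j => fst (Nterm V z j)), Series (fun j => snd (Nterm V z j))).

Definition Omega (V : R -> R) (t : R) : R := 2 * snd (Nfun V (eith t)).
Definition kappa (V : R -> R) (t : R) : R := t + Omega V t.

Definition inner (phi : R -> R) (f g : C -> C) : C :=
  Cmult (/ (2 * PI))
    (CRInt (fun t => Cmult (Cmult (f (eith t)) (Cconj (g (eith t)))) (phi t)) (- PI) PI).

Definition is_monic_OPUC (V : R -> R) (n : nat) (P : C -> C) : Prop :=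
  (exists c : nat -> C, c n = 1%C /\
     forall z, P z = sum_n (fun m => Cmult (c m) (pow_n z m)) n) /\
  (forall j, (j < n)%nat ->
     inner (fun t => exp (- INR n * V t)) P (fun z => pow_n z j) = 0%C).

Definition OPerr (V : R -> R) (P : C -> C) (n : nat) (z : C) : C :=
  Cminus (Cmult (Cmult (P z) (Cinv (pow_n z n))) (Cexp (Cmult (- INR n) (Nfun V z)))) 1%C.

(* Main.v *)
(** On the circle, write [N^* = conj N] and [Q = z^n e^{n N} e^{- n N^*} = e^{i n kappa}].
    The function [A = pi_n z^{-n} e^{- n N}] is anti-analytic with mean 1, while [Q A = pi_n e^{- n N^*}] is
    analytic.  Orthogonality says that [pi_n z^{-n} e^{- n V}] has no Fourier mode in [-n, -1], which gives
    [A = alpha + conj (Q b)] with [alpha] and [b] analytic and [b] of mean zero.  Pairing these relations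
    with [b], [alpha - 1] and [z^j] yields

      ||b||^2 = - <Q b> - <Q (alpha - 1) b>,   ||alpha - 1||^2 = - conj <Q (alpha - 1) b>,

    and shows that the coefficient of [z^{-j}] in [A - 1] is [conj <Q z^{-j} b>], where [<.>] is the mean over
    the circle.  So everything follows from [|<Q f g>| <= ||f|| ||g|| / 2] and
    [|<Q z^{-j} f>| <= K ((j + 1) / n)^{k-1} ||f||] for analytic [f], [g]: they give [||b|| = O(n^{-(k-1)})],
    hence coefficients of [A - 1] of size [O((j + 1)^{k-1} n^{-2(k-1)})], and the sum over [j] of
    [rho^{-j}] times these, or their derivatives, converges.

    Both bounds come from moving the circle to radius [e^{-t}].  Since [kappa' > 0], an almost analytic
        extension
    of [Q] decays like [e^{- c n t}], and its d-bar derivative is [O(n t^{k-1} e^{- c n t})] in L^2, because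
    [sum_j j^{2k} |V_j|^2] is finite.  Truncating the Fourier series of [N] keeps all functions smooth. *)

Require Import Defs.
From Stdlib Require Import Reals Lra Lia Psatz ZArith.
From Coquelicot Require Import Coquelicot.
Open Scope R_scope.

(** The factor 1/2 in the bilinear bound closes the argument: the two norm identities give ||alpha -
    1|| <= ||b|| / 2, then ||b||^2 <= k0 ||b|| + ||b||^2 / 4, where k0 bounds <Q f>. In <Q f g> both
    f and g are controlled only in L^2, so the d-bar derivative must be measured in the sup norm,
    where it is merely small as t -> 0: this gives a constant. In <Q z^{-j} f> there is one L^2
    function, so the d-bar derivative goes into L^2 by Cauchy-Schwarz, and t^{k-1} against e^{-cnt}
    gives the rate n^{-(k-1)}. The obstacle to moving the circle is N: at radius e^{-t} its modes
    grow like e^s, s = jt, while V has finite smoothness. The growth e^s is replaced by m(s) =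
    e^{-s} times the Taylor polynomial of e^{2s} of degree q = k - 1. This m is bounded, and m - m'
    is a single term of order s^q, which Parseval matches with j^{q+1} |V_j|. The disc algebra is
    the uniform closure of the polynomials, so only polynomials are ever moved to smaller circles; A
    is replaced by its conjugate reflection so that every function involved lies in that algebra. *)

(** * Finite sums and the complex modulus *)

Fixpoint csum (f : nat -> C) (n : nat) : C :=
  match n with O => RtoC 0 | S m => (csum f m + f m)%C end.

Fixpoint rsum (f : nat -> R) (n : nat) : R :=
  match n with O => 0 | S m => rsum f m + f m end.

Lemma csum_ext f g n : (forall i, (i < n)%nat -> f i = g i) -> csum f n = csum g n.
Proof.
  induction n as [|n IH]; intros H; simpl; [reflexivity|].
  rewrite IH, H; auto with arith.
Qed.

Lemma rsum_ext f g n : (forall i, (i < n)%nat -> f i = g i) -> rsum f n = rsum g n.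
Proof.
  induction n as [|n IH]; intros H; simpl; [reflexivity|].
  rewrite IH, H; auto with arith.
Qed.

Lemma csum_plus f g n : csum (fun i => (f i + g i)%C) n = (csum f n + csum g n)%C.
Proof. induction n as [|n IH]; simpl; [|rewrite IH]; ring. Qed.

Lemma csum_mult_l c f n : csum (fun i => (c * f i)%C) n = (c * csum f n)%C.
Proof. induction n as [|n IH]; simpl; [|rewrite IH]; ring. Qed.

Lemma csum_mult_r c f n : csum (fun i => (f i * c)%C) n = (csum f n * c)%C.
Proof. induction n as [|n IH]; simpl; [|rewrite IH]; ring. Qed.

Lemma csum_zero f n : (forall i, (i < n)%nat -> f i = RtoC 0) -> csum f n = RtoC 0.
Proof.
  induction n as [|n IH]; intros H; simpl; [reflexivity|].
  rewrite IH, H; auto with arith. ring.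
Qed.

Lemma csum_delta f n i0 : (i0 < n)%nat ->
  (forall i, (i < n)%nat -> i <> i0 -> f i = RtoC 0) -> csum f n = f i0.
Proof.
  induction n as [|n IH]; intros Hi H; simpl; [lia|].
  destruct (Nat.eq_dec i0 n) as [->|Hn].
  - rewrite csum_zero; [ring|]. intros i Hi'. apply H; lia.
  - rewrite IH; [|lia|intros; apply H; lia]. rewrite (H n); [ring|lia|lia].
Qed.

Lemma csum_conj f n : Cconj (csum f n) = csum (fun i => Cconj (f i)) n.
Proof.
  induction n as [|n IH]; simpl.
  - unfold Cconj; simpl. unfold RtoC. f_equal; ring.
  - rewrite Cplus_conj, IH. reflexivity.
Qed.

Lemma csum_first f n : csum f (S n) = (f O + csum (fun i => f (S i)) n)%C.
Proof.
  induction n as [|n IH]; [simpl; ring|].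
  change (csum f (S (S n))) with (csum f (S n) + f (S n))%C.
  rewrite IH. simpl. ring.
Qed.

Lemma csum_app f m n : csum f (m + n) = (csum f m + csum (fun i => f (m + i)%nat) n)%C.
Proof.
  induction n as [|n IH]; [rewrite Nat.add_0_r; simpl; ring|].
  rewrite Nat.add_succ_r. simpl. rewrite IH. ring.
Qed.

Lemma csum_re f n : fst (csum f n) = rsum (fun i => fst (f i)) n.
Proof. induction n as [|n IH]; simpl; [|rewrite IH]; reflexivity. Qed.

Lemma csum_im f n : snd (csum f n) = rsum (fun i => snd (f i)) n.
Proof. induction n as [|n IH]; simpl; [|rewrite IH]; reflexivity. Qed.

Lemma rsum_le f g n : (forall i, (i < n)%nat -> f i <= g i) -> rsum f n <= rsum g n.
Proof.
  induction n as [|n IH]; intros H; simpl; [lra|].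
  apply Rplus_le_compat; auto with arith.
Qed.

Lemma rsum_ge0 f n : (forall i, (i < n)%nat -> 0 <= f i) -> 0 <= rsum f n.
Proof.
  induction n as [|n IH]; intros H; simpl; [lra|].
  apply Rplus_le_le_0_compat; auto with arith.
Qed.

Lemma rsum_plus f g n : rsum (fun i => f i + g i) n = rsum f n + rsum g n.
Proof. induction n as [|n IH]; simpl; [|rewrite IH]; ring. Qed.

Lemma rsum_mult_l c f n : rsum (fun i => c * f i) n = c * rsum f n.
Proof. induction n as [|n IH]; simpl; [|rewrite IH]; ring. Qed.

Lemma rsum_app f m n : rsum f (m + n) = rsum f m + rsum (fun i => f (m + i)%nat) n.
Proof.
  induction n as [|n IH]; [rewrite Nat.add_0_r; simpl; ring|].
  rewrite Nat.add_succ_r. simpl. rewrite IH. ring.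
Qed.

Lemma rsum_mono f m n : (forall i, 0 <= f i) -> (m <= n)%nat -> rsum f m <= rsum f n.
Proof.
  intros Hf Hmn. replace n with (m + (n - m))%nat by lia. rewrite rsum_app.
  pose proof (rsum_ge0 (fun i => f (m + i)%nat) (n - m) (fun i _ => Hf (m + i)%nat)). lra.
Qed.

Lemma sum_n_rsum (f : nat -> R) n : sum_n f n = rsum f (S n).
Proof.
  induction n as [|n IH].
  - rewrite sum_O. simpl. ring.
  - rewrite sum_Sn, IH. reflexivity.
Qed.

Lemma sum_n_csum (f : nat -> C) n : sum_n f n = csum f (S n).
Proof.
  induction n as [|n IH].
  - rewrite sum_O. simpl. ring.
  - rewrite sum_Sn, IH. reflexivity.
Qed.

Lemma pow_n_Cpow (z : C) n : pow_n z n = Cpow z n.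
Proof. induction n as [|n IH]; simpl; [|rewrite IH]; reflexivity. Qed.

Lemma Cmod_csum f n : Cmod (csum f n) <= rsum (fun i => Cmod (f i)) n.
Proof.
  induction n as [|n IH]; simpl; [rewrite Cmod_0; lra|].
  eapply Rle_trans; [apply Cmod_triangle|]. lra.
Qed.

Lemma Cmod_sqr z : Cmod z ^ 2 = fst z ^ 2 + snd z ^ 2.
Proof. unfold Cmod. rewrite pow2_sqrt; [reflexivity|nra]. Qed.

Lemma Cmult_conj_r z : (z * Cconj z)%C = RtoC (Cmod z ^ 2).
Proof. rewrite Cmod_sqr. unfold Cmult, Cconj, RtoC; simpl. f_equal; ring. Qed.

Lemma Cconj_RtoC r : Cconj (RtoC r) = RtoC r.
Proof. unfold Cconj, RtoC; simpl. f_equal; ring. Qed.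

Lemma Cmod_minus_sym a b : Cmod (a - b) = Cmod (b - a).
Proof. rewrite <- Cmod_opp. f_equal. ring. Qed.

Lemma Cmod_minus_le a b : Cmod (a - b) <= Cmod a + Cmod b.
Proof. unfold Cminus. eapply Rle_trans; [apply Cmod_triangle|]. rewrite Cmod_opp. lra. Qed.

Lemma Rabs_fst_le z : Rabs (fst z) <= Cmod z.
Proof. eapply Rle_trans; [|apply Rmax_Cmod]. apply Rmax_l. Qed.

Lemma Rabs_snd_le z : Rabs (snd z) <= Cmod z.
Proof. eapply Rle_trans; [|apply Rmax_Cmod]. apply Rmax_r. Qed.

Lemma Cmod_le_abs z : Cmod z <= Rabs (fst z) + Rabs (snd z).
Proof.
  apply Rsqr_incr_0_var.
  - rewrite !Rsqr_pow2, Cmod_sqr.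
    rewrite <- (pow2_abs (fst z)), <- (pow2_abs (snd z)).
    pose proof (Rabs_pos (fst z)). pose proof (Rabs_pos (snd z)). nra.
  - pose proof (Rabs_pos (fst z)). pose proof (Rabs_pos (snd z)). lra.
Qed.

(** * The complex exponential and the unit circle *)

Lemma Cexp_plus a b : Cexp (a + b) = (Cexp a * Cexp b)%C.
Proof.
  unfold Cexp, Cmult, Cplus; simpl. rewrite exp_plus, cos_plus, sin_plus. f_equal; ring.
Qed.

Lemma Cexp_0 : Cexp (RtoC 0) = RtoC 1.
Proof. unfold Cexp, RtoC; simpl. rewrite exp_0, cos_0, sin_0. f_equal; ring. Qed.

Lemma Cmod_Cexp a : Cmod (Cexp a) = exp (fst a).
Proof.
  rewrite <- (Rabs_pos_eq (exp (fst a))) by (apply Rlt_le, exp_pos).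
  rewrite <- sqrt_Rsqr_abs. unfold Cmod, Cexp; simpl. f_equal.
  pose proof (sin2_cos2 (snd a)) as H. unfold Rsqr in *.
  transitivity (exp (fst a) * exp (fst a) * (sin (snd a) * sin (snd a) + cos (snd a) * cos (snd a)));
    [ring|rewrite H; ring].
Qed.

Lemma Cexp_conj a : Cexp (Cconj a) = Cconj (Cexp a).
Proof. unfold Cexp, Cconj; simpl. rewrite cos_neg, sin_neg. f_equal; ring. Qed.

Lemma Cexp_nat_mult n a : Cexp (RtoC (INR n) * a) = Cpow (Cexp a) n.
Proof.
  induction n as [|n IH].
  - replace (RtoC (INR 0) * a)%C with (RtoC 0) by (simpl; ring). apply Cexp_0.
  - rewrite S_INR, RtoC_plus, Cmult_plus_distr_r, Cexp_plus, IH, Cmult_1_l, Cpow_S. ring.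
Qed.

Lemma Cexp_RtoC r : Cexp (RtoC r) = RtoC (exp r).
Proof. unfold Cexp, RtoC; simpl. rewrite cos_0, sin_0. f_equal; ring. Qed.

Lemma eith_Cexp t : eith t = Cexp (0, t).
Proof. unfold eith, Cexp; simpl. rewrite exp_0. f_equal; ring. Qed.

Lemma eith_plus a b : eith (a + b) = (eith a * eith b)%C.
Proof.
  rewrite !eith_Cexp, <- Cexp_plus. f_equal. unfold Cplus; simpl. f_equal; ring.
Qed.

Lemma eith_0 : eith 0 = RtoC 1.
Proof. unfold eith. rewrite cos_0, sin_0. reflexivity. Qed.

Lemma Cmod_eith t : Cmod (eith t) = 1.
Proof. rewrite eith_Cexp, Cmod_Cexp. apply exp_0. Qed.

Lemma eith_conj t : Cconj (eith t) = eith (- t).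
Proof. unfold eith, Cconj; simpl. rewrite cos_neg, sin_neg. reflexivity. Qed.

Lemma eith_opp_mult t : (eith t * eith (- t))%C = RtoC 1.
Proof. rewrite <- eith_plus, Rplus_opp_r. apply eith_0. Qed.

Lemma eith_neq_0 t : eith t <> RtoC 0.
Proof. apply Cmod_gt_0. rewrite Cmod_eith. lra. Qed.

Lemma eith_pow t n : Cpow (eith t) n = eith (INR n * t).
Proof.
  induction n as [|n IH].
  - simpl. rewrite Rmult_0_l, eith_0. reflexivity.
  - rewrite Cpow_S, IH, <- eith_plus, S_INR. f_equal. ring.
Qed.

Lemma eith_inv t : Cinv (eith t) = eith (- t).
Proof.
  pose proof (eith_neq_0 t).
  rewrite <- (Cmult_1_l (Cinv (eith t))), <- (eith_opp_mult t). field. assumption.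
Qed.

(** * Taylor bounds for the exponential *)

Lemma MVT_is_derive (f df : R -> R) a b : (forall x, is_derive f x (df x)) ->
  exists c, Rmin a b <= c <= Rmax a b /\ f b - f a = df c * (b - a).
Proof.
  intros H. apply MVT_gen; intros x _; [apply H|].
  apply continuity_pt_filterlim, (ex_derive_continuous f). exists (df x). apply H.
Qed.

Lemma exp_le_3_small a : a <= 1 -> exp a <= 3.
Proof.
  intros H. apply Rle_trans with (exp 1); [|apply exp_le_3].
  destruct (Rle_lt_or_eq_dec _ _ H) as [H'|H'].
  - apply Rlt_le, exp_increasing, H'.
  - rewrite H'; lra.
Qed.

(** Two mean value steps give exp a - 1 - a = (exp c - 1) a = exp d * c * a with |c| <= |a|; the
    constant 3 bounds [exp d] for d <= 1. *)
Lemma exp_taylor2_bound a : Rabs a <= 1 -> Rabs (exp a - 1 - a) <= 3 * a ^ 2.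
Proof.
  intros Ha.
  destruct (MVT_is_derive (fun x => exp x - x) (fun x => exp x - 1) 0 a) as [c [Hc Heq]].
  { intros x. auto_derive; [trivial|ring]. }
  destruct (MVT_is_derive exp exp 0 c) as [d [Hd Heq2]].
  { intros x. auto_derive; [trivial|ring]. }
  rewrite exp_0 in Heq, Heq2. rewrite Rminus_0_r in Heq2.
  replace (exp a - 1 - a) with (exp d * (c * a)) by (rewrite Rminus_0_r in Heq; nra).
  assert (Hca : Rabs c <= Rabs a).
  { unfold Rmin, Rmax in Hc. destruct (Rle_dec 0 a); unfold Rabs; repeat destruct Rcase_abs; lra. }
  assert (Hd1 : exp d <= 3).
  { apply exp_le_3_small. apply Rabs_le_between in Ha. unfold Rmax in *.
    destruct (Rle_dec 0 a), (Rle_dec 0 c); lra. }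
  rewrite !Rabs_mult, (Rabs_pos_eq (exp d)) by (apply Rlt_le, exp_pos).
  rewrite <- (pow2_abs a). pose proof (Rabs_pos c). pose proof (exp_pos d).
  assert (Rabs c * Rabs a <= Rabs a ^ 2) by nra.
  apply Rmult_le_compat; nra.
Qed.

Lemma sin_le_abs b : Rabs (sin b) <= Rabs b.
Proof.
  destruct (MVT_is_derive sin cos 0 b) as [c [_ Hc]].
  - intros x. auto_derive; [trivial|ring].
  - rewrite sin_0, !Rminus_0_r in Hc. rewrite Hc, Rabs_mult.
    pose proof (COS_bound c). pose proof (Rabs_pos b).
    assert (Rabs (cos c) <= 1) by (apply Rabs_le; lra). nra.
Qed.

Lemma cos_taylor_bound b : Rabs (cos b - 1) <= b ^ 2.
Proof.
  replace (cos b - 1) with (- (2 * (sin (b / 2) * sin (b / 2)))).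
  - rewrite Rabs_Ropp, Rabs_pos_eq by nra.
    pose proof (sin_le_abs (b / 2)) as H.
    assert (Rabs (sin (b/2)) ^ 2 <= Rabs (b/2) ^ 2) by (apply pow_incr; split; [apply Rabs_pos|exact H]).
    rewrite !pow2_abs in H0. nra.
  - replace (cos b) with (cos (2 * (b / 2))) by (f_equal; field).
    rewrite cos_2a_sin. ring.
Qed.

Lemma sin_taylor_bound b : Rabs b <= 1 -> Rabs (sin b - b) <= b ^ 2.
Proof.
  intros Hb.
  destruct (MVT_is_derive (fun x => sin x - x) (fun x => cos x - 1) 0 b) as [c [Hc1 Hc]].
  - intros x. auto_derive; [trivial|ring].
  - rewrite sin_0, !Rminus_0_r in Hc. rewrite Hc, Rabs_mult.
    pose proof (cos_taylor_bound c).
    assert (Rabs c <= Rabs b).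
    { unfold Rmin, Rmax in Hc1. destruct (Rle_dec 0 b); unfold Rabs; repeat destruct Rcase_abs; lra. }
    rewrite <- (pow2_abs b). rewrite <- (pow2_abs c) in H.
    pose proof (Rabs_pos b). pose proof (Rabs_pos c).
    assert (Rabs c ^ 2 <= Rabs b ^ 2) by (apply pow_incr; lra).
    assert (Rabs b ^ 2 <= Rabs b) by nra.
    replace (Rabs b ^ 2) with (Rabs b * Rabs b) by ring.
    apply Rmult_le_compat_r; lra.
Qed.

Lemma exp_mono a b : a <= b -> exp a <= exp b.
Proof.
  intros H. destruct (Rle_lt_or_eq_dec _ _ H) as [H'|H'].
  - apply Rlt_le, exp_increasing, H'.
  - rewrite H'; lra.
Qed.

(** For u = a + ib the real error is (e^a - 1 - a) + e^a (cos b - 1) and the imaginary one e^a (sin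
    b - b) + (e^a - 1) b. They contribute at most 3 and 4 times |u|^2; 10 is a round total. *)
Lemma Cexp_taylor2 u : Cmod u <= 1 ->
  Cmod (Cexp u - RtoC 1 - u) <= 10 * Cmod u ^ 2.
Proof.
  intros Hu. destruct u as [a b].
  pose proof (Rabs_fst_le (a, b)) as Ha. pose proof (Rabs_snd_le (a, b)) as Hb. simpl in Ha, Hb.
  eapply Rle_trans; [apply Cmod_le_abs|].
  rewrite Cmod_sqr. unfold Cexp, Cminus, Cplus, Copp, RtoC; simpl.
  pose proof (exp_taylor2_bound a ltac:(lra)) as H1.
  pose proof (sin_taylor_bound b ltac:(lra)) as H2.
  pose proof (cos_taylor_bound b) as H3.
  pose proof (exp_le_3_small a ltac:(apply Rabs_le_between in Ha; lra)) as H4.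
  pose proof (exp_pos a).
  assert (Hx : Rabs (exp a * cos b + - (1) + - a) <= 3 * a ^ 2 + 3 * b ^ 2).
  { replace (exp a * cos b + - (1) + - a) with ((exp a - 1 - a) + exp a * (cos b - 1)) by ring.
    eapply Rle_trans; [apply Rabs_triang|]. apply Rplus_le_compat; [exact H1|].
    rewrite Rabs_mult, (Rabs_pos_eq (exp a)) by lra.
    apply Rmult_le_compat; try lra. apply Rabs_pos. }
  assert (Hy : Rabs (exp a * sin b + - 0 + - b) <= 3 * b ^ 2 + (3 * a ^ 2 + a ^ 2 + b ^ 2)).
  { replace (exp a * sin b + - 0 + - b) with (exp a * (sin b - b) + ((exp a - 1 - a) * b + a * b)) by ring.
    eapply Rle_trans; [apply Rabs_triang|]. apply Rplus_le_compat.
    - rewrite Rabs_mult, (Rabs_pos_eq (exp a)) by lra.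
      apply Rmult_le_compat; try lra. apply Rabs_pos.
    - eapply Rle_trans; [apply Rabs_triang|].
      rewrite !Rabs_mult. rewrite <- (pow2_abs a) in *. rewrite <- (pow2_abs b) in *.
      pose proof (Rabs_pos a). pose proof (Rabs_pos b). pose proof (Rabs_pos (exp a - 1 - a)).
      assert (Rabs (exp a - 1 - a) * Rabs b <= 3 * Rabs a ^ 2 * 1) by (apply Rmult_le_compat; lra).
      nra. }
  simpl in Hx, Hy. nra.
Qed.

Lemma Cexp_minus_1 u : Cmod u <= 1 -> Cmod (Cexp u - RtoC 1) <= 11 * Cmod u.
Proof.
  intros Hu. pose proof (Cexp_taylor2 u Hu). pose proof (Cmod_ge_0 u).
  replace (Cexp u - RtoC 1)%C with (Cexp u - RtoC 1 - u + u)%C by ring.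
  eapply Rle_trans; [apply Cmod_triangle|]. nra.
Qed.

(** Serves to compare a truncated phase with the full one; there [u] is purely imaginary and the
    prefactor is 1. *)
Lemma Cexp_lipschitz_local u d : Cmod d <= 1 ->
  Cmod (Cexp (u + d) - Cexp u) <= exp (fst u) * (11 * Cmod d).
Proof.
  intros Hd. rewrite Cexp_plus.
  replace (Cexp u * Cexp d - Cexp u)%C with (Cexp u * (Cexp d - RtoC 1))%C by ring.
  rewrite Cmod_mult, Cmod_Cexp. apply Rmult_le_compat_l; [apply Rlt_le, exp_pos|].
  apply Cexp_minus_1, Hd.
Qed.

Lemma exp_INR_mult n x : exp (INR n * x) = exp x ^ n.
Proof.
  induction n as [|n IH]; [simpl; rewrite Rmult_0_l; apply exp_0|].
  rewrite S_INR, Rmult_plus_distr_r, Rmult_1_l, exp_plus, IH. simpl. ring.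
Qed.

(** * Calculus of complex-valued functions of real variables *)

Definition Ccont (f : R -> C) : Prop :=
  forall t, continuous (fun x => fst (f x)) t /\ continuous (fun x => snd (f x)) t.

(** Derivative along a real parameter. The complex derivative of the theorem is a different notion,
    reached only through [is_derive_C_quadratic]. *)
Definition CD (f : R -> C) (t : R) (l : C) : Prop :=
  is_derive (fun x => fst (f x)) t (fst l) /\ is_derive (fun x => snd (f x)) t (snd l).

(** Joint continuity, the form in which differentiation under the integral sign asks for it. *)
Definition C2cont (f : R -> R -> C) : Prop :=
  forall x y, continuity_2d_pt (fun u v => fst (f u v)) x y /\
              continuity_2d_pt (fun u v => snd (f u v)) x y.

Lemma continuous_Rmult (f g : R -> R) t :
  continuous f t -> continuous g t -> continuous (fun x => f x * g x) t.
Proof. intros Hf Hg. apply (continuous_mult f g t Hf Hg). Qed.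

Lemma continuous_Rplus (f g : R -> R) t :
  continuous f t -> continuous g t -> continuous (fun x => f x + g x) t.
Proof. intros Hf Hg. apply (continuous_plus f g t Hf Hg). Qed.

Lemma continuous_Rminus (f g : R -> R) t :
  continuous f t -> continuous g t -> continuous (fun x => f x - g x) t.
Proof. intros Hf Hg. apply (continuous_minus f g t Hf Hg). Qed.

Lemma continuous_Ropp (f : R -> R) t :
  continuous f t -> continuous (fun x => - f x) t.
Proof. intros Hf. apply (continuous_opp f t Hf). Qed.

Lemma continuous_derivable (f : R -> R) t l : is_derive f t l -> continuous f t.
Proof. intros H. apply (ex_derive_continuous f). exists l; exact H. Qed.

Lemma is_derive_eq (f : R -> R) (t l l' : R) : is_derive f t l -> l = l' -> is_derive f t l'.
Proof. intros H <-; exact H. Qed.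

Lemma Ccont_ext f g : (forall t, f t = g t) -> Ccont f -> Ccont g.
Proof.
  intros H Hf t. destruct (Hf t) as [H1 H2]. split.
  - eapply continuous_ext; [|exact H1]. intros x; cbv beta; rewrite H; reflexivity.
  - eapply continuous_ext; [|exact H2]. intros x; cbv beta; rewrite H; reflexivity.
Qed.

Lemma Ccont_const c : Ccont (fun _ => c).
Proof. intros t; split; apply continuous_const. Qed.

Lemma Ccont_plus f g : Ccont f -> Ccont g -> Ccont (fun t => (f t + g t)%C).
Proof.
  intros Hf Hg t; destruct (Hf t), (Hg t); split; simpl; apply continuous_Rplus; assumption.
Qed.

Lemma Ccont_opp f : Ccont f -> Ccont (fun t => (- f t)%C).
Proof. intros Hf t; destruct (Hf t); split; simpl; apply continuous_Ropp; assumption. Qed.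

Lemma Ccont_minus f g : Ccont f -> Ccont g -> Ccont (fun t => (f t - g t)%C).
Proof. intros Hf Hg. apply Ccont_plus, Ccont_opp; assumption. Qed.

Lemma Ccont_mult f g : Ccont f -> Ccont g -> Ccont (fun t => (f t * g t)%C).
Proof.
  intros Hf Hg t; destruct (Hf t), (Hg t); split; simpl.
  - apply continuous_Rminus; apply continuous_Rmult; assumption.
  - apply continuous_Rplus; apply continuous_Rmult; assumption.
Qed.

Lemma Ccont_conj f : Ccont f -> Ccont (fun t => Cconj (f t)).
Proof.
  intros Hf t; destruct (Hf t); split; simpl; [|apply continuous_Ropp]; assumption.
Qed.

Lemma Ccont_RtoC (f : R -> R) : (forall t, continuous f t) -> Ccont (fun t => RtoC (f t)).
Proof. intros Hf t; split; simpl; [apply Hf|apply continuous_const]. Qed.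

Lemma Ccont_csum (f : nat -> R -> C) n :
  (forall i, Ccont (f i)) -> Ccont (fun t => csum (fun i => f i t) n).
Proof.
  intros Hf. induction n as [|n IH]; simpl; [apply Ccont_const|].
  apply Ccont_plus; [exact IH|apply Hf].
Qed.

Lemma CD_cont f df : (forall t, CD f t (df t)) -> Ccont f.
Proof.
  intros H t. destruct (H t). split; eapply continuous_derivable; eassumption.
Qed.

Lemma CD_eq f t l l' : CD f t l -> l = l' -> CD f t l'.
Proof. intros H <-; exact H. Qed.

Lemma CD_ext f g t l : (forall x, f x = g x) -> CD f t l -> CD g t l.
Proof.
  intros H [H1 H2]; split.
  - eapply is_derive_ext; [|exact H1]. intros x; cbv beta; rewrite H; reflexivity.
  - eapply is_derive_ext; [|exact H2]. intros x; cbv beta; rewrite H; reflexivity.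
Qed.

Lemma is_derive_Rconst (c t : R) : is_derive (fun _ : R => c) t 0.
Proof. apply (is_derive_const (K := R_AbsRing) (V := R_NormedModule) c t). Qed.

Lemma CD_const c t : CD (fun _ => c) t (RtoC 0).
Proof. split; simpl; apply is_derive_Rconst. Qed.

Lemma CD_plus f g t a b : CD f t a -> CD g t b -> CD (fun x => (f x + g x)%C) t (a + b)%C.
Proof.
  intros [H1 H2] [H3 H4]; split; simpl.
  - apply (is_derive_plus (fun x => fst (f x)) (fun x => fst (g x)) t _ _ H1 H3).
  - apply (is_derive_plus (fun x => snd (f x)) (fun x => snd (g x)) t _ _ H2 H4).
Qed.

Lemma is_derive_Rmult (f g : R -> R) t a b : is_derive f t a -> is_derive g t b ->
  is_derive (fun x => f x * g x) t (a * g t + f t * b).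
Proof. intros H1 H2. apply (is_derive_mult f g t a b H1 H2). intros; apply Rmult_comm. Qed.

Lemma is_derive_Rplus (f g : R -> R) t a b : is_derive f t a -> is_derive g t b ->
  is_derive (fun x => f x + g x) t (a + b).
Proof. intros H1 H2. apply (is_derive_plus f g t a b H1 H2). Qed.

Lemma is_derive_Rminus (f g : R -> R) t a b : is_derive f t a -> is_derive g t b ->
  is_derive (fun x => f x - g x) t (a - b).
Proof. intros H1 H2. apply (is_derive_minus f g t a b H1 H2). Qed.

Lemma CD_mult f g t a b : CD f t a -> CD g t b ->
  CD (fun x => (f x * g x)%C) t (a * g t + f t * b)%C.
Proof.
  intros [H1 H2] [H3 H4]; split; simpl.
  - eapply is_derive_eq; [apply is_derive_Rminus; apply is_derive_Rmult; eassumption|cbv beta; simpl; ring].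
  - eapply is_derive_eq; [apply is_derive_Rplus; apply is_derive_Rmult; eassumption|cbv beta; simpl; ring].
Qed.

Lemma CD_csum (f : nat -> R -> C) (df : nat -> C) n t : (forall i, CD (f i) t (df i)) ->
  CD (fun x => csum (fun i => f i x) n) t (csum df n).
Proof.
  intros H. induction n as [|n IH]; simpl; [apply CD_const|]. apply CD_plus; auto.
Qed.

Lemma CD_RtoC (f : R -> R) t l : is_derive f t l -> CD (fun x => RtoC (f x)) t (RtoC l).
Proof. intros H; split; simpl; [exact H|apply is_derive_Rconst]. Qed.

Lemma is_derive_Rcomp (f g : R -> R) t a b : is_derive f (g t) a -> is_derive g t b ->
  is_derive (fun x => f (g x)) t (b * a).
Proof. intros H1 H2. apply (is_derive_comp f g t a b H1 H2). Qed.

Lemma CD_Cexp f t l : CD f t l -> CD (fun x => Cexp (f x)) t (l * Cexp (f t))%C.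
Proof.
  intros [H1 H2].
  assert (He : is_derive (fun x => exp (fst (f x))) t (fst l * exp (fst (f t)))).
  { apply is_derive_Rcomp; [|exact H1]. apply is_derive_Reals, derivable_pt_lim_exp. }
  assert (Hc : is_derive (fun x => cos (snd (f x))) t (snd l * - sin (snd (f t)))).
  { apply is_derive_Rcomp; [|exact H2]. apply is_derive_Reals, derivable_pt_lim_cos. }
  assert (Hs : is_derive (fun x => sin (snd (f x))) t (snd l * cos (snd (f t)))).
  { apply is_derive_Rcomp; [|exact H2]. apply is_derive_Reals, derivable_pt_lim_sin. }
  split; simpl.
  - eapply is_derive_eq; [apply is_derive_Rmult; eassumption|]. cbv beta; simpl; ring.
  - eapply is_derive_eq; [apply is_derive_Rmult; eassumption|]. cbv beta; simpl; ring.
Qed.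

Lemma CD_eith c t : CD (fun x => eith (c * x)) t ((0, c)%R * eith (c * t))%C.
Proof.
  split; simpl; auto_derive; trivial; ring.
Qed.

Lemma Ccont_eith c : Ccont (fun x => eith (c * x)).
Proof. eapply CD_cont. intros t. apply CD_eith. Qed.

Lemma Ccont_Cexp f : Ccont f -> Ccont (fun t => Cexp (f t)).
Proof.
  intros Hf t. destruct (Hf t) as [H1 H2].
  assert (He : continuous (fun x => exp (fst (f x))) t).
  { apply (continuous_comp (fun x => fst (f x)) exp); [exact H1|].
    eapply continuous_derivable, is_derive_Reals, derivable_pt_lim_exp. }
  split; simpl; apply continuous_Rmult; try exact He.
  - apply (continuous_comp (fun x => snd (f x)) cos); [exact H2|].
    eapply continuous_derivable, is_derive_Reals, derivable_pt_lim_cos.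
  - apply (continuous_comp (fun x => snd (f x)) sin); [exact H2|].
    eapply continuous_derivable, is_derive_Reals, derivable_pt_lim_sin.
Qed.

Lemma continuous_Cmod f : Ccont f -> forall t, continuous (fun x => Cmod (f x)) t.
Proof.
  intros Hf t. destruct (Hf t) as [H1 H2]. unfold Cmod.
  apply (continuous_comp (fun x => fst (f x) ^ 2 + snd (f x) ^ 2) sqrt).
  - apply continuous_Rplus.
    + apply (continuous_comp (fun x => fst (f x)) (fun x => x ^ 2)); [exact H1|].
      apply (ex_derive_continuous (fun x => x ^ 2)). auto_derive; trivial.
    + apply (continuous_comp (fun x => snd (f x)) (fun x => x ^ 2)); [exact H2|].
      apply (ex_derive_continuous (fun x => x ^ 2)). auto_derive; trivial.
  - apply continuity_pt_filterlim, continuity_pt_sqrt. nra.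
Qed.

Lemma C2cont_const c : C2cont (fun _ _ => c).
Proof. intros x y; split; apply continuity_2d_pt_const. Qed.

Lemma C2cont_plus f g : C2cont f -> C2cont g -> C2cont (fun x y => (f x y + g x y)%C).
Proof.
  intros Hf Hg x y; destruct (Hf x y), (Hg x y); split; simpl; apply continuity_2d_pt_plus; assumption.
Qed.

Lemma C2cont_mult f g : C2cont f -> C2cont g -> C2cont (fun x y => (f x y * g x y)%C).
Proof.
  intros Hf Hg x y; destruct (Hf x y), (Hg x y); split; simpl.
  - apply continuity_2d_pt_minus; apply continuity_2d_pt_mult; assumption.
  - apply continuity_2d_pt_plus; apply continuity_2d_pt_mult; assumption.
Qed.

Lemma C2cont_csum (f : nat -> R -> R -> C) n :
  (forall i, C2cont (f i)) -> C2cont (fun x y => csum (fun i => f i x y) n).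
Proof.
  intros Hf. induction n as [|n IH]; simpl; [apply C2cont_const|].
  apply C2cont_plus; [exact IH|apply Hf].
Qed.

Lemma C2cont_Cexp f : C2cont f -> C2cont (fun x y => Cexp (f x y)).
Proof.
  intros Hf x y; destruct (Hf x y) as [H1 H2].
  assert (He : continuity_2d_pt (fun u v => exp (fst (f u v))) x y).
  { apply (continuity_1d_2d_pt_comp exp (fun u v => fst (f u v))); [|exact H1].
    apply derivable_continuous_pt, derivable_pt_exp. }
  split; simpl; apply continuity_2d_pt_mult; try exact He.
  - apply (continuity_1d_2d_pt_comp cos (fun u v => snd (f u v))); [|exact H2]. apply continuity_cos.
  - apply (continuity_1d_2d_pt_comp sin (fun u v => snd (f u v))); [|exact H2]. apply continuity_sin.
Qed.

Lemma C2cont_fst (f : R -> C) : Ccont f -> C2cont (fun x _ => f x).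
Proof.
  intros Hf x y; destruct (Hf x) as [H1 H2]; split.
  - apply (continuity_1d_2d_pt_comp (fun x => fst (f x)) (fun u v => u)); [|apply continuity_2d_pt_id1].
    apply continuity_pt_filterlim, H1.
  - apply (continuity_1d_2d_pt_comp (fun x => snd (f x)) (fun u v => u)); [|apply continuity_2d_pt_id1].
    apply continuity_pt_filterlim, H2.
Qed.

Lemma C2cont_snd (f : R -> C) : Ccont f -> C2cont (fun _ y => f y).
Proof.
  intros Hf x y; destruct (Hf y) as [H1 H2]; split.
  - apply (continuity_1d_2d_pt_comp (fun x => fst (f x)) (fun u v => v)); [|apply continuity_2d_pt_id2].
    apply continuity_pt_filterlim, H1.
  - apply (continuity_1d_2d_pt_comp (fun x => snd (f x)) (fun u v => v)); [|apply continuity_2d_pt_id2].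
    apply continuity_pt_filterlim, H2.
Qed.

(** * Means over the circle *)

Definition Rmean (f : R -> R) : R := / (2 * PI) * RInt f (- PI) PI.
Definition Cmean (f : R -> C) : C := (RtoC (/ (2 * PI)) * CRInt f (- PI)%R PI)%C.

Lemma Cmean_components f : Cmean f = (Rmean (fun t => fst (f t)), Rmean (fun t => snd (f t))).
Proof. unfold Cmean, Rmean, CRInt, Cmult, RtoC; simpl. f_equal; ring. Qed.

Lemma PI_pos2 : 0 < 2 * PI.
Proof. pose proof PI_RGT_0; lra. Qed.

Lemma PI_le : - PI <= PI.
Proof. pose proof PI_RGT_0; lra. Qed.

Lemma ex_RInt_cont (f : R -> R) a b : (forall t, continuous f t) -> ex_RInt f a b.
Proof. intros H. apply (ex_RInt_continuous f). intros; apply H. Qed.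

Lemma Rmean_ext f g : (forall t, - PI <= t <= PI -> f t = g t) -> Rmean f = Rmean g.
Proof.
  intros H. unfold Rmean. f_equal. apply RInt_ext. intros x Hx.
  rewrite Rmin_left, Rmax_right in Hx by apply PI_le. apply H; lra.
Qed.

Lemma Cmean_ext f g : (forall t, - PI <= t <= PI -> f t = g t) -> Cmean f = Cmean g.
Proof.
  intros H. rewrite !Cmean_components. f_equal; apply Rmean_ext; intros; rewrite H; auto.
Qed.

Lemma Rmean_plus f g : (forall t, continuous f t) -> (forall t, continuous g t) ->
  Rmean (fun t => f t + g t) = Rmean f + Rmean g.
Proof.
  intros Hf Hg. unfold Rmean. rewrite <- Rmult_plus_distr_l. f_equal.
  apply (RInt_plus f g); apply ex_RInt_cont; assumption.
Qed.

Lemma Rmean_scal c f : (forall t, continuous f t) -> Rmean (fun t => c * f t) = c * Rmean f.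
Proof.
  intros Hf. unfold Rmean.
  replace (RInt (fun t => c * f t) (- PI) PI) with (c * RInt f (- PI) PI); [ring|].
  symmetry. apply (RInt_scal f (- PI) PI c). apply ex_RInt_cont, Hf.
Qed.

Lemma Rmean_const c : Rmean (fun _ => c) = c.
Proof.
  unfold Rmean. rewrite RInt_const. unfold scal; simpl; unfold mult; simpl.
  pose proof PI_pos2. field. pose proof PI_RGT_0; lra.
Qed.

Lemma Rmean_le f g : (forall t, continuous f t) -> (forall t, continuous g t) ->
  (forall t, - PI <= t <= PI -> f t <= g t) -> Rmean f <= Rmean g.
Proof.
  intros Hf Hg H. unfold Rmean. apply Rmult_le_compat_l.
  - apply Rlt_le, Rinv_0_lt_compat, PI_pos2.
  - apply RInt_le; [apply PI_le| | |]; try (apply ex_RInt_cont; assumption).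
    intros; apply H; lra.
Qed.

Lemma Rmean_ge0 f : (forall t, continuous f t) -> (forall t, 0 <= f t) -> 0 <= Rmean f.
Proof.
  intros Hf H. rewrite <- (Rmean_const 0). apply Rmean_le; auto. intros; apply continuous_const.
Qed.

Lemma Cmean_plus f g : Ccont f -> Ccont g ->
  Cmean (fun t => (f t + g t)%C) = (Cmean f + Cmean g)%C.
Proof.
  intros Hf Hg. rewrite !Cmean_components. unfold Cplus; simpl.
  f_equal; apply Rmean_plus; intros t.
  - exact (proj1 (Hf t)).
  - exact (proj1 (Hg t)).
  - exact (proj2 (Hf t)).
  - exact (proj2 (Hg t)).
Qed.

Lemma Cmean_scal c f : Ccont f -> Cmean (fun t => (c * f t)%C) = (c * Cmean f)%C.
Proof.
  intros Hf. rewrite !Cmean_components. unfold Cmult; simpl.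
  assert (Hs : forall r, (forall t, continuous (fun t => r * fst (f t)) t) /\
                         (forall t, continuous (fun t => r * snd (f t)) t)).
  { intros r; split; intros t; apply continuous_Rmult; try apply continuous_const; apply Hf. }
  f_equal.
  - rewrite (Rmean_ext _ (fun t => fst c * fst (f t) + (- snd c) * snd (f t))) by (intros; ring).
    rewrite Rmean_plus by apply Hs. rewrite !Rmean_scal by (intros; apply Hf). ring.
  - rewrite Rmean_plus by apply Hs. rewrite !Rmean_scal by (intros; apply Hf). ring.
Qed.

Lemma Cmean_opp f : Ccont f -> Cmean (fun t => (- f t)%C) = (- Cmean f)%C.
Proof.
  intros Hf. rewrite (Cmean_ext _ (fun t => (- RtoC 1 * f t)%C)) by (intros; ring).
  rewrite Cmean_scal by exact Hf. ring.
Qed.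

Lemma Cmean_minus f g : Ccont f -> Ccont g ->
  Cmean (fun t => (f t - g t)%C) = (Cmean f - Cmean g)%C.
Proof.
  intros Hf Hg. unfold Cminus. rewrite Cmean_plus; [|exact Hf|apply Ccont_opp, Hg].
  rewrite Cmean_opp by exact Hg. reflexivity.
Qed.

Lemma Cmean_const c : Cmean (fun _ => c) = c.
Proof. rewrite Cmean_components, !Rmean_const. destruct c; reflexivity. Qed.

Lemma Cmean_conj f : Ccont f -> Cmean (fun t => Cconj (f t)) = Cconj (Cmean f).
Proof.
  intros Hf. rewrite !Cmean_components. unfold Cconj; simpl. f_equal.
  rewrite (Rmean_ext _ (fun t => (-1) * snd (f t))) by (intros; ring).
  rewrite Rmean_scal by (intros; apply Hf). ring.
Qed.

Lemma Cmean_csum (f : nat -> R -> C) n : (forall i, Ccont (f i)) ->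
  Cmean (fun t => csum (fun i => f i t) n) = csum (fun i => Cmean (f i)) n.
Proof.
  intros Hf. induction n as [|n IH]; simpl; [apply Cmean_const|].
  rewrite Cmean_plus; [rewrite IH; reflexivity|apply Ccont_csum, Hf|apply Hf].
Qed.

Lemma Cmean_RtoC f : Cmean (fun t => RtoC (f t)) = RtoC (Rmean f).
Proof. rewrite Cmean_components; simpl. rewrite Rmean_const. reflexivity. Qed.

(* Rotating [Cmean f] onto the positive axis reduces this to a real inequality. *)
Lemma Cmod_Cmean_le f : Ccont f -> Cmod (Cmean f) <= Rmean (fun t => Cmod (f t)).
Proof.
  intros Hf. set (w := Cmean f).
  assert (H : Cmod w ^ 2 <= Cmod w * Rmean (fun t => Cmod (f t))).
  { assert (Hr : RtoC (Cmod w ^ 2) = Cmean (fun t => (Cconj w * f t)%C)).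
    { rewrite Cmean_scal by exact Hf. fold w. rewrite <- Cmult_conj_r. ring. }
    apply (f_equal fst) in Hr. rewrite Cmean_components in Hr.
    change (Cmod w ^ 2 = Rmean (fun t => fst (Cconj w * f t)%C)) in Hr. rewrite Hr.
    rewrite <- Rmean_scal by (apply continuous_Cmod, Hf).
    assert (Hc : Ccont (fun t => (Cconj w * f t)%C)) by (apply Ccont_mult; [apply Ccont_const|exact Hf]).
    apply Rmean_le.
    - intros t. apply (Hc t).
    - intros t. apply continuous_Rmult; [apply continuous_const|apply continuous_Cmod, Hf].
    - intros t _. eapply Rle_trans; [apply Rle_abs|].
      eapply Rle_trans; [apply (Rabs_fst_le (Cconj w * f t)%C)|].
      rewrite Cmod_mult, Cmod_conj. lra. }
  pose proof (Cmod_ge_0 w) as Hw. destruct (Rle_lt_or_eq_dec _ _ Hw) as [Hp|Hz].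
  - apply Rmult_le_reg_l with (Cmod w); [exact Hp|]. nra.
  - rewrite <- Hz. apply Rmean_ge0; [apply continuous_Cmod, Hf|intros; apply Cmod_ge_0].
Qed.

Lemma Cmod_Cmean_bound f M : Ccont f -> (forall t, - PI <= t <= PI -> Cmod (f t) <= M) ->
  Cmod (Cmean f) <= M.
Proof.
  intros Hf H. eapply Rle_trans; [apply Cmod_Cmean_le, Hf|].
  rewrite <- (Rmean_const M). apply Rmean_le; [apply continuous_Cmod, Hf|intros; apply
      continuous_const|exact H].
Qed.

(** * The L^2 norm on the circle *)

Definition nrm (f : R -> C) : R := sqrt (Rmean (fun t => Cmod (f t) ^ 2)).

Lemma continuous_Cmod_sqr f : Ccont f -> forall t, continuous (fun x => Cmod (f x) ^ 2) t.
Proof.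
  intros Hf t. simpl. apply continuous_Rmult; [|apply continuous_Rmult; [|apply continuous_const]];
  apply continuous_Cmod, Hf.
Qed.

Lemma nrm_ge0 f : 0 <= nrm f.
Proof. apply sqrt_pos. Qed.

Lemma nrm_sqr f : Ccont f -> nrm f ^ 2 = Rmean (fun t => Cmod (f t) ^ 2).
Proof.
  intros Hf. unfold nrm. rewrite pow2_sqrt; [reflexivity|].
  apply Rmean_ge0; [apply continuous_Cmod_sqr, Hf|intros; apply pow2_ge_0].
Qed.

Lemma nrm_ext f g : (forall t, - PI <= t <= PI -> Cmod (f t) = Cmod (g t)) -> nrm f = nrm g.
Proof. intros H. unfold nrm. f_equal. apply Rmean_ext. intros; rewrite H; auto. Qed.

Lemma nrm_sqr_Cmean f : Ccont f -> RtoC (nrm f ^ 2) = Cmean (fun t => (f t * Cconj (f t))%C).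
Proof.
  intros Hf. rewrite nrm_sqr, <- Cmean_RtoC by exact Hf.
  apply Cmean_ext. intros; symmetry; apply Cmult_conj_r.
Qed.

(** Averaging (x |f| - y |g|)^2 >= 0 gives the quadratic inequality [Hq] for all weights x, y; the
    result follows by choosing the weights. *)
Lemma Rmean_cauchy_schwarz f g : Ccont f -> Ccont g ->
  Rmean (fun t => Cmod (f t) * Cmod (g t)) <= nrm f * nrm g.
Proof.
  intros Hf Hg.
  set (a := nrm f). set (b := nrm g). set (c := Rmean (fun t => Cmod (f t) * Cmod (g t))).
  assert (Ha := nrm_ge0 f). assert (Hb := nrm_ge0 g). fold a in Ha. fold b in Hb.
  pose proof (continuous_Cmod _ Hf) as Cf. pose proof (continuous_Cmod _ Hg) as Cg.
  assert (Cfg : forall t, continuous (fun t => Cmod (f t) * Cmod (g t)) t)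
    by (intros; apply continuous_Rmult; auto).
  assert (Hq : forall x y, 2 * x * y * c <= x ^ 2 * a ^ 2 + y ^ 2 * b ^ 2).
  { intros x y. unfold a, b, c. rewrite !nrm_sqr by assumption.
    rewrite <- !Rmean_scal by (assumption || (apply continuous_Cmod_sqr; assumption)).
    assert (C1 : forall r h, Ccont h -> forall t, continuous (fun t => r * Cmod (h t) ^ 2) t).
    { intros; apply continuous_Rmult; [apply continuous_const|apply continuous_Cmod_sqr; assumption]. }
    rewrite <- Rmean_plus by (apply C1; assumption).
    apply Rmean_le.
    - intros. apply continuous_Rmult; [apply continuous_const|apply Cfg].
    - intros. apply continuous_Rplus; apply C1; assumption.
    - intros t _. pose proof (pow2_ge_0 (x * Cmod (f t) - y * Cmod (g t))). nra. }
  assert (Hc : 0 <= c).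
  { apply Rmean_ge0; [exact Cfg|]. intros t. apply Rmult_le_pos; apply Cmod_ge_0. }
  destruct (Rle_lt_or_eq_dec _ _ Ha) as [Ha'|Ha']; [destruct (Rle_lt_or_eq_dec _ _ Hb) as [Hb'|Hb']|].
  (* These weights make both sides multiples of a b: 2 a b c <= 2 a^2 b^2. *)
  - pose proof (Hq b a) as H. assert (Hab : 0 < a * b) by nra. nra.
  - destruct (Rle_lt_or_eq_dec _ _ Hc) as [Hc'|Hc']; [|rewrite <- Hc'; nra].
    (* When b = 0 the weight y is free on the right-hand side; this choice would give 2 (a^2 + 1) <=
       a^2, so c > 0 is impossible. *)
    pose proof (Hq 1 ((a ^ 2 + 1) / c)) as H. rewrite <- Hb' in H.
    replace (2 * 1 * ((a ^ 2 + 1) / c) * c) with (2 * (a ^ 2 + 1)) in H by (field; lra). nra.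
  - destruct (Rle_lt_or_eq_dec _ _ Hc) as [Hc'|Hc']; [|rewrite <- Hc'; nra].
    pose proof (Hq ((b ^ 2 + 1) / c) 1) as H. rewrite <- Ha' in H.
    replace (2 * ((b ^ 2 + 1) / c) * 1 * c) with (2 * (b ^ 2 + 1)) in H by (field; lra). nra.
Qed.

Lemma Cmod_Cmean_mult_le f g : Ccont f -> Ccont g ->
  Cmod (Cmean (fun t => (f t * g t)%C)) <= nrm f * nrm g.
Proof.
  intros Hf Hg. eapply Rle_trans; [apply Cmod_Cmean_le, Ccont_mult; assumption|].
  rewrite (Rmean_ext _ (fun t => Cmod (f t) * Cmod (g t))) by (intros; apply Cmod_mult).
  apply Rmean_cauchy_schwarz; assumption.
Qed.

Lemma nrm_bound f M : Ccont f -> 0 <= M -> (forall t, - PI <= t <= PI -> Cmod (f t) <= M) -> nrm f <= M.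
Proof.
  intros Hf HM H. rewrite <- (sqrt_pow2 M) by exact HM. apply sqrt_le_1_alt.
  rewrite <- (Rmean_const (M ^ 2)).
  apply Rmean_le; [apply continuous_Cmod_sqr, Hf|intros; apply continuous_const|].
  intros t Ht. apply pow_incr. split; [apply Cmod_ge_0|apply H, Ht].
Qed.

Lemma nrm_triangle f g : Ccont f -> Ccont g -> nrm (fun t => (f t + g t)%C) <= nrm f + nrm g.
Proof.
  intros Hf Hg. pose proof (nrm_ge0 f). pose proof (nrm_ge0 g).
  apply Rsqr_incr_0_var; [|lra]. rewrite !Rsqr_pow2.
  rewrite nrm_sqr by (apply Ccont_plus; assumption).
  apply Rle_trans with (Rmean (fun t => (Cmod (f t) ^ 2 + Cmod (g t) ^ 2) + 2 * (Cmod (f t) * Cmod (g t)))).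
  - apply Rmean_le.
    + apply continuous_Cmod_sqr, Ccont_plus; assumption.
    + intros t. apply continuous_Rplus; [apply continuous_Rplus; apply continuous_Cmod_sqr; assumption|].
      apply continuous_Rmult; [apply continuous_const|apply continuous_Rmult; apply continuous_Cmod;
          assumption].
    + intros t _. pose proof (Cmod_triangle (f t) (g t)). pose proof (Cmod_ge_0 (f t + g t)%C).
      assert (Cmod (f t + g t) ^ 2 <= (Cmod (f t) + Cmod (g t)) ^ 2) by (apply pow_incr; lra). nra.
  - assert (C1 : forall t, continuous (fun t => Cmod (f t) * Cmod (g t)) t)
      by (intros; apply continuous_Rmult; apply continuous_Cmod; assumption).
    rewrite Rmean_plus, Rmean_plus, Rmean_scal; auto; try (apply continuous_Cmod_sqr; assumption).
    + rewrite <- !nrm_sqr by assumption. pose proof (Rmean_cauchy_schwarz f g Hf Hg). nra.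
    + intros; apply continuous_Rplus; apply continuous_Cmod_sqr; assumption.
    + intros; apply continuous_Rmult; [apply continuous_const|apply C1].
Qed.

(** The fundamental theorem of calculus over a period. It yields the orthogonality of the
    exponentials, integration by parts for Fourier coefficients, and the Stokes argument in
    [Cmean_wave_CD]. *)
Lemma Cmean_derive_periodic F dF : (forall t, CD F t (dF t)) -> Ccont dF ->
  F PI = F (- PI) -> Cmean dF = RtoC 0.
Proof.
  intros HF Hc Hp. rewrite Cmean_components. unfold Rmean.
  assert (H1 : RInt (fun t => fst (dF t)) (- PI) PI = 0).
  { transitivity (fst (F PI) - fst (F (- PI))); [|rewrite Hp; apply Rplus_opp_r].
    apply is_RInt_unique, (is_RInt_derive (fun t => fst (F t))); intros; [apply HF|apply Hc]. }
  assert (H2 : RInt (fun t => snd (dF t)) (- PI) PI = 0).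
  { transitivity (snd (F PI) - snd (F (- PI))); [|rewrite Hp; apply Rplus_opp_r].
    apply is_RInt_unique, (is_RInt_derive (fun t => snd (F t))); intros; [apply HF|apply Hc]. }
  rewrite H1, H2. unfold RtoC. f_equal; ring.
Qed.

Lemma CD_Cmean_param (P dP : R -> R -> C) t :
  (forall x y, CD (fun x => P x y) x (dP x y)) -> C2cont dP -> (forall x, Ccont (P x)) ->
  CD (fun x => Cmean (P x)) t (Cmean (dP t)).
Proof.
  intros HD Hc HP. rewrite Cmean_components.
  split; cbn [fst snd].
  - apply is_derive_ext with (fun x => / (2 * PI) * RInt (fun y => fst (P x y)) (- PI) PI).
    { intros x. rewrite Cmean_components. reflexivity. }
    unfold Rmean. apply (is_derive_scal (fun x => RInt (fun y => fst (P x y)) (- PI) PI)).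
    rewrite (RInt_ext _ (fun y => Derive (fun u => fst (P u y)) t)).
    2:{ intros y _. symmetry. apply is_derive_unique, HD. }
    apply (is_derive_RInt_param (fun x y => fst (P x y))).
    + apply filter_forall. intros x y _. exists (fst (dP x y)). apply HD.
    + intros y _. apply continuity_2d_pt_ext with (fun u v => fst (dP u v)); [|apply Hc].
      intros u v. symmetry. apply is_derive_unique, HD.
    + apply filter_forall. intros x. apply ex_RInt_cont. intros; apply HP.
  - apply is_derive_ext with (fun x => / (2 * PI) * RInt (fun y => snd (P x y)) (- PI) PI).
    { intros x. rewrite Cmean_components. reflexivity. }
    unfold Rmean. apply (is_derive_scal (fun x => RInt (fun y => snd (P x y)) (- PI) PI)).
    rewrite (RInt_ext _ (fun y => Derive (fun u => snd (P u y)) t)).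
    2:{ intros y _. symmetry. apply is_derive_unique, HD. }
    apply (is_derive_RInt_param (fun x y => snd (P x y))).
    + apply filter_forall. intros x y _. exists (snd (dP x y)). apply HD.
    + intros y _. apply continuity_2d_pt_ext with (fun u v => snd (dP u v)); [|apply Hc].
      intros u v. symmetry. apply is_derive_unique, HD.
    + apply filter_forall. intros x. apply ex_RInt_cont. intros; apply HP.
Qed.

(** * Absolutely convergent complex series *)

Definition Clim (u : nat -> C) (l : C) : Prop :=
  forall eps, 0 < eps -> exists M0, forall M, (M0 <= M)%nat -> Cmod (u M - l) < eps.

(** Componentwise, so that [Nfun] is an instance by conversion. [Series] is a total function, hence
    the value is meaningful only together with [summable]. *)
Definition CSeries (a : nat -> C) : C :=
  (Series (fun j => fst (a j)), Series (fun j => snd (a j))).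

Definition summable (a : nat -> C) : Prop := ex_series (fun j => Cmod (a j)).

Lemma Clim_unique u l l' : Clim u l -> Clim u l' -> l = l'.
Proof.
  intros H H'. apply Ceq_minus. apply Cmod_eq_0.
  destruct (Req_dec (Cmod (l - l')) 0) as [E|E]; [exact E|exfalso].
  pose proof (Cmod_ge_0 (l - l')%C).
  destruct (H (Cmod (l - l') / 2)) as [M1 H1]; [lra|].
  destruct (H' (Cmod (l - l') / 2)) as [M2 H2]; [lra|].
  specialize (H1 (M1 + M2)%nat ltac:(lia)). specialize (H2 (M1 + M2)%nat ltac:(lia)).
  set (x := u (M1 + M2)%nat) in *.
  assert (Cmod (l - l') <= Cmod (x - l) + Cmod (x - l')).
  { rewrite (Cmod_minus_sym x l). replace (l - l')%C with (l - x + (x - l'))%C by ring.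
    apply Cmod_triangle. }
  lra.
Qed.

Lemma Clim_plus u v l m : Clim u l -> Clim v m -> Clim (fun n => (u n + v n)%C) (l + m)%C.
Proof.
  intros Hu Hv eps He.
  destruct (Hu (eps / 2)) as [M1 H1]; [lra|]. destruct (Hv (eps / 2)) as [M2 H2]; [lra|].
  exists (M1 + M2)%nat. intros M HM. specialize (H1 M ltac:(lia)). specialize (H2 M ltac:(lia)).
  replace (u M + v M - (l + m))%C with (u M - l + (v M - m))%C by ring.
  eapply Rle_lt_trans; [apply Cmod_triangle|]. lra.
Qed.

Lemma ex_series_bounded (r : nat -> R) B : (forall j, 0 <= r j) ->
  (forall n, rsum r n <= B) -> ex_series r.
Proof.
  intros Hp HB.
  destruct (Un_cv_crit (sum_f_R0 r)) as [l Hl].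
  - intros n. simpl. pose proof (Hp (S n)). lra.
  - exists B. intros x [n ->]. rewrite <- sum_n_Reals, sum_n_rsum. apply HB.
  - exists l. apply is_series_Reals. exact Hl.
Qed.

Lemma is_series_rsum (r : nat -> R) : ex_series r ->
  forall eps, 0 < eps -> exists M0, forall M, (M0 <= M)%nat -> Rabs (Series r - rsum r M) < eps.
Proof.
  intros Hr eps He. pose proof (Series_correct r Hr) as H.
  apply is_series_Reals in H. destruct (H eps He) as [M0 HM].
  exists (S M0). intros M HM'. destruct M as [|M]; [lia|].
  specialize (HM M ltac:(lia)). rewrite <- sum_n_Reals, sum_n_rsum in HM.
  unfold Rdist in HM. rewrite Rabs_minus_sym. exact HM.
Qed.

Lemma rsum_le_Series (r : nat -> R) M : (forall j, 0 <= r j) -> ex_series r -> rsum r M <= Series r.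
Proof.
  intros Hp Hr. destruct (Rle_dec (rsum r M) (Series r)) as [H|H]; [exact H|exfalso].
  destruct (is_series_rsum r Hr (rsum r M - Series r)) as [M0 H0]; [lra|].
  specialize (H0 (M0 + M)%nat ltac:(lia)).
  pose proof (rsum_mono r M (M0 + M) Hp ltac:(lia)).
  rewrite Rabs_minus_sym, Rabs_pos_eq in H0 by lra. lra.
Qed.

Lemma ex_series_Cmod_le (a : nat -> C) r : (forall j, Cmod (a j) <= r j) -> ex_series r -> summable a.
Proof.
  intros Ha Hr. unfold summable.
  apply (ex_series_le (fun j => Cmod (a j)) r); [|exact Hr].
  intros n. unfold norm; simpl; unfold abs; simpl. rewrite Rabs_pos_eq by apply Cmod_ge_0. apply Ha.
Qed.

Lemma CSeries_lim a : summable a -> Clim (csum a) (CSeries a).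
Proof.
  intros Ha eps He.
  assert (E1 : ex_series (fun j => fst (a j))).
  { apply (ex_series_le (fun j => fst (a j)) (fun j => Cmod (a j))); [|exact Ha].
    intros n. apply Rabs_fst_le. }
  assert (E2 : ex_series (fun j => snd (a j))).
  { apply (ex_series_le (fun j => snd (a j)) (fun j => Cmod (a j))); [|exact Ha].
    intros n. apply Rabs_snd_le. }
  destruct (is_series_rsum _ E1 (eps / 2)) as [M1 H1]; [lra|].
  destruct (is_series_rsum _ E2 (eps / 2)) as [M2 H2]; [lra|].
  exists (M1 + M2)%nat. intros M HM.
  eapply Rle_lt_trans; [apply Cmod_le_abs|].
  change (fst (csum a M - CSeries a)%C) with (fst (csum a M) - Series (fun j => fst (a j))).
  change (snd (csum a M - CSeries a)%C) with (snd (csum a M) - Series (fun j => snd (a j))).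
  rewrite csum_re, csum_im.
  specialize (H1 M ltac:(lia)). specialize (H2 M ltac:(lia)).
  rewrite Rabs_minus_sym in H1. rewrite Rabs_minus_sym in H2. lra.
Qed.

(** The finite block from M to M + M0 is dominated by the same block of [r], which is below the tail
    of [Series r]; then M0 goes to infinity. *)
Lemma CSeries_tail a r M : (forall j, Cmod (a j) <= r j) -> ex_series r ->
  Cmod (CSeries a - csum a M) <= Series r - rsum r M.
Proof.
  intros Ha Hr.
  assert (Hp : forall j, 0 <= r j) by (intros j; eapply Rle_trans; [apply Cmod_ge_0|apply Ha]).
  apply Rle_plus_epsilon. intros eps He.
  destruct (CSeries_lim a (ex_series_Cmod_le a r Ha Hr) eps He) as [M0 H0].
  specialize (H0 (M + M0)%nat ltac:(lia)).
  replace (CSeries a - csum a M)%C with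
    (CSeries a - csum a (M + M0) + (csum a (M + M0) - csum a M))%C by ring.
  eapply Rle_trans; [apply Cmod_triangle|]. rewrite Cmod_minus_sym.
  assert (Cmod (csum a (M + M0) - csum a M) <= Series r - rsum r M); [|lra].
  rewrite csum_app.
  replace (csum a M + csum (fun i => a (M + i)%nat) M0 - csum a M)%C
    with (csum (fun i => a (M + i)%nat) M0) by ring.
  eapply Rle_trans; [apply Cmod_csum|].
  eapply Rle_trans; [apply rsum_le; intros i _; apply Ha|].
  pose proof (rsum_le_Series r (M + M0) Hp Hr) as H. rewrite rsum_app in H. lra.
Qed.

Lemma Cmod_CSeries_le a r : (forall j, Cmod (a j) <= r j) -> ex_series r ->
  Cmod (CSeries a) <= Series r.
Proof.
  intros Ha Hr. pose proof (CSeries_tail a r 0 Ha Hr) as H. simpl in H.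
  replace (CSeries a - RtoC 0)%C with (CSeries a) in H by ring. lra.
Qed.

Lemma CSeries_ext a b : (forall j, a j = b j) -> CSeries a = CSeries b.
Proof.
  intros H. unfold CSeries. f_equal; apply Series_ext; intros; rewrite H; reflexivity.
Qed.

Lemma CSeries_mult_l c a : summable a -> CSeries (fun j => (c * a j)%C) = (c * CSeries a)%C.
Proof.
  intros Ha.
  assert (Hca : summable (fun j => (c * a j)%C)).
  { apply ex_series_Cmod_le with (fun j => Cmod c * Cmod (a j)).
    - intros j. rewrite Cmod_mult. lra.
    - apply (ex_series_scal_l (Cmod c) (fun j => Cmod (a j))), Ha. }
  apply (Clim_unique (csum (fun j => (c * a j)%C))); [apply CSeries_lim, Hca|].
  intros eps He. pose proof (Cmod_ge_0 c).
  destruct (CSeries_lim a Ha (eps / (Cmod c + 1))) as [M0 H0].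
  { apply Rdiv_lt_0_compat; lra. }
  exists M0. intros M HM. specialize (H0 M HM). rewrite csum_mult_l.
  replace (c * csum a M - c * CSeries a)%C with (c * (csum a M - CSeries a))%C by ring.
  rewrite Cmod_mult. pose proof (Cmod_ge_0 (csum a M - CSeries a)%C).
  apply Rle_lt_trans with ((Cmod c + 1) * Cmod (csum a M - CSeries a)); [nra|].
  apply Rlt_le_trans with ((Cmod c + 1) * (eps / (Cmod c + 1))).
  - apply Rmult_lt_compat_l; lra.
  - right. field. lra.
Qed.

Lemma CSeries_conj a : CSeries (fun j => Cconj (a j)) = Cconj (CSeries a).
Proof.
  unfold CSeries, Cconj; simpl. f_equal. apply Series_opp.
Qed.

(** * Fourier coefficients *)

Definition four (f : R -> C) (j : Z) : C := Cmean (fun t => (f t * eith (- IZR j * t))%C).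

Lemma eith_2PI_Z (j : Z) : eith (IZR j * (2 * PI)) = RtoC 1.
Proof.
  assert (Hn : forall n, eith (INR n * (2 * PI)) = RtoC 1).
  { intros n. rewrite <- eith_pow. replace (eith (2 * PI)) with (RtoC 1).
    - apply Cpow_1_l.
    - unfold eith. rewrite cos_2PI, sin_2PI. reflexivity. }
  destruct (Z_le_gt_dec 0 j) as [H|H].
  - rewrite <- (Z2Nat.id j H), <- INR_IZR_INZ. apply Hn.
  - replace (IZR j * (2 * PI)) with (- (INR (Z.to_nat (- j)) * (2 * PI))).
    + rewrite <- eith_conj, Hn. apply Cconj_RtoC.
    + rewrite INR_IZR_INZ, Z2Nat.id by lia. rewrite opp_IZR. ring.
Qed.

Lemma eith_endpoints (j : Z) : eith (IZR j * PI) = eith (IZR j * - PI).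
Proof.
  replace (IZR j * PI) with (IZR j * - PI + IZR j * (2 * PI)) by ring.
  rewrite eith_plus, eith_2PI_Z. ring.
Qed.

Lemma Cmean_eith (j : Z) : j <> 0%Z -> Cmean (fun t => eith (IZR j * t)) = RtoC 0.
Proof.
  intros Hj. assert (Hj' : IZR j <> 0) by (apply not_0_IZR, Hj).
  apply (Cmean_derive_periodic (fun t => ((0, - / IZR j)%R * eith (IZR j * t))%C)).
  - intros t. eapply CD_eq; [apply CD_mult; [apply CD_const|apply CD_eith]|].
    unfold Cmult, Cplus, RtoC; simpl. unfold eith; simpl. f_equal; field; exact Hj'.
  - apply Ccont_eith.
  - f_equal. apply eith_endpoints.
Qed.

Lemma Cmean_eith_0 : Cmean (fun t => eith (IZR 0 * t)) = RtoC 1.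
Proof.
  rewrite (Cmean_ext _ (fun _ => RtoC 1)); [apply Cmean_const|].
  intros. rewrite Rmult_0_l. apply eith_0.
Qed.

Lemma Ccont_four_integrand f j : Ccont f -> Ccont (fun t => (f t * eith (- IZR j * t))%C).
Proof. intros Hf. apply Ccont_mult; [exact Hf|apply Ccont_eith]. Qed.

(** A window of frequencies j0, ..., j0 + M - 1 with arbitrary start: j0 = 0 covers polynomials on
    the circle, j0 = 1 strictly positive modes, and j0 = -n the function z^{-n} pi_n. *)
Definition trig (j0 : Z) (c : nat -> C) (M : nat) (t : R) : C :=
  csum (fun i => (c i * eith (IZR (j0 + Z.of_nat i) * t))%C) M.

Lemma Ccont_trig j0 c M : Ccont (trig j0 c M).
Proof.
  apply (Ccont_csum (fun i t => (c i * eith (IZR (j0 + Z.of_nat i) * t))%C)).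
  intros i. apply Ccont_mult; [apply Ccont_const|apply Ccont_eith].
Qed.

Lemma four_trig j0 c M l : (l < M)%nat -> four (trig j0 c M) (j0 + Z.of_nat l) = c l.
Proof.
  intros Hl. unfold four.
  rewrite (Cmean_ext _ (fun t => csum (fun i => (c i * eith (IZR (Z.of_nat i - Z.of_nat l) * t))%C) M)).
  2:{ intros t _. unfold trig. rewrite <- csum_mult_r. apply csum_ext. intros i _.
      rewrite <- Cmult_assoc, <- eith_plus. do 2 f_equal.
      rewrite minus_IZR, !plus_IZR. ring. }
  rewrite (Cmean_csum (fun i t => (c i * eith (IZR (Z.of_nat i - Z.of_nat l) * t))%C)).
  2:{ intros i. apply Ccont_mult; [apply Ccont_const|apply Ccont_eith]. }
  rewrite (csum_delta _ M l Hl).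
  - rewrite Cmean_scal by apply Ccont_eith. rewrite Z.sub_diag, Cmean_eith_0. ring.
  - intros i _ Hi. rewrite Cmean_scal by apply Ccont_eith. rewrite Cmean_eith by lia. ring.
Qed.

Lemma Cmean_mult_conj_trig f j0 c M : Ccont f ->
  Cmean (fun t => (f t * Cconj (trig j0 c M t))%C) =
  csum (fun i => (Cconj (c i) * four f (j0 + Z.of_nat i))%C) M.
Proof.
  intros Hf.
  rewrite (Cmean_ext _ (fun t => csum (fun i => (Cconj (c i) * (f t * eith (- IZR (j0 + Z.of_nat i) *
      t)))%C) M)).
  2:{ intros t _. unfold trig. rewrite csum_conj, <- csum_mult_l. apply csum_ext. intros i _.
      rewrite Cmult_conj, eith_conj, Ropp_mult_distr_l. ring. }
  rewrite (Cmean_csum (fun i t => (Cconj (c i) * (f t * eith (- IZR (j0 + Z.of_nat i) * t)))%C)).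
  2:{ intros i. apply Ccont_mult; [apply Ccont_const|apply Ccont_four_integrand, Hf]. }
  apply csum_ext. intros i _. apply Cmean_scal, Ccont_four_integrand, Hf.
Qed.

Lemma csum_RtoC r n : csum (fun i => RtoC (r i)) n = RtoC (rsum r n).
Proof. induction n as [|n IH]; simpl; [reflexivity|]. rewrite IH, RtoC_plus. reflexivity. Qed.

Lemma parseval_trig j0 c M : nrm (trig j0 c M) ^ 2 = rsum (fun i => Cmod (c i) ^ 2) M.
Proof.
  apply RtoC_inj. rewrite nrm_sqr_Cmean by apply Ccont_trig.
  rewrite Cmean_mult_conj_trig by apply Ccont_trig.
  rewrite <- csum_RtoC. apply csum_ext. intros i Hi. rewrite four_trig by exact Hi.
  rewrite Cmult_comm. apply Cmult_conj_r.
Qed.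

(** The sum S of squares is the pairing of [f] with the trigonometric polynomial built from its own
    coefficients, whose squared norm is S by Parseval; Cauchy-Schwarz gives S <= ||f|| sqrt S. *)
Lemma bessel f j0 M : Ccont f ->
  rsum (fun i => Cmod (four f (j0 + Z.of_nat i)) ^ 2) M <= nrm f ^ 2.
Proof.
  intros Hf. set (c := fun i => four f (j0 + Z.of_nat i)).
  set (S := rsum (fun i => Cmod (four f (j0 + Z.of_nat i)) ^ 2) M).
  assert (HS : 0 <= S) by (apply rsum_ge0; intros; apply pow2_ge_0).
  assert (H1 : S <= nrm f * nrm (trig j0 c M)).
  { rewrite <- (Rabs_pos_eq S HS), <- Cmod_R.
    assert (E : RtoC S = Cmean (fun t => (f t * Cconj (trig j0 c M t))%C)).
    { rewrite Cmean_mult_conj_trig by exact Hf. unfold S. rewrite <- csum_RtoC.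
      apply csum_ext. intros i _. unfold c. rewrite Cmult_comm. symmetry; apply Cmult_conj_r. }
    rewrite E. eapply Rle_trans; [apply Cmod_Cmean_mult_le; [exact Hf|apply Ccont_conj, Ccont_trig]|].
    apply Req_le. f_equal. apply nrm_ext. intros; apply Cmod_conj. }
  pose proof (parseval_trig j0 c M) as H2. change (rsum (fun i => Cmod (c i) ^ 2) M) with S in H2.
  pose proof (nrm_ge0 f). pose proof (nrm_ge0 (trig j0 c M)).
  destruct (Rle_lt_or_eq_dec _ _ HS) as [Hp|Hz]; [|rewrite <- Hz; nra].
  assert (nrm (trig j0 c M) > 0) by nra. nra.
Qed.

Lemma four_conj f j : Ccont f -> four (fun t => Cconj (f t)) j = Cconj (four f (- j)).
Proof.
  intros Hf. unfold four. rewrite <- Cmean_conj by (apply Ccont_four_integrand, Hf).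
  apply Cmean_ext. intros t _. rewrite Cmult_conj, eith_conj. do 2 f_equal.
  rewrite opp_IZR. ring.
Qed.

Lemma four_plus f g j : Ccont f -> Ccont g ->
  four (fun t => (f t + g t)%C) j = (four f j + four g j)%C.
Proof.
  intros Hf Hg. unfold four. rewrite <- Cmean_plus by (apply Ccont_four_integrand; assumption).
  apply Cmean_ext. intros. ring.
Qed.

Lemma four_scal c f j : Ccont f -> four (fun t => (c * f t)%C) j = (c * four f j)%C.
Proof.
  intros Hf. unfold four. rewrite <- Cmean_scal by (apply Ccont_four_integrand; assumption).
  apply Cmean_ext. intros. ring.
Qed.

(** By Bessel the squared coefficients form a convergent series, so their terms tend to zero. *)
Lemma riemann_lebesgue_pos f : Ccont f -> Clim (fun n => four f (Z.of_nat n)) (RtoC 0).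
Proof.
  intros Hf eps He.
  assert (Hs : ex_series (fun i => Cmod (four f (0 + Z.of_nat i)) ^ 2)).
  { apply ex_series_bounded with (nrm f ^ 2).
    - intros; apply pow2_ge_0.
    - intros n. apply bessel, Hf. }
  apply ex_series_lim_0, is_lim_seq_spec in Hs.
  destruct (Hs (mkposreal (eps ^ 2) (pow_lt _ 2 He))) as [M0 H0].
  exists M0. intros M HM. specialize (H0 M HM). simpl pos in H0.
  rewrite Rminus_0_r, Rabs_pos_eq in H0 by apply pow2_ge_0. rewrite Z.add_0_l in H0.
  replace (four f (Z.of_nat M) - RtoC 0)%C with (four f (Z.of_nat M)) by ring.
  pose proof (Cmod_ge_0 (four f (Z.of_nat M))). nra.
Qed.

Lemma riemann_lebesgue_neg f : Ccont f -> Clim (fun n => four f (- Z.of_nat n)) (RtoC 0).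
Proof.
  intros Hf eps He.
  destruct (riemann_lebesgue_pos (fun t => Cconj (f t)) (Ccont_conj f Hf) eps He) as [M0 H0].
  exists M0. intros M HM. specialize (H0 M HM). rewrite four_conj in H0 by exact Hf.
  rewrite <- Cmod_conj, Cminus_conj, Cconj_RtoC. exact H0.
Qed.

Lemma four_derive f df j : (forall t, CD f t (df t)) -> Ccont df -> f PI = f (- PI) ->
  four df j = ((0, IZR j)%R * four f j)%C.
Proof.
  intros HD Hc Hp. assert (Hf : Ccont f) by (eapply CD_cont; exact HD).
  assert (H : Cmean (fun t => (df t * eith (- IZR j * t) + (0, - IZR j)%R * (f t * eith (- IZR j * t)))%C)
      = RtoC 0).
  { apply (Cmean_derive_periodic (fun t => (f t * eith (- IZR j * t))%C)).
    - intros t. eapply CD_eq; [apply CD_mult; [apply HD|apply CD_eith]|]. cbv beta. ring.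
    - apply Ccont_plus; [|apply Ccont_mult; [apply Ccont_const|]]; apply Ccont_four_integrand; assumption.
    - rewrite Hp. f_equal. rewrite <- opp_IZR. apply eith_endpoints. }
  pose proof (Ccont_four_integrand df j Hc) as C1. pose proof (Ccont_four_integrand f j Hf) as C2.
  rewrite (Cmean_plus _ _ C1 (Ccont_mult _ _ (Ccont_const (0, - IZR j)) C2)) in H.
  rewrite (Cmean_scal _ _ C2) in H.
  fold (four df j) in H. fold (four f j) in H.
  replace (four df j) with (RtoC 0 - (0, - IZR j)%R * four f j)%C.
  - unfold Cmult, Cminus, Cplus, Copp, RtoC; simpl. f_equal; ring.
  - rewrite <- H. ring.
Qed.

(** The shift trades the piece [-PI, -PI + a] for [PI, PI + a], over which a periodic function has
    the same integral. *)
Lemma RInt_shift_periodic (f : R -> R) a : (forall t, continuous f t) ->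
  (forall t, f (t + 2 * PI) = f t) -> RInt (fun t => f (t + a)) (- PI) PI = RInt f (- PI) PI.
Proof.
  intros Hf Hp.
  assert (Hsh : forall c x y, RInt (fun t => f (t + c)) x y = RInt f (x + c) (y + c)).
  { intros c x y.
    pose proof (RInt_comp_lin f 1 c x y) as H.
    rewrite !Rmult_1_l in H. rewrite <- H by (apply ex_RInt_cont, Hf).
    apply RInt_ext. intros t _. unfold scal; simpl; unfold mult; simpl. rewrite !Rmult_1_l. reflexivity. }
  rewrite Hsh.
  assert (E : RInt f (- PI) (- PI + a) = RInt f PI (PI + a)).
  { rewrite (RInt_ext f (fun t => f (t + 2 * PI)) (- PI)) by (intros; symmetry; apply Hp).
    rewrite Hsh. f_equal; ring. }
  assert (Ex : forall x y, ex_RInt f x y) by (intros; apply ex_RInt_cont, Hf).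
  pose proof (RInt_Chasles f (- PI) (- PI + a) (PI + a) (Ex _ _) (Ex _ _)) as H1.
  pose proof (RInt_Chasles f (- PI) PI (PI + a) (Ex _ _) (Ex _ _)) as H2.
  unfold plus in H1, H2; simpl in H1, H2. lra.
Qed.

Lemma Cmean_shift_periodic f a : Ccont f -> (forall t, f (t + 2 * PI) = f t) ->
  Cmean (fun t => f (t + a)) = Cmean f.
Proof.
  intros Hf Hp. rewrite !Cmean_components. unfold Rmean. f_equal; f_equal.
  - apply (RInt_shift_periodic (fun t => fst (f t))); [intros; apply Hf|intros; rewrite Hp; reflexivity].
  - apply (RInt_shift_periodic (fun t => snd (f t))); [intros; apply Hf|intros; rewrite Hp; reflexivity].
Qed.

Lemma Ccont_shift f a : Ccont f -> Ccont (fun t => f (t + a)).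
Proof.
  intros Hf t.
  assert (Hc : continuous (fun x => x + a) t).
  { apply continuous_Rplus; [apply continuous_id|apply continuous_const]. }
  split.
  - apply (continuous_comp (fun x => x + a) (fun x => fst (f x))); [exact Hc|apply Hf].
  - apply (continuous_comp (fun x => x + a) (fun x => snd (f x))); [exact Hc|apply Hf].
Qed.

Lemma four_shift f a j : Ccont f -> (forall t, f (t + 2 * PI) = f t) ->
  four (fun t => f (t + a)) j = (eith (IZR j * a) * four f j)%C.
Proof.
  intros Hf Hp. unfold four.
  rewrite <- (Cmean_shift_periodic (fun t => (f t * eith (- IZR j * t))%C) a).
  - rewrite <- Cmean_scal.
    + apply Cmean_ext. intros t _.
      replace (- IZR j * (t + a)) with (- IZR j * t + - (IZR j * a)) by ring.
      rewrite eith_plus.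
      replace (eith (IZR j * a) * (f (t + a)%R * (eith (- IZR j * t) * eith (- (IZR j * a)))))%C
        with (f (t + a)%R * eith (- IZR j * t) * (eith (IZR j * a) * eith (- (IZR j * a))))%C by ring.
      rewrite eith_opp_mult. ring.
    + apply (Ccont_shift (fun t => (f t * eith (- IZR j * t))%C)), Ccont_four_integrand, Hf.
  - apply Ccont_four_integrand, Hf.
  - intros t. rewrite Hp, Rmult_plus_distr_l, eith_plus, <- opp_IZR, eith_2PI_Z. ring.
Qed.

(** * Fourier inversion for C^1 functions *)

Definition slope (h : R -> R) (l t : R) : R :=
  if Req_EM_T t 0 then l else h t / t.

Lemma slope_mult h l t : h 0 = 0 -> t * slope h l t = h t.
Proof.
  intros H0. unfold slope. destruct (Req_EM_T t 0) as [->|H]; [rewrite H0; ring|].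
  field; exact H.
Qed.

Lemma continuous_slope (h : R -> R) l : (forall t, continuous h t) -> h 0 = 0 ->
  is_derive h 0 l -> forall t, continuous (slope h l) t.
Proof.
  intros Hc H0 HD t. destruct (Req_dec t 0) as [->|Ht].
  - apply is_derive_Reals in HD. apply continuity_pt_filterlim.
    intros eps He. destruct (HD eps He) as [d Hd].
    exists d. split; [apply cond_pos|]. intros x [[_ Hx] Hdx].
    unfold slope. destruct (Req_EM_T x 0) as [E|E]; [congruence|].
    destruct (Req_EM_T 0 0) as [_|E']; [|lra].
    simpl in *. unfold Rdist in *. rewrite Rminus_0_r in Hdx.
    specialize (Hd x E Hdx). rewrite Rplus_0_l, H0, Rminus_0_r in Hd. exact Hd.
  - apply continuous_ext_loc with (fun x => h x * / x).
    + exists (mkposreal (Rabs t) (Rabs_pos_lt t Ht)). intros x Hx.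
      unfold ball in Hx; simpl in Hx. unfold AbsRing_ball, abs, minus, plus, opp in Hx; simpl in Hx.
      unfold slope. destruct (Req_EM_T x 0) as [->|E]; [|reflexivity].
      rewrite Rplus_0_l, Rabs_Ropp in Hx. lra.
    + apply continuous_Rmult; [apply Hc|].
      apply continuity_pt_filterlim, continuity_pt_inv; [apply continuity_pt_id|exact Ht].
Qed.

(** The retraction of the line onto [-PI, PI], by an explicit continuous formula. [Ccont] asks for
    continuity on the whole line, while a division by sin (t/2) is legitimate only near that
    interval. *)
Definition clamp (t : R) : R := (Rabs (t + PI) - Rabs (t - PI)) / 2.

Lemma clamp_id t : - PI <= t <= PI -> clamp t = t.
Proof. intros H. unfold clamp. rewrite Rabs_pos_eq, Rabs_left1 by lra. field. Qed.

Lemma clamp_range t : - PI <= clamp t <= PI.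
Proof.
  unfold clamp. pose proof PI_RGT_0. unfold Rabs; repeat destruct Rcase_abs; lra.
Qed.

Lemma continuous_clamp t : continuous clamp t.
Proof.
  unfold clamp. apply continuous_Rmult; [|apply continuous_const].
  apply continuous_Rminus.
  - apply (continuous_comp (fun x => x + PI) Rabs); [|apply continuous_Rabs].
    apply continuous_Rplus; [apply continuous_id|apply continuous_const].
  - apply (continuous_comp (fun x => x - PI) Rabs); [|apply continuous_Rabs].
    apply continuous_Rminus; [apply continuous_id|apply continuous_const].
Qed.

(** Both [h] and sin (t/2) vanish at 0 and are differentiable there, so each is t times a continuous
    slope. The slope of sin (t/2) has no zero on [-PI, PI], and the quotient of the two slopes is
    [q]. *)
Lemma Rcont_sin_half_quotient (h : R -> R) l : (forall t, continuous h t) -> h 0 = 0 -> is_derive h 0 l ->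
  exists q, (forall t, continuous q t) /\ forall t, - PI <= t <= PI -> h t = q t * sin (t / 2).
Proof.
  intros Hc H0 HD.
  set (s := slope (fun t => sin (t / 2)) (/ 2)).
  assert (Hs0 : sin (0 / 2) = 0) by (replace (0 / 2) with 0 by field; apply sin_0).
  assert (Hs : forall t, continuous s t).
  { apply continuous_slope; [|exact Hs0|].
    - intros t. apply (ex_derive_continuous (fun t => sin (t / 2))). auto_derive; trivial.
    - auto_derive; [trivial|]. replace (0 * / 2) with 0 by ring. rewrite cos_0. ring. }
  assert (Hsn : forall t, - PI <= t <= PI -> s t <> 0).
  { intros t Ht. unfold s, slope. destruct (Req_EM_T t 0) as [E|E]; [lra|].
    pose proof PI_RGT_0. intros Hz. apply Rmult_integral in Hz. destruct Hz as [Hz|Hz].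
    - destruct (Rlt_dec 0 t).
      + pose proof (sin_gt_0 (t / 2)). lra.
      + pose proof (sin_lt_0_var (t / 2)). lra.
    - revert Hz. apply Rinv_neq_0_compat, E. }
  exists (fun t => slope h l (clamp t) * / s (clamp t)). split.
  - intros t. apply continuous_Rmult.
    + apply (continuous_comp clamp (slope h l)); [apply continuous_clamp|apply continuous_slope; assumption].
    + apply (continuous_comp clamp (fun t => / s t)); [apply continuous_clamp|].
      apply continuity_pt_filterlim, continuity_pt_inv; [apply continuity_pt_filterlim, Hs|].
      apply Hsn, clamp_range.
  - intros t Ht. rewrite clamp_id by exact Ht.
    rewrite <- (slope_mult (fun t => sin (t / 2)) (/ 2) t Hs0). fold s.
    rewrite <- (slope_mult h l t H0). field. apply Hsn, Ht.
Qed.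

(* [e^{it} - 1 = 2 i sin(t/2) e^{it/2}]: the zero of [f] at [0] absorbs the zero of [e^{it} - 1]. *)
Lemma eith_minus_1_quotient f l : Ccont f -> f 0 = RtoC 0 -> CD f 0 l ->
  exists g, Ccont g /\ forall t, - PI <= t <= PI -> f t = (g t * (eith t - RtoC 1))%C.
Proof.
  intros Hc H0 [HD1 HD2].
  destruct (Rcont_sin_half_quotient (fun t => fst (f t)) (fst l)) as [q1 [Hq1 E1]];
    [intros; apply Hc|rewrite H0; reflexivity|exact HD1|].
  destruct (Rcont_sin_half_quotient (fun t => snd (f t)) (snd l)) as [q2 [Hq2 E2]];
    [intros; apply Hc|rewrite H0; reflexivity|exact HD2|].
  exists (fun t => ((0, - / 2)%R * eith (- / 2 * t) * (q1 t, q2 t)%R)%C). split.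
  - apply Ccont_mult; [apply Ccont_mult; [apply Ccont_const|apply Ccont_eith]|].
    intros t; split; simpl; auto.
  - intros t Ht.
    assert (E : f t = ((q1 t, q2 t)%R * RtoC (sin (t / 2)))%C).
    { rewrite (surjective_pairing (f t)), (E1 t Ht), (E2 t Ht).
      unfold Cmult, RtoC; simpl. f_equal; ring. }
    rewrite E.
    assert (E3 : ((0, - / 2)%R * eith (- / 2 * t) * (eith t - RtoC 1))%C = RtoC (sin (t / 2))).
    { replace t with (t / 2 + t / 2) at 2 by field. rewrite eith_plus.
      replace (- / 2 * t) with (- (t / 2)) by field.
      set (x := t / 2). unfold eith, Cmult, Cminus, Cplus, Copp, RtoC; simpl.
      rewrite cos_neg, sin_neg. pose proof (sin2_cos2 x) as H. unfold Rsqr in H.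
      set (c := cos x) in *. set (s := sin x) in *.
      assert (Hc2 : c * c = 1 - s * s) by lra.
      f_equal.
      - replace ((0 * c - - / 2 * - s) * (c * c - s * s + - (1)) - (0 * - s + - / 2 * c) * (c * s + s * c +
          - 0))
          with (s * (/ 2 * (s * s) + / 2 + / 2 * (c * c))) by ring. rewrite Hc2. field.
      - replace ((0 * c - - / 2 * - s) * (c * s + s * c + - 0) + (0 * - s + - / 2 * c) * (c * c - s * s + -
          (1)))
          with (/ 2 * c * (1 - (s * s + c * c))) by ring. rewrite H. ring. }
    rewrite <- E3. ring.
Qed.

Lemma four_ext f g j : (forall t, - PI <= t <= PI -> f t = g t) -> four f j = four g j.
Proof. intros H. apply Cmean_ext. intros t Ht. rewrite H; auto. Qed.

(** Dividing by e^{it} - 1 turns coefficients into differences, f_j = g_{j-1} - g_j. The partial sum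
    telescopes to g_{-(M+1)} - g_M, which vanishes in the limit by Riemann-Lebesgue. *)
Lemma four_partial_sums_at_zero f l : Ccont f -> f 0 = RtoC 0 -> CD f 0 l ->
  Clim (fun M => (csum (fun i => four f (Z.of_nat i)) (S M) + csum (fun i => four f (- Z.of_nat (S i)))
      M)%C) (RtoC 0).
Proof.
  intros Hc H0 HD. destruct (eith_minus_1_quotient f l Hc H0 HD) as [g [Hg E]].
  assert (Hj : forall j, four f j = (four g (j - 1) - four g j)%C).
  { intros j. rewrite (four_ext f _ j E). unfold four.
    rewrite <- Cmean_minus by (apply Ccont_four_integrand, Hg).
    apply Cmean_ext. intros t _.
    replace (- IZR (j - 1) * t) with (t + - IZR j * t) by (rewrite minus_IZR; ring).
    rewrite eith_plus. ring. }
  assert (S1 : forall M, csum (fun i => four f (Z.of_nat i)) M =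
                         (four g (-1) - four g (Z.of_nat M - 1))%C).
  { induction M as [|M IH]; [simpl; ring|]. simpl csum. rewrite IH, Hj.
    replace (Z.of_nat (S M) - 1)%Z with (Z.of_nat M) by lia. ring. }
  assert (S2 : forall M, csum (fun i => four f (- Z.of_nat (S i))) M =
                         (four g (- Z.of_nat (S M)) - four g (-1))%C).
  { induction M as [|M IH]; [simpl; ring|].
    change (csum (fun i => four f (- Z.of_nat (S i))) (S M)) with
      (csum (fun i => four f (- Z.of_nat (S i))) M + four f (- Z.of_nat (S M)))%C.
    rewrite IH, Hj.
    replace (- Z.of_nat (S M) - 1)%Z with (- Z.of_nat (S (S M)))%Z by lia. ring. }
  intros eps He.
  destruct (riemann_lebesgue_pos g Hg (eps / 2)) as [M1 H1]; [lra|].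
  destruct (riemann_lebesgue_neg g Hg (eps / 2)) as [M2 H2]; [lra|].
  exists (M1 + M2)%nat. intros M HM.
  specialize (H1 M ltac:(lia)). specialize (H2 (S M) ltac:(lia)).
  rewrite S1, S2. replace (Z.of_nat (S M) - 1)%Z with (Z.of_nat M) by lia.
  replace (four g (-1) - four g (Z.of_nat M) + (four g (- Z.of_nat (S M)) - four g (-1)) - RtoC 0)%C
    with (four g (- Z.of_nat (S M)) - RtoC 0 - (four g (Z.of_nat M) - RtoC 0))%C by ring.
  eapply Rle_lt_trans; [apply Cmod_minus_le|]. lra.
Qed.

Lemma ex_series_inv_sqr : ex_series (fun j => / INR (S j) ^ 2).
Proof.
  apply ex_series_bounded with 2.
  - intros j. apply Rlt_le, Rinv_0_lt_compat, pow_lt, lt_0_INR. lia.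
  - assert (H : forall n, rsum (fun j => / INR (S j) ^ 2) (S n) <= 2 - / INR (S n)).
    { induction n as [|n IH]; [simpl; lra|].
      change (rsum (fun j => / INR (S j) ^ 2) (S (S n))) with
        (rsum (fun j => / INR (S j) ^ 2) (S n) + / INR (S (S n)) ^ 2).
      assert (Hp : 0 < INR (S n)) by (apply lt_0_INR; lia).
      rewrite (S_INR (S n)). set (x := INR (S n)) in *.
      assert (/ (x + 1) ^ 2 <= / x - / (x + 1)); [|lra].
      replace (/ x - / (x + 1)) with (/ (x * (x + 1))) by (field; lra).
      apply Rinv_le_contravar; nra. }
    intros [|n]; [simpl; lra|]. eapply Rle_trans; [apply H|].
    assert (0 < / INR (S n)) by (apply Rinv_0_lt_compat, lt_0_INR; lia). lra.
Qed.

(** Turns the square-summability supplied by Bessel into absolute convergence, at the price of one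
    factor j + 1. *)
Lemma summable_of_weighted_l2 (a : nat -> C) B :
  (forall n, rsum (fun j => (INR (S j) * Cmod (a j)) ^ 2) n <= B) -> summable a.
Proof.
  intros HB.
  apply ex_series_Cmod_le with (fun j => / INR (S j) ^ 2 + (INR (S j) * Cmod (a j)) ^ 2).
  - intros j. assert (Hp : 0 < INR (S j)) by (apply lt_0_INR; lia).
    set (x := INR (S j)) in *. pose proof (Cmod_ge_0 (a j)).
    (* AM-GM: [|a_j| <= (1/x^2 + (x |a_j|)^2) / 2] *)
    assert (0 <= (/ x - x * Cmod (a j)) ^ 2) by apply pow2_ge_0.
    assert (E : (/ x - x * Cmod (a j)) ^ 2 = / x ^ 2 - 2 * Cmod (a j) + (x * Cmod (a j)) ^ 2) by (field; lra).
    lra.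
  - apply (ex_series_plus (fun j => / INR (S j) ^ 2) (fun j => (INR (S j) * Cmod (a j)) ^ 2)).
    + apply ex_series_inv_sqr.
    + apply ex_series_bounded with B; [intros; apply pow2_ge_0|exact HB].
Qed.

Lemma summable_S a : summable (fun j => a (S j)) -> summable a.
Proof. intros H. apply (ex_series_incr_1 (fun j => Cmod (a j))). exact H. Qed.

Section Inversion.

Context (f df : R -> C) (HD : forall t, CD f t (df t)) (Hdf : Ccont df)
  (Hper : forall t, f (t + 2 * PI) = f t).

Let Hf : Ccont f := CD_cont f df HD.

Let Hends : f PI = f (- PI).
Proof. rewrite <- (Hper (- PI)). f_equal. ring. Qed.

Lemma four_derive_mod j : Cmod (four df j) = Rabs (IZR j) * Cmod (four f j).
Proof.
  rewrite (four_derive f df j HD Hdf Hends), Cmod_mult. f_equal.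
  unfold Cmod; simpl. rewrite <- sqrt_Rsqr_abs. f_equal. unfold Rsqr. ring.
Qed.

Lemma summable_four_pos : summable (fun j => four f (Z.of_nat j)).
Proof.
  apply summable_S, summable_of_weighted_l2 with (nrm df ^ 2).
  intros n. eapply Rle_trans; [|apply (bessel df 1 n Hdf)].
  apply Req_le, rsum_ext. intros i _. rewrite four_derive_mod.
  replace (1 + Z.of_nat i)%Z with (Z.of_nat (S i)) by lia.
  rewrite <- INR_IZR_INZ, Rabs_pos_eq by apply pos_INR. reflexivity.
Qed.

Lemma summable_four_neg : summable (fun j => four f (- Z.of_nat (S j))).
Proof.
  apply summable_of_weighted_l2 with (nrm (fun t => Cconj (df t)) ^ 2).
  intros n. eapply Rle_trans; [|apply (bessel (fun t => Cconj (df t)) 1 n), Ccont_conj, Hdf].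
  apply Req_le, rsum_ext. intros i _.
  rewrite four_conj by exact Hdf. rewrite Cmod_conj, four_derive_mod.
  replace (- (1 + Z.of_nat i))%Z with (- Z.of_nat (S i))%Z by lia.
  rewrite opp_IZR, Rabs_Ropp, <- INR_IZR_INZ, Rabs_pos_eq by apply pos_INR. reflexivity.
Qed.

(** The function h(x) = f(x + t) - f(t) vanishes at 0, so its Fourier partial sums at 0 tend to 0.
    Its modes are those of [f] times e^{ijt}, with f(t) removed from mode 0. *)
Lemma fourier_inversion t : f t =
  (CSeries (fun j => (four f (Z.of_nat j) * eith (INR j * t))%C) + CSeries (fun j => (four f (- Z.of_nat (S
      j)) * eith (- INR (S j) * t))%C))%C.
Proof.
  set (h := fun x => (f (x + t)%R + - f t)%C).
  assert (Hh : Ccont h) by (apply Ccont_plus; [apply Ccont_shift, Hf|apply Ccont_const]).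
  assert (Hh0 : h 0 = RtoC 0) by (unfold h; rewrite Rplus_0_l; ring).
  assert (HhD : CD h 0 (df t)).
  { unfold h. apply CD_eq with (df (0 + t)%R + RtoC 0)%C; [|rewrite Rplus_0_l; ring].
    apply CD_plus; [|apply CD_const].
    destruct (HD (0 + t)) as [H1 H2].
    split.
    - eapply is_derive_eq; [apply (is_derive_Rcomp (fun x => fst (f x)) (fun x => x + t)); [exact H1|]|].
      + eapply is_derive_Rplus; [apply is_derive_id|apply is_derive_Rconst].
      + unfold one; simpl. ring.
    - eapply is_derive_eq; [apply (is_derive_Rcomp (fun x => snd (f x)) (fun x => x + t)); [exact H2|]|].
      + eapply is_derive_Rplus; [apply is_derive_id|apply is_derive_Rconst].
      + unfold one; simpl. ring. }
  pose proof (four_partial_sums_at_zero h (df t) Hh Hh0 HhD) as HL.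
  assert (Hfour : forall j, four h j = (four f j * eith (IZR j * t) + - f t * Cmean (fun x => eith (IZR (-
      j) * x)))%C).
  { intros j. unfold h. rewrite four_plus; [|apply Ccont_shift, Hf|apply Ccont_const].
    rewrite four_shift by assumption. f_equal; [ring|].
    unfold four. rewrite Cmean_scal by apply Ccont_eith. rewrite opp_IZR. reflexivity. }
  assert (Lp : Clim (csum (fun j => (four f (Z.of_nat j) * eith (INR j * t))%C))
                    (CSeries (fun j => (four f (Z.of_nat j) * eith (INR j * t))%C))).
  { apply CSeries_lim, ex_series_Cmod_le with (fun j => Cmod (four f (Z.of_nat j))); [|apply summable_four_pos].
    intros j. rewrite Cmod_mult, Cmod_eith. lra. }
  assert (Ln : Clim (csum (fun j => (four f (- Z.of_nat (S j)) * eith (- INR (S j) * t))%C))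
                    (CSeries (fun j => (four f (- Z.of_nat (S j)) * eith (- INR (S j) * t))%C))).
  { apply CSeries_lim, ex_series_Cmod_le with (fun j => Cmod (four f (- Z.of_nat (S j)))); [|apply
      summable_four_neg].
    intros j. rewrite Cmod_mult, Cmod_eith. lra. }
  apply (Clim_unique (fun M => (csum (fun j => (four f (Z.of_nat j) * eith (INR j * t))%C) (S M) + csum
      (fun j => (four f (- Z.of_nat (S j)) * eith (- INR (S j) * t))%C) M)%C)).
  - intros eps He. destruct (HL eps He) as [M0 H0]. exists M0. intros M HM. specialize (H0 M HM).
    rewrite csum_first in H0.
    rewrite (csum_ext (fun i => four h (Z.of_nat (S i)))
              (fun i => (four f (Z.of_nat (S i)) * eith (INR (S i) * t))%C)) in H0.
    2:{ intros i _. rewrite Hfour, Cmean_eith by lia. rewrite <- INR_IZR_INZ. ring. }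
    rewrite (csum_ext (fun i => four h (- Z.of_nat (S i)))
              (fun i => (four f (- Z.of_nat (S i)) * eith (- INR (S i) * t))%C)) in H0.
    2:{ intros i _. rewrite Hfour, Cmean_eith by lia. rewrite opp_IZR, <- INR_IZR_INZ. ring. }
    (* Mode 0 is the only one to which the constant [- f t] contributes; this brings f(t) into the
       limit. *)
    rewrite Hfour in H0. change (- Z.of_nat 0)%Z with 0%Z in H0. rewrite Cmean_eith_0 in H0.
    rewrite csum_first. eapply Rle_lt_trans; [|exact H0]. apply Req_le. f_equal.
    change (IZR (Z.of_nat 0)) with (INR 0). ring.
  - apply Clim_plus; [|exact Ln].
    intros eps He. destruct (Lp eps He) as [M0 H0]. exists M0. intros M HM. apply H0. lia.
Qed.

End Inversion.

(** * Decay of the Fourier coefficients *)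

Lemma periodic_derive (f df : R -> R) : (forall t, is_derive f t (df t)) ->
  (forall t, f (t + 2 * PI) = f t) -> forall t, df (t + 2 * PI) = df t.
Proof.
  intros HD Hp t.
  rewrite <- (is_derive_unique f t (df t) (HD t)).
  symmetry. apply is_derive_unique.
  apply is_derive_ext with (fun x => f (x + 2 * PI)); [exact Hp|].
  eapply is_derive_eq; [apply (is_derive_Rcomp f (fun x => x + 2 * PI)); [apply HD|]|].
  - eapply is_derive_Rplus; [apply is_derive_id|apply is_derive_Rconst].
  - unfold one; simpl. ring.
Qed.

(* Bessel's inequality for [f (. + h) - f] divided by [h], in the limit [h -> 0]. *)
Lemma bessel_lipschitz f j0 M L : Ccont f -> (forall t, f (t + 2 * PI) = f t) -> 0 <= L ->
  (forall x y, Cmod (f x - f y) <= L * Rabs (x - y)) ->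
  rsum (fun i => (Rabs (IZR (j0 + Z.of_nat i)) * Cmod (four f (j0 + Z.of_nat i))) ^ 2) M <= L ^ 2.
Proof.
  intros Hf Hp HL Hlip.
  assert (H : forall h, 0 < h ->
    rsum (fun i => (Rabs (2 * sin (IZR (j0 + Z.of_nat i) * h / 2) / h) * Cmod (four f (j0 + Z.of_nat i))) ^
        2) M <= L ^ 2).
  { intros h Hh.
    set (g := fun t => (RtoC (/ h) * (f (t + h)%R + - f t))%C).
    assert (Hg0 : Ccont (fun t => (f (t + h)%R + - f t)%C))
      by (apply Ccont_plus; [apply Ccont_shift|apply Ccont_opp]; exact Hf).
    assert (Hg : Ccont g) by (apply Ccont_mult; [apply Ccont_const|exact Hg0]).
    eapply Rle_trans; [|apply Rle_trans with (nrm g ^ 2); [apply (bessel g j0 M Hg)|]].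
    - apply Req_le, rsum_ext. intros i _. f_equal. set (j := (j0 + Z.of_nat i)%Z).
      unfold g. rewrite four_scal by exact Hg0.
      rewrite four_plus by (apply Ccont_shift || apply Ccont_opp; exact Hf).
      rewrite four_shift by assumption.
      assert (E : four (fun t => (- f t)%C) j = (- four f j)%C).
      { unfold four. rewrite <- Cmean_opp by (apply Ccont_four_integrand, Hf).
        apply Cmean_ext; intros; ring. }
      rewrite E.
      replace (RtoC (/ h) * (eith (IZR j * h) * four f j + - four f j))%C
        with (RtoC (/ h) * (eith (IZR j * h) - RtoC 1) * four f j)%C by ring.
      rewrite !Cmod_mult, Cmod_R. f_equal.
      assert (E2 : Cmod (eith (IZR j * h) - RtoC 1) = Rabs (2 * sin (IZR j * h / 2))).
      { rewrite <- sqrt_Rsqr_abs. unfold Cmod. f_equal.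
        unfold eith, Cminus, Cplus, Copp, RtoC; simpl.
        replace (IZR j * h) with (2 * (IZR j * h / 2)) at 1 2 3 4 by field.
        set (x := IZR j * h / 2). rewrite cos_2a_sin, sin_2a. unfold Rsqr.
        pose proof (sin2_cos2 x) as Hx. unfold Rsqr in Hx.
        replace (cos x) with (cos x) by reflexivity.
        assert (Hx' : cos x * cos x = 1 - sin x * sin x) by lra.
        transitivity (4 * (sin x * sin x) * (sin x * sin x + cos x * cos x)); [ring|rewrite Hx; ring]. }
      rewrite E2. unfold Rdiv. rewrite !Rabs_mult. ring.
    - apply pow_incr. split; [apply nrm_ge0|]. apply nrm_bound; [exact Hg|exact HL|].
      intros t _. unfold g. rewrite Cmod_mult, Cmod_R.
      rewrite Rabs_pos_eq by (apply Rlt_le, Rinv_0_lt_compat, Hh).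
      specialize (Hlip (t + h) t). replace (t + h - t) with h in Hlip by ring.
      rewrite (Rabs_pos_eq h) in Hlip by lra. unfold Cminus in Hlip.
      apply Rle_trans with (/ h * (L * h)).
      + apply Rmult_le_compat_l; [apply Rlt_le, Rinv_0_lt_compat, Hh|exact Hlip].
      + right. field. lra. }
  (* Along h = 1 / (n + 1) each multiplier |2 sin (jh/2) / h| tends to |j|, and the sum is
     finite. *)
  assert (Hlim : is_lim_seq (fun n => rsum (fun i => (Rabs (2 * sin (IZR (j0 + Z.of_nat i) * / INR (S n) /
      2) / / INR (S n))
                     * Cmod (four f (j0 + Z.of_nat i))) ^ 2) M)
             (rsum (fun i => (Rabs (IZR (j0 + Z.of_nat i)) * Cmod (four f (j0 + Z.of_nat i))) ^ 2) M)).
  { clear H. induction M as [|M IH]; [apply is_lim_seq_const|].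
    simpl rsum. apply is_lim_seq_plus'; [exact IH|].
    set (c := Cmod (four f (j0 + Z.of_nat M))). set (x := IZR (j0 + Z.of_nat M)).
    assert (Hs : is_lim_seq (fun n => 2 * sin (x * / INR (S n) / 2) / / INR (S n)) x).
    { assert (Hd : is_derive (fun h => 2 * sin (x * h / 2)) 0 x).
      { auto_derive; [trivial|]. replace (x * 0 * / 2) with 0 by ring. rewrite cos_0. field. }
      apply is_derive_Reals in Hd. apply is_lim_seq_spec. intros eps.
      destruct (Hd eps (cond_pos eps)) as [d Hd'].
      destruct (archimed_cor1 d (cond_pos d)) as [N [HN HN']].
      exists N. intros n Hn.
      assert (Hin : 0 < INR (S n)) by (apply lt_0_INR; lia).
      assert (Hsm : Rabs (/ INR (S n)) < d).
      { rewrite Rabs_pos_eq by (apply Rlt_le, Rinv_0_lt_compat, Hin).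
        apply Rle_lt_trans with (/ INR N); [|exact HN].
        apply Rinv_le_contravar; [apply lt_0_INR; lia|apply le_INR; lia]. }
      specialize (Hd' (/ INR (S n)) ltac:(apply Rinv_neq_0_compat; lra) Hsm).
      rewrite Rplus_0_l, Rmult_0_r in Hd'. replace (0 / 2) with 0 in Hd' by field.
      rewrite sin_0, Rmult_0_r, Rminus_0_r in Hd'. exact Hd'. }
    apply is_lim_seq_ext with (fun n => (Rabs (2 * sin (x * / INR (S n) / 2) / / INR (S n)) * c) *
        ((Rabs (2 * sin (x * / INR (S n) / 2) / / INR (S n)) * c) * 1)); [reflexivity|].
    apply (is_lim_seq_abs _ x) in Hs. simpl in Hs.
    repeat (apply is_lim_seq_mult' || exact Hs || apply is_lim_seq_const). }
  assert (Hc := is_lim_seq_le _ (fun _ => L ^ 2) _ (L ^ 2)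
    (fun n => H (/ INR (S n)) ltac:(apply Rinv_0_lt_compat, lt_0_INR; lia)) Hlim (is_lim_seq_const _)).
  exact Hc.
Qed.

(** Periodicity is carried through the induction because each integration by parts needs its
    boundary terms to cancel. *)
Lemma Cmod_four_iterated_derive (d : nat -> R -> R) m j :
  (forall t, d 0%nat (t + 2 * PI) = d 0%nat t) ->
  (forall i t, (i < m)%nat -> is_derive (d i) t (d (S i) t)) ->
  (forall t, continuous (d m) t) ->
  (forall t, d m (t + 2 * PI) = d m t) /\
  Cmod (four (fun t => RtoC (d m t)) j) = Rabs (IZR j) ^ m * Cmod (four (fun t => RtoC (d 0%nat t)) j).
Proof.
  intros Hp. induction m as [|m IH]; intros HD Hc.
  - split; [exact Hp|simpl; ring].
  - destruct IH as [IH1 IH2].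
    + intros i t Hi. apply HD. lia.
    + intros t. eapply continuous_derivable, HD. lia.
    + split.
      * apply (periodic_derive (d m)); [intros; apply HD; lia|exact IH1].
      * rewrite (four_derive_mod (fun t => RtoC (d m t)) (fun t => RtoC (d (S m) t))).
        -- rewrite IH2. simpl. ring.
        -- intros t. apply CD_RtoC, HD. lia.
        -- apply Ccont_RtoC, Hc.
        -- intros t. rewrite IH1. reflexivity.
Qed.

(** * The disc algebra *)

Definition poly (c : nat -> C) (n : nat) (w : C) : C := csum (fun j => (c j * Cpow w j)%C) n.

Definition is_poly (P : C -> C) : Prop := exists n c, forall w, P w = poly c n w.

(** The disc algebra as the uniform closure of the polynomials on the closed disc. In this form the
    mean value property, the power series expansion and the oscillatory bounds reduce to
    polynomials. Nothing is prescribed outside the disc. *)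
Definition disc_alg (F : C -> C) : Prop :=
  forall eps, 0 < eps -> exists P, is_poly P /\ forall w, Cmod w <= 1 -> Cmod (F w - P w) <= eps.

Lemma poly_extend c n m : (n <= m)%nat ->
  forall w, poly c n w = poly (fun j => if lt_dec j n then c j else RtoC 0) m w.
Proof.
  intros Hnm w. unfold poly. replace m with (n + (m - n))%nat by lia. rewrite csum_app.
  rewrite (csum_zero (fun i => ((if lt_dec (n + i) n then c (n + i)%nat else RtoC 0) * Cpow w (n + i))%C)).
  - rewrite Cplus_0_r. apply csum_ext. intros i Hi. destruct (lt_dec i n); [reflexivity|lia].
  - intros i _. destruct (lt_dec (n + i) n); [lia|ring].
Qed.

Lemma is_poly_monomial c n : is_poly (fun w => (c * Cpow w n)%C).
Proof.
  exists (S n), (fun j => if Nat.eq_dec j n then c else RtoC 0). intros w. unfold poly.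
  rewrite (csum_delta _ (S n) n); [|lia|].
  - destruct (Nat.eq_dec n n); [reflexivity|lia].
  - intros i _ Hi. destruct (Nat.eq_dec i n); [lia|ring].
Qed.

Lemma is_poly_plus P R : is_poly P -> is_poly R -> is_poly (fun w => (P w + R w)%C).
Proof.
  intros [n [c Hc]] [m [d Hd]].
  exists (n + m)%nat, (fun j => ((if lt_dec j n then c j else RtoC 0) + (if lt_dec j m then d j else RtoC
      0))%C).
  intros w. rewrite Hc, Hd, (poly_extend c n (n + m)), (poly_extend d m (n + m)) by lia.
  unfold poly. rewrite <- csum_plus. apply csum_ext. intros; ring.
Qed.

Lemma is_poly_ext P R : (forall w, P w = R w) -> is_poly P -> is_poly R.
Proof. intros H [n [c Hc]]. exists n, c. intros w. rewrite <- H. apply Hc. Qed.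

Lemma is_poly_const c : is_poly (fun _ => c).
Proof. apply is_poly_ext with (fun w => (c * Cpow w 0)%C); [intros; simpl; ring|apply is_poly_monomial]. Qed.

Lemma is_poly_csum (P : nat -> C -> C) n : (forall i, is_poly (P i)) -> is_poly (fun w => csum (fun i => P
    i w) n).
Proof.
  intros H. induction n as [|n IH]; simpl; [apply is_poly_const|apply is_poly_plus; auto].
Qed.

Lemma is_poly_mult P R : is_poly P -> is_poly R -> is_poly (fun w => (P w * R w)%C).
Proof.
  intros [n [c Hc]] [m [d Hd]].
  apply is_poly_ext with (fun w => csum (fun i => csum (fun j => (c i * d j * Cpow w (i + j))%C) m) n).
  - intros w. rewrite Hc, Hd. unfold poly. rewrite <- csum_mult_r. apply csum_ext. intros i _.
    rewrite <- csum_mult_l. apply csum_ext. intros j _. rewrite Cpow_add_r. ring.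
  - apply (is_poly_csum (fun i w => csum (fun j => (c i * d j * Cpow w (i + j))%C) m)).
    intros i. apply (is_poly_csum (fun j w => (c i * d j * Cpow w (i + j))%C)).
    intros j. apply is_poly_monomial.
Qed.

Lemma Rpow_le_1 x n : 0 <= x <= 1 -> x ^ n <= 1.
Proof. intros H. rewrite <- (pow1 n). apply pow_incr. exact H. Qed.

Lemma is_poly_bounded P : is_poly P -> exists B, 0 <= B /\ forall w, Cmod w <= 1 -> Cmod (P w) <= B.
Proof.
  intros [n [c Hc]]. exists (rsum (fun j => Cmod (c j)) n). split.
  - apply rsum_ge0. intros; apply Cmod_ge_0.
  - intros w Hw. rewrite Hc. eapply Rle_trans; [apply Cmod_csum|]. apply rsum_le. intros i _.
    rewrite Cmod_mult, Cmod_pow. rewrite <- (Rmult_1_r (Cmod (c i))) at 2.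
    apply Rmult_le_compat_l; [apply Cmod_ge_0|]. apply Rpow_le_1. split; [apply Cmod_ge_0|exact Hw].
Qed.

Lemma disc_alg_poly P : is_poly P -> disc_alg P.
Proof.
  intros H eps He. exists P. split; [exact H|]. intros w _.
  replace (P w - P w)%C with (RtoC 0) by ring. rewrite Cmod_0. lra.
Qed.

Lemma disc_alg_const c : disc_alg (fun _ => c).
Proof. apply disc_alg_poly, is_poly_const. Qed.

Lemma disc_alg_Cpow n : disc_alg (fun w => Cpow w n).
Proof.
  apply disc_alg_poly, is_poly_ext with (fun w => (RtoC 1 * Cpow w n)%C); [intros; ring|].
  apply is_poly_monomial.
Qed.

Lemma disc_alg_ext F G : (forall w, Cmod w <= 1 -> F w = G w) -> disc_alg F -> disc_alg G.
Proof.
  intros H HF eps He. destruct (HF eps He) as [P [HP HB]]. exists P. split; [exact HP|].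
  intros w Hw. rewrite <- H by exact Hw. auto.
Qed.

Lemma disc_alg_bounded F : disc_alg F -> exists B, 0 <= B /\ forall w, Cmod w <= 1 -> Cmod (F w) <= B.
Proof.
  intros HF. destruct (HF 1 Rlt_0_1) as [P [HP H]]. destruct (is_poly_bounded P HP) as [B [HB0 HB]].
  exists (1 + B). split; [lra|]. intros w Hw.
  replace (F w) with (F w - P w + P w)%C by ring.
  eapply Rle_trans; [apply Cmod_triangle|]. specialize (H w Hw). specialize (HB w Hw). lra.
Qed.

Lemma disc_alg_plus F G : disc_alg F -> disc_alg G -> disc_alg (fun w => (F w + G w)%C).
Proof.
  intros HF HG eps He.
  destruct (HF (eps / 2)) as [P [HP H1]]; [lra|]. destruct (HG (eps / 2)) as [R [HR H2]]; [lra|].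
  exists (fun w => (P w + R w)%C). split; [apply is_poly_plus; assumption|].
  intros w Hw. specialize (H1 w Hw). specialize (H2 w Hw).
  replace (F w + G w - (P w + R w))%C with
    (F w - P w + (G w - R w))%C by ring.
  eapply Rle_trans; [apply Cmod_triangle|]. lra.
Qed.

Lemma disc_alg_mult F G : disc_alg F -> disc_alg G -> disc_alg (fun w => (F w * G w)%C).
Proof.
  intros HF HG eps He.
  destruct (disc_alg_bounded F HF) as [A [HA0 HA]]. destruct (disc_alg_bounded G HG) as [B [HB0 HB]].
  (* The product error is at most e1 B + A e1 + e1^2, which is at most e1 (A + B + 1) as e1 <= 1. *)
  set (e1 := Rmin 1 (eps / (2 * (A + B + 2)))).
  assert (He1 : 0 < e1) by (apply Rmin_pos; [lra|apply Rdiv_lt_0_compat; lra]).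
  assert (He1' : e1 * (A + B + 1) <= eps).
  { apply Rle_trans with (eps / (2 * (A + B + 2)) * (2 * (A + B + 2))).
    - apply Rmult_le_compat; try lra. apply Rmin_r.
    - right. field. lra. }
  assert (e1 <= 1) by apply Rmin_l.
  destruct (HF e1 He1) as [P [HP H1]]. destruct (HG e1 He1) as [R [HR H2]].
  exists (fun w => (P w * R w)%C). split; [apply is_poly_mult; assumption|].
  intros w Hw. specialize (H1 w Hw). specialize (H2 w Hw). specialize (HA w Hw). specialize (HB w Hw).
  replace (F w * G w - P w * R w)%C with
    ((F w - P w) * G w + (F w * (G w - R w) + - ((F w - P w) * (G w - R w))))%C by ring.
  eapply Rle_trans; [apply Cmod_triangle|]. rewrite Cmod_mult.
  eapply Rle_trans; [apply Rplus_le_compat_l, Cmod_triangle|]. rewrite Cmod_opp, !Cmod_mult.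
  pose proof (Cmod_ge_0 (F w - P w)%C). pose proof (Cmod_ge_0 (G w - R w)%C).
  pose proof (Cmod_ge_0 (F w)). pose proof (Cmod_ge_0 (G w)).
  assert (Cmod (F w - P w) * Cmod (G w) <= e1 * B) by (apply Rmult_le_compat; lra).
  assert (Cmod (F w) * Cmod (G w - R w) <= A * e1) by (apply Rmult_le_compat; lra).
  assert (Cmod (F w - P w) * Cmod (G w - R w) <= e1 * 1) by (apply Rmult_le_compat; lra).
  lra.
Qed.

Lemma disc_alg_minus F G : disc_alg F -> disc_alg G -> disc_alg (fun w => (F w - G w)%C).
Proof.
  intros HF HG. apply disc_alg_ext with (fun w => (F w + - RtoC 1 * G w)%C).
  - intros; ring.
  - apply disc_alg_plus; [exact HF|]. apply disc_alg_mult; [apply disc_alg_const|exact HG].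
Qed.

Lemma disc_alg_pow F n : disc_alg F -> disc_alg (fun w => Cpow (F w) n).
Proof.
  intros HF. induction n as [|n IH]; simpl; [apply disc_alg_const|apply disc_alg_mult; assumption].
Qed.

Lemma disc_alg_uniform_limit F :
  (forall eps, 0 < eps -> exists G, disc_alg G /\ forall w, Cmod w <= 1 -> Cmod (F w - G w) <= eps) ->
  disc_alg F.
Proof.
  intros H eps He. destruct (H (eps / 2)) as [G [HG H1]]; [lra|].
  destruct (HG (eps / 2)) as [P [HP H2]]; [lra|]. exists P. split; [exact HP|].
  intros w Hw. specialize (H1 w Hw). specialize (H2 w Hw).
  replace (F w - P w)%C with (F w - G w + (G w - P w))%C by ring.
  eapply Rle_trans; [apply Cmod_triangle|]. lra.
Qed.

(** Induction on a^{n+1} - b^{n+1} = a (a^n - b^n) + (a - b) b^n; with r >= 1 the natural exponent n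
    - 1 may be raised to n. *)
Lemma Cpow_diff_le a b r n : 1 <= r -> Cmod a <= r -> Cmod b <= r ->
  Cmod (Cpow a n - Cpow b n) <= INR n * r ^ n * Cmod (a - b).
Proof.
  intros Hr Ha Hb. induction n as [|n IH].
  - simpl. replace (RtoC 1 - RtoC 1)%C with (RtoC 0) by ring. rewrite Cmod_0. lra.
  - rewrite !Cpow_S.
    replace (a * Cpow a n - b * Cpow b n)%C with
      (a * (Cpow a n - Cpow b n) + (a - b) * Cpow b n)%C by ring.
    eapply Rle_trans; [apply Cmod_triangle|]. rewrite !Cmod_mult, Cmod_pow, S_INR.
    set (d := Cmod (a - b)) in *. assert (0 <= d) by apply Cmod_ge_0.
    pose proof (Cmod_ge_0 a). pose proof (Cmod_ge_0 b). pose proof (pos_INR n).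
    assert (Hbn : Cmod b ^ n <= r ^ n) by (apply pow_incr; lra).
    assert (Hrn : r ^ n <= r ^ S n) by (simpl; pose proof (pow_le r n ltac:(lra)); nra).
    assert (Cmod a * Cmod (Cpow a n - Cpow b n) <= r * (INR n * r ^ n * d)).
    { apply Rmult_le_compat; try lra; apply Cmod_ge_0. }
    assert (d * Cmod b ^ n <= d * r ^ S n) by (apply Rmult_le_compat_l; lra).
    simpl in *. lra.
Qed.

(* [(1 + F / m)^m] converges uniformly to [exp F]. *)
Lemma disc_alg_Cexp F : disc_alg F -> disc_alg (fun w => Cexp (F w)).
Proof.
  intros HF. destruct (disc_alg_bounded F HF) as [B [HB0 HB]].
  apply disc_alg_uniform_limit. intros eps He.
  (* Taking m >= B makes |F / m| <= 1, so the Taylor bound applies; taking m >= 10 B^2 e^B / eps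
     makes the total error m e^B * 10 (B/m)^2 at most eps. *)
  destruct (INR_unbounded (B + 10 * B ^ 2 * exp B / eps + 1)) as [m Hm].
  assert (Hq : 0 <= 10 * B ^ 2 * exp B / eps).
  { pose proof (exp_pos B). apply Rmult_le_pos; [nra|]. apply Rlt_le, Rinv_0_lt_compat, He. }
  assert (Hm0 : 0 < INR m) by lra.
  exists (fun w => Cpow (RtoC 1 + RtoC (/ INR m) * F w) m). split.
  - apply disc_alg_pow, disc_alg_plus; [apply disc_alg_const|].
    apply disc_alg_mult; [apply disc_alg_const|exact HF].
  - intros w Hw. specialize (HB w Hw). set (u := (RtoC (/ INR m) * F w)%C).
    replace (F w) with (RtoC (INR m) * u)%C.
    2:{ unfold u. rewrite Cmult_assoc, <- RtoC_mult, Rinv_r by lra. ring. }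
    rewrite Cexp_nat_mult.
    assert (Hinv : 0 < / INR m) by (apply Rinv_0_lt_compat; lra).
    assert (Hu : Cmod u <= B / INR m).
    { unfold u. rewrite Cmod_mult, Cmod_R, Rabs_pos_eq by lra. unfold Rdiv. rewrite Rmult_comm.
      apply Rmult_le_compat_r; lra. }
    assert (HBm : B / INR m <= 1).
    { apply Rmult_le_reg_r with (INR m); [exact Hm0|]. unfold Rdiv. rewrite Rmult_assoc, Rinv_l by lra. lra. }
    pose proof (Cmod_ge_0 u) as Hu0.
    assert (Hr : 1 + B / INR m <= exp (B / INR m)) by apply exp_ineq1_le.
    assert (HBm0 : 0 <= B / INR m) by lra.
    eapply Rle_trans; [apply (Cpow_diff_le _ _ (exp (B / INR m)))|].
    + lra.
    + rewrite Cmod_Cexp. apply exp_mono. pose proof (Rabs_fst_le u). pose proof (Rle_abs (fst u)). lra.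
    + eapply Rle_trans; [apply Cmod_triangle|]. rewrite Cmod_1. lra.
    + replace (Cexp u - (RtoC 1 + u))%C with (Cexp u - RtoC 1 - u)%C by ring.
      assert (He1 : exp (B / INR m) ^ m = exp B).
      { rewrite <- exp_INR_mult. f_equal. field. lra. }
      rewrite He1.
      assert (H10 : Cmod (Cexp u - RtoC 1 - u) <= 10 * (B / INR m) ^ 2).
      { eapply Rle_trans; [apply Cexp_taylor2; lra|]. apply Rmult_le_compat_l; [lra|].
        apply pow_incr; lra. }
      pose proof (exp_pos B).
      apply Rle_trans with (INR m * exp B * (10 * (B / INR m) ^ 2)).
      { apply Rmult_le_compat_l; [nra|exact H10]. }
      replace (INR m * exp B * (10 * (B / INR m) ^ 2)) with ((10 * B ^ 2 * exp B / eps) * (eps * / INR m))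
          by (field; lra).
      apply Rle_trans with (INR m * (eps * / INR m)).
      { apply Rmult_le_compat_r; [nra|lra]. }
      right. field. lra.
Qed.

Definition pseries (a : nat -> C) (w : C) : C := CSeries (fun j => (a j * Cpow w j)%C).

Lemma Cmod_pseries_term a w j : Cmod w <= 1 -> Cmod (a j * Cpow w j) <= Cmod (a j).
Proof.
  intros Hw. rewrite Cmod_mult, Cmod_pow. rewrite <- (Rmult_1_r (Cmod (a j))) at 2.
  apply Rmult_le_compat_l; [apply Cmod_ge_0|]. apply Rpow_le_1. split; [apply Cmod_ge_0|exact Hw].
Qed.

Lemma pseries_0 a : summable a -> pseries a (RtoC 0) = a O.
Proof.
  intros Ha. apply (Clim_unique (csum (fun j => (a j * Cpow (RtoC 0) j)%C))).
  - apply CSeries_lim, ex_series_Cmod_le with (fun j => Cmod (a j)); [|exact Ha].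
    intros j. apply Cmod_pseries_term. rewrite Cmod_0; lra.
  - intros eps He. exists 1%nat. intros M HM. destruct M as [|M]; [lia|].
    rewrite csum_first, csum_zero.
    + replace (a O * Cpow (RtoC 0) 0 + RtoC 0 - a O)%C with (RtoC 0) by (simpl; ring).
      rewrite Cmod_0. exact He.
    + intros i _. simpl. ring.
Qed.

Lemma disc_alg_pseries a : summable a -> disc_alg (pseries a).
Proof.
  intros Ha eps He.
  destruct (is_series_rsum (fun j => Cmod (a j)) Ha eps He) as [M HM].
  exists (poly a M). split; [exists M, a; reflexivity|].
  intros w Hw. eapply Rle_trans; [apply (CSeries_tail _ (fun j => Cmod (a j)))|].
  - intros j. apply Cmod_pseries_term, Hw.
  - exact Ha.
  - eapply Rle_trans; [apply Rle_abs|]. apply Rlt_le, HM. lia.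
Qed.

Lemma Ccont_uniform_limit f :
  (forall eps, 0 < eps -> exists g, Ccont g /\ forall t, Cmod (f t - g t) <= eps) -> Ccont f.
Proof.
  intros H t.
  assert (Hc : forall (p : C -> R), (forall z z', Rabs (p z - p z') <= Cmod (z - z')) ->
    (forall g, Ccont g -> continuous (fun x => p (g x)) t) -> continuous (fun x => p (f x)) t).
  { intros p Hp Hpg. apply continuity_pt_filterlim. intros eps He.
    destruct (H (eps / 4)) as [g [Hg Hfg]]; [lra|].
    pose proof (Hpg g Hg) as Hgt. apply continuity_pt_filterlim in Hgt.
    destruct (Hgt (eps / 4)) as [d [Hd Hd']]; [lra|].
    exists d. split; [exact Hd|]. intros x Hx. specialize (Hd' x Hx).
    simpl in *. unfold Rdist in *.
    pose proof (Hp (f x) (g x)). pose proof (Hp (f t) (g t)).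
    pose proof (Hfg x). pose proof (Hfg t).
    replace (p (f x) - p (f t)) with ((p (f x) - p (g x)) + (p (g x) - p (g t)) - (p (f t) - p (g t))) by ring.
    unfold Rminus at 1. eapply Rle_lt_trans; [apply Rabs_triang|]. rewrite Rabs_Ropp.
    eapply Rle_lt_trans; [apply Rplus_le_compat_r, Rabs_triang|]. lra. }
  split; apply Hc.
  - intros z z'. apply (Rabs_fst_le (z - z')%C).
  - intros g Hg. apply Hg.
  - intros z z'. apply (Rabs_snd_le (z - z')%C).
  - intros g Hg. apply Hg.
Qed.

Lemma poly_trig c n t : poly c n (eith t) = trig 0 c n t.
Proof.
  unfold poly, trig. apply csum_ext. intros i _. rewrite eith_pow, Z.add_0_l, <- INR_IZR_INZ. reflexivity.
Qed.

Lemma Ccont_poly P : is_poly P -> Ccont (fun t => P (eith t)).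
Proof.
  intros [n [c Hc]]. apply Ccont_ext with (trig 0 c n); [|apply Ccont_trig].
  intros t. rewrite Hc, poly_trig. reflexivity.
Qed.

Lemma Ccont_disc_alg F : disc_alg F -> Ccont (fun t => F (eith t)).
Proof.
  intros HF. apply Ccont_uniform_limit. intros eps He. destruct (HF eps He) as [P [HP H]].
  exists (fun t => P (eith t)). split; [apply Ccont_poly, HP|].
  intros t. apply H. rewrite Cmod_eith. lra.
Qed.

Lemma Cmean_poly P : is_poly P -> Cmean (fun t => P (eith t)) = P (RtoC 0).
Proof.
  intros [n [c Hc]]. rewrite Hc.
  rewrite (Cmean_ext _ (fun t => csum (fun i => (c i * eith (IZR (Z.of_nat i) * t))%C) n)).
  2:{ intros t _. rewrite Hc, poly_trig. unfold trig. apply csum_ext. intros; rewrite Z.add_0_l; reflexivity. }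
  rewrite (Cmean_csum (fun i t => (c i * eith (IZR (Z.of_nat i) * t))%C)).
  2:{ intros i. apply Ccont_mult; [apply Ccont_const|apply Ccont_eith]. }
  unfold poly. apply csum_ext. intros i _. rewrite Cmean_scal by apply Ccont_eith. f_equal.
  destruct i as [|i].
  - simpl Z.of_nat. rewrite Cmean_eith_0. reflexivity.
  - rewrite Cmean_eith by lia. simpl. ring.
Qed.

Lemma eq_of_Cmod_le_eps a b k : (forall eps, 0 < eps -> Cmod (a - b) <= k * eps) -> a = b.
Proof.
  intros H. apply Ceq_minus, Cmod_eq_0. apply Rle_antisym; [|apply Cmod_ge_0].
  apply Rle_plus_epsilon. intros e He. rewrite Rplus_0_l.
  eapply Rle_trans; [apply (H (e / (Rabs k + 1)))|].
  - apply Rdiv_lt_0_compat; [exact He|]. pose proof (Rabs_pos k); lra.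
  - pose proof (Rabs_pos k). pose proof (Rle_abs k).
    assert (0 < e / (Rabs k + 1)) by (apply Rdiv_lt_0_compat; lra).
    apply Rle_trans with ((Rabs k + 1) * (e / (Rabs k + 1))); [nra|]. right. field. lra.
Qed.

(** The mean value property passes to uniform limits. This is the only form of Cauchy's theorem that
    the Hankel argument uses: means of analytic products vanish as soon as one factor vanishes at
    0. *)
Lemma Cmean_disc_alg F : disc_alg F -> Cmean (fun t => F (eith t)) = F (RtoC 0).
Proof.
  intros HF. apply eq_of_Cmod_le_eps with 2. intros eps He.
  destruct (HF eps He) as [P [HP H]].
  replace (Cmean (fun t => F (eith t)) - F (RtoC 0)%R)%C with
    (Cmean (fun t => F (eith t)) - Cmean (fun t => P (eith t)) - (F (RtoC 0)%R - P (RtoC 0)%R))%C.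
  2:{ rewrite (Cmean_poly P HP). ring. }
  eapply Rle_trans; [apply Cmod_minus_le|].
  rewrite <- Cmean_minus by (first [apply Ccont_disc_alg; assumption | apply Ccont_poly; assumption]).
  assert (Cmod (F (RtoC 0)%R - P (RtoC 0)%R) <= eps) by (apply H; rewrite Cmod_0; lra).
  assert (Cmod (Cmean (fun t => (F (eith t) - P (eith t))%C)) <= eps); [|lra].
  apply Cmod_Cmean_bound.
  - apply Ccont_minus; [apply Ccont_disc_alg, HF|apply Ccont_poly, HP].
  - intros t _. apply H. rewrite Cmod_eith. lra.
Qed.

Lemma ex_series_geom_Cmod r : 0 <= r < 1 -> ex_series (fun j => r ^ j) /\ Series (fun j => r ^ j) = / (1 - r).
Proof.
  intros Hr. assert (Rabs r < 1) by (rewrite Rabs_pos_eq; lra). split.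
  - apply ex_series_geom; assumption.
  - apply Series_geom; assumption.
Qed.

(** If a polynomial is within eps of [F], its coefficients are within eps of the Fourier
    coefficients of [F], so the two series differ at [w] by at most eps / (1 - |w|). With the
    approximation error and the tail this accounts for the constant passed to
    [eq_of_Cmod_le_eps]. *)
Lemma disc_alg_pseries_expansion F w : disc_alg F -> Cmod w < 1 ->
  F w = pseries (fun j => four (fun t => F (eith t)) (Z.of_nat j)) w.
Proof.
  intros HF Hw. pose proof (Cmod_ge_0 w) as Hw0.
  destruct (ex_series_geom_Cmod (Cmod w) ltac:(lra)) as [Hg1 Hg2].
  assert (Hi : 0 < / (1 - Cmod w)) by (apply Rinv_0_lt_compat; lra).
  destruct (disc_alg_bounded F HF) as [B [HB0 HB]].
  set (a := fun j => four (fun t => F (eith t)) (Z.of_nat j)).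
  assert (Hsum : summable (fun j => (a j * Cpow w j)%C)).
  { apply ex_series_Cmod_le with (fun j => B * Cmod w ^ j).
    - intros j. rewrite Cmod_mult, Cmod_pow. apply Rmult_le_compat_r; [apply pow_le, Hw0|].
      apply Cmod_Cmean_bound; [apply Ccont_four_integrand, Ccont_disc_alg, HF|].
      intros t _. rewrite Cmod_mult, Cmod_eith, Rmult_1_r. apply HB. rewrite Cmod_eith; lra.
    - apply (ex_series_scal_l B (fun j => Cmod w ^ j)), Hg1. }
  apply eq_of_Cmod_le_eps with (1 + / (1 - Cmod w) + 1). intros eps He.
  destruct (HF eps He) as [P [[n [c Hc]] H]].
  destruct (CSeries_lim _ Hsum eps He) as [M HM]. specialize (HM (n + M)%nat ltac:(lia)).
  fold (pseries a w) in HM. fold (poly a (n + M) w) in HM.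
  set (c' := fun j => if lt_dec j n then c j else RtoC 0).
  assert (HP : forall w, P w = poly c' (n + M) w).
  { intros w'. rewrite Hc. apply poly_extend. lia. }
  replace (F w - pseries a w)%C with
    (F w - P w + (P w - poly a (n + M) w + (poly a (n + M) w - pseries a w)))%C by ring.
  eapply Rle_trans; [apply Cmod_triangle|].
  eapply Rle_trans; [apply Rplus_le_compat_l, Cmod_triangle|].
  specialize (H w ltac:(lra)) as H1.
  assert (H2 : Cmod (P w - poly a (n + M) w) <= eps * / (1 - Cmod w)); [|lra].
  rewrite HP. unfold poly.
  replace (csum (fun j => (c' j * Cpow w j)%C) (n + M) - csum (fun j => (a j * Cpow w j)%C) (n + M))%C
    with (csum (fun j => ((c' j - a j) * Cpow w j)%C) (n + M)).
  2:{ set (m := (n + M)%nat). clearbody m. clear. induction m as [|m IH]; simpl; [ring|]. rewrite IH. ring. }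
  eapply Rle_trans; [apply Cmod_csum|].
  apply Rle_trans with (rsum (fun j => eps * Cmod w ^ j) (n + M)).
  - apply rsum_le. intros j Hj. rewrite Cmod_mult, Cmod_pow. apply Rmult_le_compat_r; [apply pow_le, Hw0|].
    replace (c' j) with (four (fun t => P (eith t)) (Z.of_nat j)).
    + rewrite Cmod_minus_sym. unfold a, four.
      assert (HPc : Ccont (fun t => P (eith t))) by (apply Ccont_poly; exists n, c; exact Hc).
      rewrite <- Cmean_minus by (apply Ccont_four_integrand; first [assumption | apply Ccont_disc_alg, HF]).
      apply Cmod_Cmean_bound.
      * apply Ccont_minus; apply Ccont_four_integrand; [apply Ccont_disc_alg, HF|assumption].
      * intros t _. replace (F (eith t) * eith (- IZR (Z.of_nat j) * t) - P (eith t) * eith (- IZR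
          (Z.of_nat j) * t))%C
          with ((F (eith t) - P (eith t)) * eith (- IZR (Z.of_nat j) * t))%C by ring.
        rewrite Cmod_mult, Cmod_eith, Rmult_1_r. apply H. rewrite Cmod_eith; lra.
    + rewrite (four_ext _ (trig 0 c' (n + M))).
      * rewrite <- (Z.add_0_l (Z.of_nat j)). apply four_trig, Hj.
      * intros t _. rewrite HP. apply poly_trig.
  - rewrite rsum_mult_l. apply Rmult_le_compat_l; [lra|]. rewrite <- Hg2.
    apply rsum_le_Series; [intros; apply pow_le, Hw0|exact Hg1].
Qed.

Lemma le_of_le_eps a b k : (forall eps, 0 < eps <= 1 -> a <= b + k * eps) -> a <= b.
Proof.
  intros H. apply Rle_plus_epsilon. intros e He. pose proof (Rabs_pos k) as Hk. pose proof (Rle_abs k).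
  set (e' := Rmin 1 (e / (Rabs k + 1))).
  assert (He' : 0 < e') by (apply Rmin_pos; [lra|apply Rdiv_lt_0_compat; lra]).
  assert (e' <= 1) by apply Rmin_l.
  eapply Rle_trans; [apply (H e'); lra|]. apply Rplus_le_compat_l.
  apply Rle_trans with ((Rabs k + 1) * (e / (Rabs k + 1))).
  - apply Rle_trans with ((Rabs k + 1) * e'); [nra|]. apply Rmult_le_compat_l; [lra|apply Rmin_r].
  - right. field. lra.
Qed.

Lemma disc_alg_approx_nrm F P eps : disc_alg F -> is_poly P -> 0 <= eps ->
  (forall w, Cmod w <= 1 -> Cmod (F w - P w) <= eps) ->
  nrm (fun t => P (eith t)) <= nrm (fun t => F (eith t)) + eps.
Proof.
  intros HF HP He H.
  pose proof (Ccont_disc_alg F HF) as CF. pose proof (Ccont_poly P HP) as CP.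
  rewrite (nrm_ext (fun t => P (eith t)) (fun t => (F (eith t) + (P (eith t) - F (eith t)))%C)).
  2:{ intros; f_equal; ring. }
  eapply Rle_trans; [apply nrm_triangle; [exact CF|apply Ccont_minus; assumption]|].
  apply Rplus_le_compat_l, nrm_bound; [apply Ccont_minus; assumption|exact He|].
  intros t _. rewrite Cmod_minus_sym. apply H. rewrite Cmod_eith; lra.
Qed.

(** Both sides are continuous in [F] for uniform convergence, so the estimate extends from
    polynomials to their closure. *)
Lemma disc_alg_linear_bound q k F : Ccont q -> 0 <= k ->
  (forall P, is_poly P -> Cmod (Cmean (fun t => (q t * P (eith t))%C)) <= k * nrm (fun t => P (eith t))) ->
  disc_alg F -> Cmod (Cmean (fun t => (q t * F (eith t))%C)) <= k * nrm (fun t => F (eith t)).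
Proof.
  intros Hq Hk H HF. apply le_of_le_eps with (k + nrm q). intros eps [He _].
  destruct (HF eps He) as [P [HP HB]].
  pose proof (Ccont_disc_alg F HF) as CF. pose proof (Ccont_poly P HP) as CP.
  pose proof (Ccont_minus _ _ CF CP) as CFP.
  rewrite (Cmean_ext _ (fun t => (q t * P (eith t) + q t * (F (eith t) - P (eith t)))%C)) by (intros; ring).
  rewrite (Cmean_plus _ _ (Ccont_mult _ _ Hq CP) (Ccont_mult _ _ Hq CFP)).
  eapply Rle_trans; [apply Cmod_triangle|].
  assert (H1 : Cmod (Cmean (fun t => (q t * (F (eith t) - P (eith t)))%C)) <= nrm q * eps).
  { eapply Rle_trans; [apply (Cmod_Cmean_mult_le q _ Hq CFP)|]. apply Rmult_le_compat_l; [apply nrm_ge0|].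
    apply nrm_bound; [exact CFP|lra|]. intros t _. apply HB. rewrite Cmod_eith. lra. }
  pose proof (H P HP). pose proof (disc_alg_approx_nrm F P eps HF HP ltac:(lra) HB).
  assert (k * nrm (fun t => P (eith t)) <= k * (nrm (fun t => F (eith t)) + eps)) by (apply
      Rmult_le_compat_l; assumption).
  lra.
Qed.

(** With one factor absorbed into the kernel this is a linear bound; it is applied once in each
    factor. *)
Lemma disc_alg_bilinear_bound q k F G : Ccont q -> 0 <= k ->
  (forall P R, is_poly P -> is_poly R ->
     Cmod (Cmean (fun t => (q t * (P (eith t) * R (eith t)))%C)) <=
     k * (nrm (fun t => P (eith t)) * nrm (fun t => R (eith t)))) ->
  disc_alg F -> disc_alg G ->
  Cmod (Cmean (fun t => (q t * (F (eith t) * G (eith t)))%C)) <=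
  k * (nrm (fun t => F (eith t)) * nrm (fun t => G (eith t))).
Proof.
  intros Hq Hk H HF HG. pose proof (Ccont_disc_alg F HF) as CF.
  assert (Hn : forall f, 0 <= k * nrm f) by (intros; apply Rmult_le_pos; [exact Hk|apply nrm_ge0]).
  rewrite <- Rmult_assoc, (Cmean_ext _ (fun t => (q t * F (eith t) * G (eith t))%C)) by (intros; ring).
  apply disc_alg_linear_bound; [apply Ccont_mult; assumption|apply Hn| |exact HG].
  intros U HU. pose proof (Ccont_poly U HU) as CU.
  rewrite (Cmean_ext _ (fun t => (q t * U (eith t) * F (eith t))%C)) by (intros; ring).
  rewrite Rmult_assoc, (Rmult_comm (nrm _)), <- Rmult_assoc.
  apply disc_alg_linear_bound; [apply Ccont_mult; assumption|apply Hn| |exact HF].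
  intros P HP. rewrite (Cmean_ext _ (fun t => (q t * (P (eith t) * U (eith t)))%C)) by (intros; ring).
  rewrite Rmult_assoc, (Rmult_comm (nrm (fun t => U (eith t)))). apply H; assumption.
Qed.

(** * The cut-off multiplier *)

Definition expo_taylor (n : nat) (x : R) : R := rsum (fun i => x ^ i / INR (fact i)) n.
(** The last Taylor term of e^{2s} kept in [cutoff], damped by e^{-s}. Since it is the exact defect
    of analyticity, its size at 0 and at infinity governs all later estimates. *)
Definition tail_term (q : nat) (s : R) : R := exp (- s) * ((2 * s) ^ q / INR (fact q)).

(* [cutoff q s] agrees with [exp s] to order [s^q] at [s = 0] but stays bounded for [s >= 0]. *)
Definition cutoff (q : nat) (s : R) : R := exp (- s) * expo_taylor (S q) (2 * s).
(** The derivative of [cutoff q]: differentiating the Taylor polynomial drops its top term. The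
    equation m' = m of the exponential thus fails by exactly twice [tail_term], which has order
    s^q. *)
Definition cutoff' (q : nat) (s : R) : R := cutoff q s - 2 * tail_term q s.

Lemma INR_fact_pos n : 0 < INR (fact n).
Proof. apply lt_0_INR, lt_O_fact. Qed.

Lemma expo_taylor_derive n x : is_derive (expo_taylor (S n)) x (expo_taylor n x).
Proof.
  induction n as [|n IH].
  - unfold expo_taylor; simpl. apply is_derive_ext with (fun _ : R => 0 + 1 / 1); [reflexivity|apply
      is_derive_Rconst].
  - unfold expo_taylor in *. simpl rsum at 2.
    apply is_derive_ext with (fun x => rsum (fun i => x ^ i / INR (fact i)) (S n) + x ^ S n / INR (fact (S n))).
    { intros; reflexivity. }
    apply is_derive_Rplus; [exact IH|].
    pose proof (INR_fact_pos n).
    auto_derive; [trivial|].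
    change (fact n + n * fact n)%nat with (S n * fact n)%nat. rewrite mult_INR.
    change (match n with O => 1 | S _ => INR n + 1 end) with (INR (S n)). pose proof (lt_0_INR (S n)
        ltac:(lia)). field. lra.
Qed.

Lemma cutoff_derive q s : is_derive (cutoff q) s (cutoff' q s).
Proof.
  unfold cutoff.
  eapply is_derive_eq.
  - apply (is_derive_Rmult (fun s => exp (- s)) (fun s => expo_taylor (S q) (2 * s)) s (- exp (- s)) (2 *
      expo_taylor q (2 * s))).
    + auto_derive; [trivial|ring].
    + apply (is_derive_Rcomp (expo_taylor (S q)) (fun s => 2 * s)); [apply expo_taylor_derive|].
      auto_derive; [trivial|ring].
  - cbv beta. unfold cutoff', cutoff, tail_term, expo_taylor. simpl rsum. ring.
Qed.

Lemma tail_term_derive q s : is_derive (tail_term (S q)) s (2 * tail_term q s - tail_term (S q) s).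
Proof.
  unfold tail_term. pose proof (INR_fact_pos q).
  auto_derive; [trivial|].
  change (fact (S q)) with (S q * fact q)%nat. change (fact q + q * fact q)%nat with (S q * fact q)%nat.
  rewrite mult_INR.
  change (match q with O => 1 | S _ => INR q + 1 end) with (INR (S q)).
  pose proof (lt_0_INR (S q) ltac:(lia)).
  change ((2 * s) ^ S q) with ((2 * s) * (2 * s) ^ q). field. lra.
Qed.

(** The n-th Taylor term is below the whole exponential. This one inequality bounds [tail_term],
    trades t^q for n^{-q} against exponential decay, and beats polynomial growth by a geometric
    factor. *)
Lemma pow_le_fact_exp n x : 0 <= x -> x ^ n <= INR (fact n) * exp x.
Proof.
  intros Hx. pose proof (INR_fact_pos n).
  assert (Ht : expo_taylor (S n) x <= exp x).
  { unfold expo_taylor. rewrite <- sum_n_rsum, sum_n_Reals. apply exp_ge_taylor, Hx. }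
  assert (x ^ n / INR (fact n) <= exp x).
  { eapply Rle_trans; [|exact Ht]. unfold expo_taylor; simpl.
    assert (0 <= rsum (fun i => x ^ i / INR (fact i)) n); [|lra].
    apply rsum_ge0. intros i _. apply Rmult_le_pos; [apply pow_le, Hx|].
    apply Rlt_le, Rinv_0_lt_compat, INR_fact_pos. }
  apply Rle_trans with (INR (fact n) * (x ^ n / INR (fact n))); [right; field; lra|].
  apply Rmult_le_compat_l; lra.
Qed.

Lemma tail_term_ge0 q s : 0 <= s -> 0 <= tail_term q s.
Proof.
  intros Hs. unfold tail_term. apply Rmult_le_pos; [apply Rlt_le, exp_pos|].
  apply Rmult_le_pos; [apply pow_le; lra|]. apply Rlt_le, Rinv_0_lt_compat, INR_fact_pos.
Qed.

Lemma tail_term_le q s : 0 <= s -> tail_term q s <= 2 ^ q.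
Proof.
  intros Hs. unfold tail_term. rewrite Rpow_mult_distr.
  pose proof (pow_le_fact_exp q s Hs). pose proof (INR_fact_pos q). pose proof (exp_pos (- s)).
  assert (E : exp (- s) * exp s = 1) by (rewrite <- exp_plus, Rplus_opp_l; apply exp_0).
  assert (0 < 2 ^ q) by (apply pow_lt; lra).
  apply Rle_trans with (exp (- s) * (2 ^ q * (INR (fact q) * exp s) / INR (fact q))).
  - apply Rmult_le_compat_l; [lra|]. apply Rmult_le_compat_r; [apply Rlt_le, Rinv_0_lt_compat; lra|].
    apply Rmult_le_compat_l; lra.
  - right. replace (exp (- s) * (2 ^ q * (INR (fact q) * exp s) / INR (fact q)))
      with (2 ^ q * (exp (- s) * exp s)) by (field; lra). rewrite E. ring.
Qed.

Lemma tail_term_le_pow q s : 0 <= s -> tail_term q s <= 2 ^ q * s ^ q.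
Proof.
  intros Hs. unfold tail_term. rewrite <- Rpow_mult_distr.
  assert (0 <= (2 * s) ^ q) by (apply pow_le; lra).
  assert (exp (- s) <= 1) by (rewrite <- exp_0; apply exp_mono; lra).
  assert (H1 : / INR (fact q) <= 1).
  { rewrite <- Rinv_1. apply Rinv_le_contravar; [lra|]. apply (le_INR 1). apply lt_O_fact. }
  pose proof (exp_pos (- s)). assert (0 < / INR (fact q)) by (apply Rinv_0_lt_compat, INR_fact_pos).
  apply Rle_trans with (1 * ((2 * s) ^ q * 1)); [|lra].
  apply Rmult_le_compat; try lra; [apply Rmult_le_pos; lra|]. apply Rmult_le_compat_l; lra.
Qed.

(** The i-th term is [tail_term i s], at most 2^i, and the powers of 2 add up to less than 2^q. *)
Lemma expo_taylor_scaled_le q s : 0 <= s -> 0 <= exp (- s) * expo_taylor q (2 * s) <= 2 ^ q.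
Proof.
  intros Hs. induction q as [|q IH].
  - unfold expo_taylor; simpl. lra.
  - assert (E : exp (- s) * expo_taylor (S q) (2 * s) = exp (- s) * expo_taylor q (2 * s) + tail_term q s).
    { unfold expo_taylor, tail_term. simpl rsum. ring. }
    rewrite E. pose proof (tail_term_le q s Hs). pose proof (tail_term_ge0 q s Hs). simpl. lra.
Qed.

Lemma Rabs_cutoff'_le q s : 0 <= s -> Rabs (cutoff' q s) <= 2 ^ (q + 2).
Proof.
  intros Hs. pose proof (expo_taylor_scaled_le (S q) s Hs) as H. fold (cutoff q s) in H.
  pose proof (tail_term_le q s Hs). pose proof (tail_term_ge0 q s Hs).
  assert (E : 2 ^ (q + 2) = 4 * 2 ^ q) by (rewrite pow_add; simpl; ring).
  simpl in H. unfold cutoff'. rewrite E. apply Rabs_le. lra.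
Qed.

Lemma cutoff'_0 q : cutoff' (S q) 0 = 1.
Proof.
  unfold cutoff', cutoff, tail_term. rewrite Ropp_0, exp_0, Rmult_0_r. unfold expo_taylor.
  rewrite pow_i by lia.
  assert (E : forall n, rsum (fun i => 0 ^ i / INR (fact i)) (S n) = 1).
  { induction n as [|n IH]; [simpl; field|].
    change (rsum (fun i => 0 ^ i / INR (fact i)) (S n) + 0 ^ S n / INR (fact (S n)) = 1).
    rewrite IH, pow_i by lia. unfold Rdiv; ring. }
  rewrite E. unfold Rdiv. ring.
Qed.

Lemma tail_term_0 q : tail_term (S q) 0 = 0.
Proof. unfold tail_term. rewrite Rmult_0_r, pow_i by lia. unfold Rdiv. ring. Qed.

Lemma MVT_halfline (f df : R -> R) K : (forall x, is_derive f x (df x)) ->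
  (forall x, 0 <= x -> Rabs (df x) <= K) -> forall s, 0 <= s -> Rabs (f s - f 0) <= K * s.
Proof.
  intros HD HK s Hs. destruct (MVT_is_derive f df 0 s HD) as [c [Hc E]].
  rewrite Rmin_left, Rmax_right in Hc by lra. rewrite E, Rabs_mult, Rminus_0_r, (Rabs_pos_eq s) by lra.
  apply Rmult_le_compat_r; [exact Hs|]. apply HK. lra.
Qed.

(** The minimum of 1 and s = jt is the weight that [min_weight_small] sums against j |v_j|, giving
    smallness as t -> 0 uniformly in the truncation. Large s uses the global bound, small s the mean
    value theorem. *)
Lemma tail_term_le_min q s : 0 <= s -> tail_term (S q) s <= 2 ^ (S q) * Rmin 1 s.
Proof.
  intros Hs. unfold Rmin. destruct (Rle_dec 1 s).
  - rewrite Rmult_1_r. apply tail_term_le, Hs.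
  - eapply Rle_trans; [apply Rle_abs|]. rewrite <- (Rminus_0_r (tail_term (S q) s)), <- (tail_term_0 q).
    apply (MVT_halfline _ (fun s => 2 * tail_term q s - tail_term (S q) s)); [apply tail_term_derive|
        |exact Hs].
    intros x Hx. pose proof (tail_term_le q x Hx). pose proof (tail_term_ge0 q x Hx).
    pose proof (tail_term_le (S q) x Hx). pose proof (tail_term_ge0 (S q) x Hx).
    simpl in *. apply Rabs_le. lra.
Qed.

(** For s >= 1 this is the global bound on [cutoff']; for s < 1 it is the mean value theorem from
    the value 1 at 0, the second derivative being bounded too. The factor 2^5 covers both cases. *)
Lemma cutoff'_minus_1_le q s : 0 <= s -> Rabs (cutoff' (S q) s - 1) <= 2 ^ (q + 5) * Rmin 1 s.
Proof.
  intros Hs.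
  assert (E : 2 ^ (q + 5) = 32 * 2 ^ q) by (rewrite pow_add; simpl; ring).
  assert (E2 : 2 ^ (S q + 2) = 8 * 2 ^ q) by (rewrite pow_add; simpl; ring).
  assert (1 <= 2 ^ q) by (apply pow_R1_Rle; lra).
  unfold Rmin. destruct (Rle_dec 1 s).
  - rewrite Rmult_1_r. pose proof (Rabs_cutoff'_le (S q) s Hs). unfold Rminus.
    eapply Rle_trans; [apply Rabs_triang|]. rewrite Rabs_Ropp, Rabs_R1. lra.
  - rewrite <- (cutoff'_0 q).
    apply (MVT_halfline _ (fun s => cutoff' (S q) s - 2 * (2 * tail_term q s - tail_term (S q) s))); [|
        |exact Hs].
    + intros x. unfold cutoff' at 1. apply is_derive_Rminus; [apply cutoff_derive|].
      apply (is_derive_scal (tail_term (S q)) x 2), tail_term_derive.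
    + intros x Hx. pose proof (tail_term_le q x Hx). pose proof (tail_term_ge0 q x Hx).
      pose proof (tail_term_le (S q) x Hx). pose proof (tail_term_ge0 (S q) x Hx).
      pose proof (Rabs_cutoff'_le (S q) x Hx) as H4. apply Rabs_le_between in H4.
      simpl in *. apply Rabs_le. lra.
Qed.

Lemma exp_neg_minus_1_le s : 0 <= s -> Rabs (exp (- s) - 1) <= Rmin 1 s.
Proof.
  intros Hs. pose proof (exp_ineq1_le (- s)). pose proof (exp_pos (- s)).
  assert (exp (- s) <= 1) by (rewrite <- exp_0; apply exp_mono; lra).
  rewrite Rabs_left1 by lra. apply Rmin_glb; lra.
Qed.

(** * Oscillatory integrals with a non-stationary phase *)

Lemma CD_scal c f t l : CD f t l -> CD (fun x => (c * f x)%C) t (c * l)%C.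
Proof.
  intros H. eapply CD_eq; [apply CD_mult; [apply CD_const|exact H]|]. cbv beta. ring.
Qed.

Lemma CD_scal_r c f t l : CD f t l -> CD (fun x => (f x * c)%C) t (l * c)%C.
Proof.
  intros H. eapply CD_eq; [apply CD_mult; [exact H|apply CD_const]|]. cbv beta. ring.
Qed.

Lemma is_derive_lin_comp (f df : R -> R) a : (forall x, is_derive f x (df x)) ->
  forall t, is_derive (fun t => f (a * t)) t (a * df (a * t)).
Proof.
  intros H t. apply (is_derive_Rcomp f (fun t => a * t)); [apply H|]. auto_derive; [trivial|ring].
Qed.

(** Rotating J so that J 0 becomes positive and subtracting (A/a) e^{-at} from its real part gives a
    real function with nonnegative derivative on [0, t0]; one mean value step then replaces an
    integration in t. *)
Lemma Cmod_le_of_derive_decay (J dJ : R -> C) t0 A a : 0 <= t0 -> 0 < a -> 0 <= A ->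
  (forall t, CD J t (dJ t)) -> (forall t, 0 <= t <= t0 -> Cmod (dJ t) <= A * exp (- a * t)) ->
  Cmod (J 0) <= Cmod (J t0) + A / a.
Proof.
  intros Ht0 Ha HA HD Hb.
  destruct (Req_dec (Cmod (J 0)) 0) as [E0|E0].
  { rewrite E0. pose proof (Cmod_ge_0 (J t0)). assert (0 <= A / a) by (apply Rmult_le_pos; [lra|apply
      Rlt_le, Rinv_0_lt_compat, Ha]). lra. }
  pose proof (Cmod_ge_0 (J 0)) as Hp0.
  set (lam := (RtoC (/ Cmod (J 0)) * Cconj (J 0))%C).
  assert (Hlam : Cmod lam = 1).
  { unfold lam. rewrite Cmod_mult, Cmod_conj, Cmod_R, Rabs_pos_eq; [field; exact E0|].
    apply Rlt_le, Rinv_0_lt_compat. lra. }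
  assert (HlamJ : fst (lam * J 0)%C = Cmod (J 0)).
  { unfold lam. replace (RtoC (/ Cmod (J 0)) * Cconj (J 0) * J 0)%C with
      (RtoC (/ Cmod (J 0)) * (J 0 * Cconj (J 0)))%C by ring.
    rewrite Cmult_conj_r, <- RtoC_mult. simpl. field. exact E0. }
  set (g := fun t => fst (lam * J t)%C - A / a * exp (- a * t)).
  destruct (MVT_is_derive g (fun t => fst (lam * dJ t)%C + A * exp (- a * t)) 0 t0) as [c [Hc E]].
  { intros t. unfold g.
    eapply is_derive_eq; [apply is_derive_Rminus; [exact (proj1 (CD_scal lam J t _ (HD t)))|]|].
    - apply (is_derive_scal (fun t => exp (- a * t)) t (A / a) (- a * exp (- a * t))).
      auto_derive; [trivial|ring].
    - unfold scal; simpl; unfold mult; simpl. field. lra. }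
  rewrite Rmin_left, Rmax_right in Hc by exact Ht0.
  assert (Hge : 0 <= fst (lam * dJ c)%C + A * exp (- a * c)).
  { pose proof (Hb c Hc) as H. pose proof (Rabs_fst_le (lam * dJ c)%C) as H1.
    rewrite Cmod_mult, Hlam, Rmult_1_l in H1. apply Rabs_le_between in H1. lra. }
  unfold g in E. rewrite HlamJ in E. replace (- a * 0) with 0 in E by ring. rewrite exp_0 in E.
  pose proof (Rabs_fst_le (lam * J t0)%C) as H2. rewrite Cmod_mult, Hlam, Rmult_1_l in H2.
  apply Rabs_le_between in H2.
  assert (0 <= (fst (lam * dJ c)%C + A * exp (- a * c)) * (t0 - 0)) by (apply Rmult_le_pos; lra).
  assert (0 <= A / a * exp (- a * t0)).
  { apply Rmult_le_pos; [apply Rmult_le_pos; [lra|apply Rlt_le, Rinv_0_lt_compat, Ha]|apply Rlt_le, exp_pos]. }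
  lra.
Qed.

(** Dominated convergence by hand: beyond M the weight is at most 1 and the tail is below eps / 2,
    while the first M terms are O(t). The threshold [t0] does not depend on [J]. *)
Lemma min_weight_small (x : nat -> R) : (forall j, 0 <= x j) -> ex_series x ->
  forall eps, 0 < eps -> exists t0, 0 < t0 /\ forall t J, 0 <= t <= t0 ->
    rsum (fun j => x j * Rmin 1 (INR (S j) * t)) J <= eps.
Proof.
  intros Hx Hs eps He.
  destruct (is_series_rsum x Hs (eps / 2)) as [M HM]; [lra|]. specialize (HM M (le_n M)).
  set (S0 := rsum (fun j => x j * INR (S j)) M).
  assert (HS0 : 0 <= S0) by (apply rsum_ge0; intros; apply Rmult_le_pos; [apply Hx|apply pos_INR]).
  assert (Ht0 : 0 < eps / (2 * (S0 + 1))) by (apply Rdiv_lt_0_compat; lra).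
  exists (eps / (2 * (S0 + 1))). split; [exact Ht0|].
  intros t J [Ht Ht'].
  assert (Hm0 : forall j, 0 <= Rmin 1 (INR (S j) * t)).
  { intros j. apply Rmin_glb; [lra|]. apply Rmult_le_pos; [apply pos_INR|exact Ht]. }
  assert (Hpos : forall j, 0 <= x j * Rmin 1 (INR (S j) * t)) by (intros; apply Rmult_le_pos; auto).
  eapply Rle_trans; [apply (rsum_mono _ J (M + J) Hpos); lia|]. rewrite rsum_app.
  assert (H1 : rsum (fun j => x j * Rmin 1 (INR (S j) * t)) M <= eps / 2).
  { apply Rle_trans with (rsum (fun j => t * (x j * INR (S j))) M).
    - apply rsum_le. intros j _. pose proof (Rmin_r 1 (INR (S j) * t)). pose proof (Hx j). nra.
    - rewrite rsum_mult_l. fold S0.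
      apply Rle_trans with (eps / (2 * (S0 + 1)) * (S0 + 1)); [nra|]. right. field. lra. }
  assert (H2 : rsum (fun i => x (M + i)%nat * Rmin 1 (INR (S (M + i)) * t)) J <= eps / 2).
  { apply Rle_trans with (rsum (fun i => x (M + i)%nat) J).
    - apply rsum_le. intros j _. pose proof (Rmin_l 1 (INR (S (M + j)) * t)). pose proof (Hx (M + j)%nat). nra.
    - pose proof (rsum_le_Series x (M + J) Hx Hs) as H. rewrite rsum_app in H.
      apply Rabs_def2 in HM. lra. }
  lra.
Qed.

(** * The almost analytic extension and its d-bar identity *)

Section Phase.

Context (q0 : nat) (v : nat -> C).
Let q := S q0.

(* Almost analytic extension of [N - conj N] to [e^{i y - t}], [t >= 0], truncated to [J] modes:
   the modes of [conj N] extend analytically, those of [N] through [cutoff]. *)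
Definition ext_term (j : nat) (t y : R) : C :=
  (v j * (RtoC (cutoff q (INR (S j) * t)) * eith (- INR (S j) * y)) + - Cconj (v j) * (RtoC (exp (- (INR (S
      j) * t))) * eith (INR (S j) * y)))%C.
Definition ext (J : nat) (t y : R) : C := csum (fun j => ext_term j t y) J.

Definition ext_t_term (j : nat) (t y : R) : C :=
  (v j * (RtoC (INR (S j) * cutoff' q (INR (S j) * t)) * eith (- INR (S j) * y)) + - Cconj (v j) * (RtoC
      (INR (S j) * - exp (- (INR (S j) * t))) * eith (INR (S j) * y)))%C.
Definition ext_t (J : nat) (t y : R) : C := csum (fun j => ext_t_term j t y) J.

Definition ext_y_term (j : nat) (t y : R) : C :=
  (v j * (RtoC (cutoff q (INR (S j) * t)) * ((0, - INR (S j))%R * eith (- INR (S j) * y))) + - Cconj (v j)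
      * (RtoC (exp (- (INR (S j) * t))) * ((0, INR (S j))%R * eith (INR (S j) * y))))%C.
Definition ext_y (J : nat) (t y : R) : C := csum (fun j => ext_y_term j t y) J.

(** The operator d/dt - i d/dy annihilates analytic functions of e^{iy - t}, so the modes of conj N
    drop out. A mode of N contributes (j + 1)(m' - m) at s = (j + 1) t, which is minus twice
    [tail_term]. *)
Definition dbar_term (j : nat) (t y : R) : C :=
  (v j * RtoC (- (INR (S j) * (2 * tail_term q (INR (S j) * t)))) * eith (- INR (S j) * y))%C.
Definition dbar (J : nat) (t y : R) : C := csum (fun j => dbar_term j t y) J.

Lemma ext_dbar J t y : (ext_t J t y - Ci * ext_y J t y)%C = dbar J t y.
Proof.
  unfold ext_t, ext_y, dbar, ext_t_term, ext_y_term, dbar_term. induction J as [|J IH]; [simpl; ring|].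
  cbn [csum]. rewrite <- IH. unfold cutoff'.
  replace (0, - INR (S J)) with (- Ci * RtoC (INR (S J)))%C.
  2:{ unfold Cmult, Copp, Ci, RtoC; cbn [fst snd]. f_equal; ring. }
  replace (0, INR (S J)) with (Ci * RtoC (INR (S J)))%C.
  2:{ unfold Cmult, Ci, RtoC; cbn [fst snd]. f_equal; ring. }
  assert (HCi : (Ci * Ci)%C = (- RtoC 1)%C).
  { unfold Cmult, Copp, Ci, RtoC; simpl. f_equal; ring. }
  set (x := INR (S J)). set (m := cutoff q (x * t)). set (mu := tail_term q (x * t)).
  set (e := exp (- (x * t))). set (e1 := eith (- x * y)). set (e2 := eith (x * y)).
  rewrite !RtoC_mult, RtoC_minus, !RtoC_opp, !RtoC_mult.
  match goal with |- (?A + ?T - Ci * (?A' + ?T'))%C = _ =>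
    transitivity (A - Ci * A' + (T - Ci * T'))%C; [ring|] end.
  f_equal.
  (* [ring] treats [Ci] as a free variable; the added multiple of Ci * Ci + 1 vanishes and supplies
     i^2 = -1 where it is used. *)
  match goal with |- ?X = _ =>
    transitivity (X + (Ci * Ci + RtoC 1) * (v J * (RtoC m * (RtoC x * e1)) + Cconj (v J) * (RtoC e * (RtoC
        x * e2))))%C end.
  - rewrite HCi. ring.
  - ring_simplify. rewrite ?HCi. replace (Cpow Ci 2) with (- RtoC 1)%C by (rewrite <- HCi; simpl; ring). ring.
Qed.

Lemma ext_CD_t J t y : CD (fun t => ext J t y) t (ext_t J t y).
Proof.
  apply (CD_csum (fun j t => ext_term j t y)).
  intros j. apply CD_plus; apply CD_scal, CD_scal_r, CD_RtoC.
  - apply is_derive_lin_comp, cutoff_derive.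
  - apply (is_derive_lin_comp (fun s => exp (- s)) (fun s => - exp (- s))).
    intros x. auto_derive; [trivial|ring].
Qed.

Lemma ext_CD_y J t y : CD (ext J t) y (ext_y J t y).
Proof.
  apply (CD_csum (fun j y => ext_term j t y)).
  intros j. apply CD_plus; apply CD_scal, CD_scal, CD_eith.
Qed.

Lemma continuous_lin_comp (f : R -> R) a : (forall x, continuous f x) ->
  forall t, continuous (fun t => f (a * t)) t.
Proof.
  intros H t. apply (continuous_comp (fun t => a * t) f); [|apply H].
  apply continuous_Rmult; [apply continuous_const|apply continuous_id].
Qed.

Lemma continuous_exp_opp_lin a t : continuous (fun t => exp (- (a * t))) t.
Proof.
  apply (ex_derive_continuous (fun t => exp (- (a * t)))). auto_derive; trivial.
Qed.

Lemma continuous_cutoff s : continuous (cutoff q) s.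
Proof. eapply continuous_derivable, cutoff_derive. Qed.

Lemma continuous_cutoff' s : continuous (cutoff' q) s.
Proof.
  unfold cutoff'. apply continuous_Rminus; [apply continuous_cutoff|].
  apply continuous_Rmult; [apply continuous_const|]. unfold q. eapply continuous_derivable, tail_term_derive.
Qed.

Lemma C2cont_ext J : C2cont (ext J).
Proof.
  apply (C2cont_csum (fun j t y => ext_term j t y)).
  intros j. apply C2cont_plus; apply C2cont_mult; try apply C2cont_const; apply C2cont_mult.
  - apply (C2cont_fst (fun t => RtoC (cutoff q (INR (S j) * t)))), Ccont_RtoC, continuous_lin_comp,
      continuous_cutoff.
  - apply (C2cont_snd (fun y => eith (- INR (S j) * y))), Ccont_eith.
  - apply (C2cont_fst (fun t => RtoC (exp (- (INR (S j) * t))))), Ccont_RtoC, continuous_exp_opp_lin.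
  - apply (C2cont_snd (fun y => eith (INR (S j) * y))), Ccont_eith.
Qed.

Lemma C2cont_ext_t J : C2cont (ext_t J).
Proof.
  apply (C2cont_csum (fun j t y => ext_t_term j t y)).
  intros j. apply C2cont_plus; apply C2cont_mult; try apply C2cont_const; apply C2cont_mult.
  - apply (C2cont_fst (fun t => RtoC (INR (S j) * cutoff' q (INR (S j) * t)))), Ccont_RtoC.
    intros t. apply continuous_Rmult; [apply continuous_const|].
    apply (continuous_lin_comp (cutoff' q)), continuous_cutoff'.
  - apply (C2cont_snd (fun y => eith (- INR (S j) * y))), Ccont_eith.
  - apply (C2cont_fst (fun t => RtoC (INR (S j) * - exp (- (INR (S j) * t))))), Ccont_RtoC.
    intros t. apply continuous_Rmult; [apply continuous_const|]. apply continuous_Ropp, continuous_exp_opp_lin.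
  - apply (C2cont_snd (fun y => eith (INR (S j) * y))), Ccont_eith.
Qed.

Lemma Ccont_ext_y J t : Ccont (ext_y J t).
Proof.
  apply (Ccont_csum (fun j y => ext_y_term j t y)).
  intros j. apply Ccont_plus; do 3 (apply Ccont_mult; [apply Ccont_const|]); apply Ccont_eith.
Qed.

Lemma Ccont_dbar J t : Ccont (dbar J t).
Proof.
  apply (Ccont_csum (fun j y => dbar_term j t y)).
  intros j. apply Ccont_mult; [apply Ccont_const|apply Ccont_eith].
Qed.

Lemma ext_periodic J t : ext J t PI = ext J t (- PI).
Proof.
  unfold ext, ext_term. apply csum_ext. intros j _.
  assert (E : eith (INR (S j) * PI) = eith (INR (S j) * - PI)) by (rewrite INR_IZR_INZ; apply eith_endpoints).
  rewrite E.
  replace (- INR (S j) * - PI) with (INR (S j) * PI) by ring.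
  replace (- INR (S j) * PI) with (INR (S j) * - PI) by ring. rewrite E. reflexivity.
Qed.

(** The exponential of n times the extended phase, multiplied by the z-th power of e^{iy - t}. With
    z = n - s it extends the truncation of Q e^{-isy} from t = 0 to smaller circles. *)
Definition wave (n : nat) (z : Z) (J : nat) (t y : R) : C :=
  (Cexp (RtoC (INR n) * ext J t y) * (RtoC (exp (- (IZR z * t))) * eith (IZR z * y)))%C.

Lemma wave_CD_t n z J t y : CD (fun t => wave n z J t y) t
  ((RtoC (INR n) * ext_t J t y + RtoC (- IZR z)) * wave n z J t y)%C.
Proof.
  unfold wave. eapply CD_eq.
  - apply CD_mult; [apply CD_Cexp, CD_scal, ext_CD_t|apply CD_scal_r, CD_RtoC].
    apply (is_derive_lin_comp (fun s => exp (- s)) (fun s => - exp (- s))).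
    intros x. auto_derive; [trivial|ring].
  - cbv beta. rewrite RtoC_mult, !RtoC_opp. ring.
Qed.

Lemma wave_CD_y n z J t y : CD (wave n z J t) y
  ((RtoC (INR n) * ext_y J t y + (0, IZR z)%R) * wave n z J t y)%C.
Proof.
  unfold wave. eapply CD_eq.
  - apply CD_mult; [apply CD_Cexp, CD_scal, ext_CD_y|apply CD_scal, CD_eith].
  - cbv beta. ring.
Qed.

Lemma C2cont_wave n z J : C2cont (wave n z J).
Proof.
  apply C2cont_mult; [apply C2cont_Cexp, C2cont_mult; [apply C2cont_const|apply C2cont_ext]|].
  apply C2cont_mult.
  - apply (C2cont_fst (fun t => RtoC (exp (- (IZR z * t))))), Ccont_RtoC, continuous_exp_opp_lin.
  - apply (C2cont_snd (fun y => eith (IZR z * y))), Ccont_eith.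
Qed.

Lemma Ccont_wave n z J t : Ccont (wave n z J t).
Proof. eapply CD_cont. intros y. apply wave_CD_y. Qed.

(** Stokes' theorem on an annulus: in the t-derivative, i times the y-derivative may be subtracted
    freely, being a total derivative over a period, and only the d-bar part of the phase
    survives. *)
Lemma Cmean_wave_CD n z J t : CD (fun t => Cmean (wave n z J t)) t
  (Cmean (fun y => (RtoC (INR n) * dbar J t y * wave n z J t y)%C)).
Proof.
  eapply CD_eq.
  - apply (CD_Cmean_param (wave n z J)
      (fun t y => ((RtoC (INR n) * ext_t J t y + RtoC (- IZR z)) * wave n z J t y)%C)).
    + intros x y. apply wave_CD_t.
    + apply C2cont_mult; [|apply C2cont_wave]. apply C2cont_plus; [|apply C2cont_const].
      apply C2cont_mult; [apply C2cont_const|apply C2cont_ext_t].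
    + intros x. apply Ccont_wave.
  - assert (Hy : Ccont (fun y => ((RtoC (INR n) * ext_y J t y + (0, IZR z)%R) * wave n z J t y)%C)).
    { apply Ccont_mult; [|apply Ccont_wave]. apply Ccont_plus; [|apply Ccont_const].
      apply Ccont_mult; [apply Ccont_const|apply Ccont_ext_y]. }
    assert (H0 : Cmean (fun y => ((RtoC (INR n) * ext_y J t y + (0, IZR z)%R) * wave n z J t y)%C) = RtoC 0).
    { apply (Cmean_derive_periodic (wave n z J t)); [intros; apply wave_CD_y|exact Hy|].
      unfold wave. rewrite ext_periodic, eith_endpoints. reflexivity. }
    rewrite (Cmean_ext (fun y => (RtoC (INR n) * dbar J t y * wave n z J t y)%C)
      (fun y => ((RtoC (INR n) * ext_t J t y + RtoC (- IZR z)) * wave n z J t y - Ci * ((RtoC (INR n) *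
          ext_y J t y + (0, IZR z)%R) * wave n z J t y))%C)).
    + rewrite Cmean_minus.
      * rewrite Cmean_scal by exact Hy. rewrite H0. ring.
      * apply Ccont_mult; [|apply Ccont_wave]. apply Ccont_plus; [|apply Ccont_const].
        apply Ccont_mult; [apply Ccont_const|].
        (* Continuity in y alone is read off from joint continuity with t frozen. *)
        intros y. destruct (C2cont_ext_t J t y) as [H1 H2].
        split; apply continuity_pt_filterlim.
        -- intros eps He. destruct (H1 (mkposreal eps He)) as [d Hd]. exists d. split; [apply cond_pos|].
           intros x [_ Hx]. simpl in *. apply Hd; [rewrite Rminus_diag, Rabs_R0; apply cond_pos|exact Hx].
        -- intros eps He. destruct (H2 (mkposreal eps He)) as [d Hd]. exists d. split; [apply cond_pos|].
           intros x [_ Hx]. simpl in *. apply Hd; [rewrite Rminus_diag, Rabs_R0; apply cond_pos|exact Hx].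
      * apply Ccont_mult; [apply Ccont_const|exact Hy].
    + intros y _. rewrite <- ext_dbar.
      replace (0, IZR z) with (Ci * RtoC (IZR z))%C.
      2:{ unfold Cmult, Ci, RtoC; cbn [fst snd]. f_equal; ring. }
      assert (HCi : Cpow Ci 2 = (- RtoC 1)%C).
      { simpl. unfold Cmult, Copp, Ci, RtoC; simpl. f_equal; ring. }
      rewrite RtoC_opp. ring_simplify. rewrite HCi. ring.
Qed.

End Phase.

(** * Norms of polynomials on smaller circles *)

Lemma nrm_le f g : Ccont f -> Ccont g -> (forall t, - PI <= t <= PI -> Cmod (f t) <= Cmod (g t)) ->
  nrm f <= nrm g.
Proof.
  intros Hf Hg H. apply sqrt_le_1_alt, Rmean_le; try (apply continuous_Cmod_sqr; assumption).
  intros t Ht. apply pow_incr. split; [apply Cmod_ge_0|apply H, Ht].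
Qed.

Lemma nrm_scal c f : Ccont f -> nrm (fun t => (c * f t)%C) = Cmod c * nrm f.
Proof.
  intros Hf. pose proof (Cmod_ge_0 c). pose proof (nrm_ge0 f).
  apply Rsqr_inj; [apply nrm_ge0|apply Rmult_le_pos; assumption|]. rewrite !Rsqr_pow2, Rpow_mult_distr.
  rewrite !nrm_sqr by (try apply Ccont_mult; try apply Ccont_const; exact Hf).
  rewrite <- Rmean_scal by (apply continuous_Cmod_sqr, Hf).
  apply Rmean_ext. intros t _. rewrite Cmod_mult. apply Rpow_mult_distr.
Qed.

Definition scaled (P : C -> C) (t y : R) : C := P (RtoC (exp (- t)) * eith y)%C.

Lemma scaled_trig P n c t : (forall w, P w = poly c n w) ->
  forall y, scaled P t y = trig 0 (fun i => (c i * RtoC (exp (- t) ^ i))%C) n y.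
Proof.
  intros Hc y. unfold scaled, trig. rewrite Hc. unfold poly. apply csum_ext. intros i _.
  rewrite Cpow_mult_l, <- RtoC_pow, eith_pow, Z.add_0_l, <- INR_IZR_INZ. ring.
Qed.

Lemma Ccont_scaled P t : is_poly P -> Ccont (scaled P t).
Proof.
  intros [n [c Hc]].
  apply Ccont_ext with (trig 0 (fun i => (c i * RtoC (exp (- t) ^ i))%C) n); [|apply Ccont_trig].
  intros y. symmetry. apply scaled_trig, Hc.
Qed.

(** By Parseval: on the circle of radius e^{-t} the i-th coefficient is multiplied by e^{-it} in
    modulus, a factor at most 1. *)
Lemma nrm_scaled_le P t : is_poly P -> 0 <= t -> nrm (scaled P t) <= nrm (fun y => P (eith y)).
Proof.
  intros [n [c Hc]] Ht.
  rewrite (nrm_ext (scaled P t) (trig 0 (fun i => (c i * RtoC (exp (- t) ^ i))%C) n))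
    by (intros; rewrite (scaled_trig P n c t Hc); reflexivity).
  rewrite (nrm_ext (fun y => P (eith y)) (trig 0 c n)) by (intros; rewrite Hc, poly_trig; reflexivity).
  apply Rsqr_incr_0_var; [|apply nrm_ge0]. rewrite !Rsqr_pow2, !parseval_trig.
  apply rsum_le. intros i _. apply pow_incr. split; [apply Cmod_ge_0|].
  rewrite Cmod_mult, Cmod_R. rewrite <- (Rmult_1_r (Cmod (c i))) at 2.
  apply Rmult_le_compat_l; [apply Cmod_ge_0|].
  assert (0 <= exp (- t) <= 1).
  { split; [apply Rlt_le, exp_pos|]. rewrite <- exp_0. apply exp_mono. lra. }
  rewrite Rabs_pos_eq by (apply pow_le; lra). apply Rpow_le_1. assumption.
Qed.

(** * Boundary values of N and the unimodular symbol *)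

(** The coefficients of N are indexed from 0 although N begins with the first power; this inserts
    the missing zero constant term. *)
Definition shift0 (a : nat -> C) (j : nat) : C := match j with O => RtoC 0 | S j => a j end.

Lemma summable_shift0 a : summable a -> summable (shift0 a).
Proof. intros Ha. apply summable_S. exact Ha. Qed.

Lemma summable_conj a : summable a -> summable (fun j => Cconj (a j)).
Proof.
  intros Ha. apply ex_series_ext with (fun j => Cmod (a j)); [|exact Ha].
  intros j. symmetry. apply Cmod_conj.
Qed.

Lemma summable_mult a b : summable a -> (forall j, Cmod (b j) <= 1) -> summable (fun j => (a j * b j)%C).
Proof.
  intros Ha Hb. apply ex_series_Cmod_le with (fun j => Cmod (a j)); [|exact Ha].
  intros j. rewrite Cmod_mult. pose proof (Hb j). pose proof (Cmod_ge_0 (a j)). pose proof (Cmod_ge_0 (b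
      j)). nra.
Qed.

Lemma Cmod_Cpow_le_1 w j : Cmod w <= 1 -> Cmod (Cpow w j) <= 1.
Proof. intros Hw. rewrite Cmod_pow. apply Rpow_le_1. split; [apply Cmod_ge_0|exact Hw]. Qed.

Lemma CSeries_shift0 a w : summable a -> Cmod w <= 1 ->
  CSeries (fun j => (a j * Cpow w (S j))%C) = pseries (shift0 a) w.
Proof.
  intros Ha Hw.
  assert (S1 : summable (fun j => (shift0 a j * Cpow w j)%C)).
  { apply summable_mult; [apply summable_shift0, Ha|]. intros; apply Cmod_Cpow_le_1, Hw. }
  assert (S2 : summable (fun j => (a j * Cpow w (S j))%C)).
  { apply summable_mult; [exact Ha|]. intros; apply Cmod_Cpow_le_1, Hw. }
  apply (Clim_unique (csum (fun j => (a j * Cpow w (S j))%C))); [apply CSeries_lim, S2|].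
  intros eps He. destruct (CSeries_lim _ S1 eps He) as [M HM]. exists M. intros M' HM'.
  specialize (HM (S M') ltac:(lia)). rewrite csum_first in HM.
  eapply Rle_lt_trans; [|exact HM]. right. f_equal. unfold pseries. cbn [shift0]. ring.
Qed.

(** N on the unit circle, with [v j] in the role of the Fourier coefficient of index -(j + 1). *)
Definition Nbd (v : nat -> C) (y : R) : C := CSeries (fun j => (v j * eith (- INR (S j) * y))%C).

Lemma Nbd_pseries v y : summable v -> Nbd v y = pseries (shift0 v) (eith (- y)).
Proof.
  intros Hv. rewrite <- CSeries_shift0 by (assumption || (rewrite Cmod_eith; lra)).
  apply CSeries_ext. intros j. rewrite eith_pow. do 2 f_equal. ring.
Qed.

Lemma Nbd_conj v y : summable v -> Cconj (Nbd v y) = pseries (shift0 (fun j => Cconj (v j))) (eith y).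
Proof.
  intros Hv. rewrite <- CSeries_shift0 by (try apply summable_conj; assumption || (rewrite Cmod_eith; lra)).
  unfold Nbd. rewrite <- CSeries_conj. apply CSeries_ext. intros j.
  rewrite Cmult_conj, eith_conj, eith_pow. do 2 f_equal. ring.
Qed.

Lemma Ccont_Nbd v : summable v -> Ccont (Nbd v).
Proof.
  intros Hv. apply Ccont_ext with (fun y => Cconj (pseries (shift0 (fun j => Cconj (v j))) (eith y))).
  - intros y. rewrite <- Nbd_conj by exact Hv. apply Cconj_conj.
  - apply Ccont_conj, Ccont_disc_alg, disc_alg_pseries, summable_shift0, summable_conj, Hv.
Qed.

(** This is Q = e^{i n kappa}: N - conj N = 2 i Im N is i times Omega. *)
Definition osc (v : nat -> C) (n : nat) (y : R) : C :=
  (Cexp (RtoC (INR n) * (Nbd v y - Cconj (Nbd v y))) * eith (INR n * y))%C.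

Lemma Ccont_osc v n : summable v -> Ccont (osc v n).
Proof.
  intros Hv. apply Ccont_mult; [|apply Ccont_eith]. apply Ccont_Cexp, Ccont_mult; [apply Ccont_const|].
  apply Ccont_minus; [|apply Ccont_conj]; apply Ccont_Nbd, Hv.
Qed.

Lemma Cmod_osc v n y : Cmod (osc v n y) = 1.
Proof.
  unfold osc. rewrite Cmod_mult, Cmod_eith, Cmod_Cexp, Rmult_1_r, <- exp_0. f_equal.
  destruct (Nbd v y). simpl. ring.
Qed.

(** * The two oscillatory bounds *)

Section Estimates.

Context (q0 : nat) (v : nat -> C) (B c0 : R).
Let q := S q0.

Hypothesis HB0 : 0 <= B.
Hypothesis Hreg : forall n, rsum (fun j => (INR (S j) ^ S q * Cmod (v j)) ^ 2) n <= B ^ 2.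
Hypothesis Hc0 : 0 < c0.
(** The right-hand side is kappa'(y): differentiating 2 Im N(e^{iy}) term by term produces -2 Re of
    the displayed series. *)
Hypothesis Hkappa : forall y, - PI <= y <= PI ->
  c0 <= 1 - 2 * fst (CSeries (fun j => (RtoC (INR (S j)) * v j * eith (- INR (S j) * y))%C)).

Let INR_S_ge1 j : 1 <= INR (S j).
Proof. apply (le_INR 1). lia. Qed.

(** One more factor j + 1 makes (j + 1)^2 |v_j|, which [Hreg] controls in l^2 because q + 1 >= 2. *)
Lemma summable_weighted : summable (fun j => (RtoC (INR (S j)) * v j)%C).
Proof.
  apply summable_of_weighted_l2 with (B ^ 2). intros n. eapply Rle_trans; [|apply (Hreg n)].
  apply rsum_le. intros j _. pose proof (INR_S_ge1 j) as H1. pose proof (Cmod_ge_0 (v j)).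
  rewrite Cmod_mult, Cmod_R, Rabs_pos_eq by lra. apply pow_incr. split.
  - repeat apply Rmult_le_pos; lra.
  - rewrite <- Rmult_assoc. apply Rmult_le_compat_r; [assumption|].
    unfold q. simpl. rewrite <- Rmult_assoc. rewrite <- (Rmult_1_r (INR (S j) * INR (S j))) at 1.
    apply Rmult_le_compat_l; [nra|]. apply pow_R1_Rle, H1.
Qed.

Let weight j := INR (S j) * Cmod (v j).

Let weight_ge0 j : 0 <= weight j.
Proof. apply Rmult_le_pos; [apply pos_INR|apply Cmod_ge_0]. Qed.

Let Cmod_weight j : Cmod (RtoC (INR (S j)) * v j) = weight j.
Proof. rewrite Cmod_mult, Cmod_R, Rabs_pos_eq by apply pos_INR. reflexivity. Qed.

Lemma ex_series_weight : ex_series (fun j => INR (S j) * Cmod (v j)).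
Proof.
  apply ex_series_ext with (fun j => Cmod (RtoC (INR (S j)) * v j)); [apply Cmod_weight|].
  apply summable_weighted.
Qed.

Lemma summable_coef : summable v.
Proof.
  apply ex_series_Cmod_le with (fun j => INR (S j) * Cmod (v j)); [|apply ex_series_weight].
  intros j. pose proof (INR_S_ge1 j). pose proof (Cmod_ge_0 (v j)). nra.
Qed.

Lemma ext_re_0 J y : fst (ext q0 v J 0 y) = 0.
Proof.
  unfold ext, ext_term. rewrite csum_re.
  assert (Hcut : cutoff (S q0) 0 = 1).
  { pose proof (cutoff'_0 q0) as H. unfold cutoff' in H. rewrite tail_term_0 in H. lra. }
  induction J as [|J IH]; [reflexivity|]. cbn [rsum]. rewrite IH, Rmult_0_r, Ropp_0, exp_0, Hcut.
  replace (- INR (S J) * y) with (- (INR (S J) * y)) by ring. rewrite <- eith_conj.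
  set (e := eith (INR (S J) * y)). destruct (v J), e. simpl. ring.
Qed.

(** At t = 0 without truncation the real part is 1 - kappa' <= 1 - c0. Truncation costs at most c0 /
    4 (twice c0 / 8), and moving to t > 0 another c0 / 4. *)
Lemma ext_t_re_le : exists t0 J0, 0 < t0 /\ forall J t y, (J0 <= J)%nat -> 0 <= t <= t0 -> - PI <= y <= PI ->
  fst (ext_t q0 v J t y) <= 1 - c0 / 2.
Proof.
  (* Combined deviation of the two multipliers [cutoff'] and exp from their value 1 at s = 0. *)
  set (K := 2 ^ (q0 + 5) + 1).
  assert (HK : 0 < K) by (pose proof (pow_lt 2 (q0 + 5) ltac:(lra)); unfold K; lra).
  destruct (min_weight_small weight weight_ge0 ex_series_weight (c0 / (4 * K))) as [t0 [Ht0 Hmin]].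
  { apply Rdiv_lt_0_compat; lra. }
  destruct (is_series_rsum weight ex_series_weight (c0 / 8)) as [J0 HJ0]; [lra|].
  exists t0, J0. split; [exact Ht0|]. intros J t y HJ Ht Hy.
  specialize (Hmin t J Ht). specialize (HJ0 J HJ). specialize (Hkappa y Hy).
  set (a := fun j => (RtoC (INR (S j)) * v j * eith (- INR (S j) * y))%C) in *.
  assert (Ha : forall j, Cmod (a j) = weight j).
  { intros j. unfold a. rewrite Cmod_mult, Cmod_eith, Rmult_1_r. apply Cmod_weight. }
  assert (H1 : fst (csum a J) <= fst (CSeries a) + c0 / 8).
  { pose proof (CSeries_tail a weight J (fun j => Req_le _ _ (Ha j)) ex_series_weight) as H.
    pose proof (Rabs_fst_le (CSeries a - csum a J)%C) as H'.
    apply Rabs_def2 in HJ0. apply Rabs_le_between in H'.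
    change (fst (CSeries a - csum a J)%C) with (fst (CSeries a) - fst (csum a J)) in H'. lra. }
  assert (H2 : fst (ext_t q0 v J t y) <= 2 * fst (csum a J) + K * rsum (fun j => weight j * Rmin 1 (INR (S
      j) * t)) J).
  { unfold ext_t, ext_t_term. rewrite !csum_re, <- !rsum_mult_l, <- rsum_plus. apply rsum_le. intros j _.
    replace (INR (S j) * y) with (- (- INR (S j) * y)) by ring. rewrite <- eith_conj.
    set (x := INR (S j)) in *. set (m := cutoff' (S q0) (x * t)). set (e := exp (- (x * t))).
    set (z := (v j * eith (- x * y))%C).
    assert (E1 : a j = (RtoC x * z)%C) by (unfold a, z; fold x; ring).
    assert (E2 : (v j * (RtoC (x * m) * eith (- x * y)) + - Cconj (v j) * (RtoC (x * - e) * Cconj (eith (-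
        x * y))))%C =
        (RtoC x * (RtoC m * z + RtoC e * Cconj z))%C).
    { unfold z. rewrite Cmult_conj, !RtoC_mult, RtoC_opp. ring. }
    rewrite E1, E2.
    assert (E3 : fst (RtoC x * (RtoC m * z + RtoC e * Cconj z))%C =
                 2 * fst (RtoC x * z)%C + ((m - 1) + (e - 1)) * (x * fst z)).
    { destruct z; simpl. ring. }
    rewrite E3. apply Rplus_le_compat_l.
    assert (Hx : 0 <= x) by apply pos_INR. assert (Hxt : 0 <= x * t) by (apply Rmult_le_pos; lra).
    pose proof (cutoff'_minus_1_le q0 (x * t) Hxt) as Hm. fold m in Hm.
    pose proof (exp_neg_minus_1_le (x * t) Hxt) as He. fold e in He.
    assert (Hz : Rabs (x * fst z) <= weight j).
    { rewrite Rabs_mult, Rabs_pos_eq by exact Hx. unfold weight. fold x. apply Rmult_le_compat_l; [exact Hx|].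
      eapply Rle_trans; [apply Rabs_fst_le|]. unfold z. rewrite Cmod_mult, Cmod_eith. lra. }
    assert (Hme : Rabs ((m - 1) + (e - 1)) <= K * Rmin 1 (x * t)).
    { eapply Rle_trans; [apply Rabs_triang|]. unfold K. lra. }
    eapply Rle_trans; [apply Rle_abs|]. rewrite Rabs_mult.
    replace (K * (weight j * Rmin 1 (x * t))) with ((K * Rmin 1 (x * t)) * weight j) by ring.
    apply Rmult_le_compat; try apply Rabs_pos; assumption. }
  assert (H3 : K * rsum (fun j => weight j * Rmin 1 (INR (S j) * t)) J <= c0 / 4).
  { apply Rle_trans with (K * (c0 / (4 * K))); [apply Rmult_le_compat_l; lra|]. right. field. lra. }
  lra.
Qed.

(** On the circle the phase is purely imaginary, so the derivative bound integrates from 0. In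
    [wave] the summand t is cancelled by the n-th power of e^{iy - t}, which leaves the decay e^{-c0
    n t / 2}. *)
Lemma ext_re_le : exists t0 J0, 0 < t0 /\ forall J t y, (J0 <= J)%nat -> 0 <= t <= t0 -> - PI <= y <= PI ->
  fst (ext q0 v J t y) <= t - c0 / 2 * t.
Proof.
  destruct ext_t_re_le as [t0 [J0 [Ht0 H]]]. exists t0, J0. split; [exact Ht0|].
  intros J t y HJ Ht Hy.
  destruct (MVT_is_derive (fun t => fst (ext q0 v J t y)) (fun t => fst (ext_t q0 v J t y)) 0 t) as [c [Hc E]].
  { intros x. apply (proj1 (ext_CD_t q0 v J x y)). }
  rewrite Rmin_left, Rmax_right in Hc by lra.
  rewrite ext_re_0, !Rminus_0_r in E. rewrite E.
  specialize (H J c y HJ ltac:(lra) Hy). nra.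
Qed.

(** The bound [tail_term] <= 2^q ((j+1) t)^q makes the j-th coefficient at most 2^{q+1} t^q
    (j+1)^{q+1} |v_j|, and Parseval reduces the norm to [Hreg]. *)
Lemma nrm_dbar_le J t : 0 <= t -> nrm (dbar q0 v J t) <= 2 ^ S q * B * t ^ q.
Proof.
  intros Ht.
  (* Conjugation moves the negative frequencies to the window starting at 1 without changing the
     modulus. *)
  set (c := fun j => Cconj (v j * RtoC (- (INR (S j) * (2 * tail_term q (INR (S j) * t)))))).
  rewrite (nrm_ext (dbar q0 v J t) (trig 1 c J)).
  2:{ intros y _. rewrite <- Cmod_conj. unfold dbar, dbar_term, trig. rewrite csum_conj. f_equal.
      apply csum_ext. intros j _. rewrite Cmult_conj, eith_conj. unfold c, q. do 2 f_equal.
      replace (1 + Z.of_nat j)%Z with (Z.of_nat (S j)) by lia. rewrite <- INR_IZR_INZ. ring. }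
  assert (H2 : 0 <= 2 ^ S q) by (apply pow_le; lra).
  assert (Htq : 0 <= t ^ q) by (apply pow_le, Ht).
  apply Rsqr_incr_0_var; [|apply Rmult_le_pos; [apply Rmult_le_pos|]; assumption].
  rewrite !Rsqr_pow2, parseval_trig.
  replace ((2 ^ S q * B * t ^ q) ^ 2) with ((2 ^ S q * t ^ q) ^ 2 * B ^ 2) by (rewrite <- Rpow_mult_distr;
      f_equal; ring).
  eapply Rle_trans; [|apply Rmult_le_compat_l; [apply pow2_ge_0|apply (Hreg J)]].
  rewrite <- rsum_mult_l. apply rsum_le. intros j _. rewrite <- Rpow_mult_distr.
  apply pow_incr. split; [apply Cmod_ge_0|].
  unfold c. rewrite Cmod_conj, Cmod_mult, Cmod_R, Rabs_Ropp.
  set (x := INR (S j)). assert (Hx : 0 <= x) by apply pos_INR.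
  assert (Hxt : 0 <= x * t) by (apply Rmult_le_pos; assumption).
  pose proof (tail_term_le_pow q (x * t) Hxt) as H. pose proof (tail_term_ge0 q (x * t) Hxt).
  rewrite Rpow_mult_distr in H. rewrite Rabs_pos_eq by (apply Rmult_le_pos; lra).
  apply Rle_trans with (Cmod (v j) * (x * (2 * (2 ^ q * (x ^ q * t ^ q))))).
  - apply Rmult_le_compat_l; [apply Cmod_ge_0|]. apply Rmult_le_compat_l; lra.
  - right. simpl. ring.
Qed.

(** In the sup norm only the convergence of the sum of (j + 1) |v_j| is exploited, so the bound
    carries no power of t; it is uniform in [J] and [y]. *)
Lemma Cmod_dbar_small eps : 0 < eps -> exists t0, 0 < t0 /\ forall J t y, 0 <= t <= t0 ->
  Cmod (dbar q0 v J t y) <= eps.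
Proof.
  intros He. assert (Hp : 0 < 2 * 2 ^ q) by (pose proof (pow_lt 2 q ltac:(lra)); lra).
  destruct (min_weight_small weight weight_ge0 ex_series_weight (eps / (2 * 2 ^ q))) as [t0 [Ht0 Hmin]].
  { apply Rdiv_lt_0_compat; lra. }
  exists t0. split; [exact Ht0|]. intros J t y Ht. specialize (Hmin t J Ht).
  apply Rle_trans with (2 * 2 ^ q * rsum (fun j => weight j * Rmin 1 (INR (S j) * t)) J).
  - unfold dbar, dbar_term. eapply Rle_trans; [apply Cmod_csum|]. rewrite <- rsum_mult_l. apply rsum_le.
      intros j _.
    rewrite !Cmod_mult, Cmod_eith, Cmod_R, Rabs_Ropp, Rmult_1_r. unfold weight.
    set (x := INR (S j)). assert (Hx : 0 <= x) by apply pos_INR.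
    assert (Hxt : 0 <= x * t) by (apply Rmult_le_pos; lra).
    pose proof (tail_term_le_min q0 (x * t) Hxt) as H. fold q in H |- *. pose proof (tail_term_ge0 q (x *
        t) Hxt).
    rewrite Rabs_pos_eq by (apply Rmult_le_pos; lra).
    replace (2 * 2 ^ q * (x * Cmod (v j) * Rmin 1 (x * t))) with (Cmod (v j) * (x * (2 * (2 ^ q * Rmin 1 (x
        * t))))) by ring.
    apply Rmult_le_compat_l; [apply Cmod_ge_0|]. apply Rmult_le_compat_l; lra.
  - apply Rle_trans with (2 * 2 ^ q * (eps / (2 * 2 ^ q))); [apply Rmult_le_compat_l; lra|]. right. field.
    apply pow_nonzero. lra.
Qed.

Lemma wave_add n z J t y i :
  wave q0 v n (z + Z.of_nat i) J t y = (wave q0 v n z J t y * Cpow (RtoC (exp (- t)) * eith y) i)%C.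
Proof.
  unfold wave. rewrite Cpow_mult_l, <- RtoC_pow, eith_pow, <- exp_INR_mult.
  rewrite plus_IZR, Rmult_plus_distr_r, <- INR_IZR_INZ.
  replace (- (IZR z * t + INR i * t)) with (- (IZR z * t) + INR i * - t) by ring.
  rewrite Rmult_plus_distr_r, exp_plus, eith_plus, RtoC_mult. ring.
Qed.

Lemma Cmod_wave n z J t y : Cmod (wave q0 v n z J t y) = exp (INR n * fst (ext q0 v J t y) - IZR z * t).
Proof.
  unfold wave. rewrite !Cmod_mult, Cmod_eith, Cmod_R, Cmod_Cexp, Rmult_1_r.
  rewrite Rabs_pos_eq by (apply Rlt_le, exp_pos). rewrite <- exp_plus. f_equal.
  simpl. ring.
Qed.

(** Multiplying a wave by a power of e^{iy - t} shifts its integer exponent, so for a polynomial P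
    the mean is a finite combination of means of waves. Its t-derivative is the d-bar pairing, and
    the factor n comes from the exponent. *)
Lemma wave_mean_le n z J P t0 A a : is_poly P -> 0 <= t0 -> 0 < a -> 0 <= A ->
  (forall t, 0 <= t <= t0 ->
     Cmod (Cmean (fun y => (dbar q0 v J t y * (wave q0 v n z J t y * scaled P t y))%C)) <= A * exp (- a * t)) ->
  Cmod (Cmean (fun y => (wave q0 v n z J 0 y * P (eith y))%C)) <=
  Cmod (Cmean (fun y => (wave q0 v n z J t0 y * scaled P t0 y)%C)) + INR n * A / a.
Proof.
  intros [M [c Hc]] Ht0 Ha HA Hb.
  assert (Hw : forall i t, Ccont (wave q0 v n (z + Z.of_nat i) J t)) by (intros; apply Ccont_wave).
  (* Reassembles the finite combination of shifted waves into one mean, for g = 1 as well as for g =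
     n times [dbar]. *)
  assert (Hsum : forall t (g : R -> C), Ccont g ->
    csum (fun i => (c i * Cmean (fun y => (g y * wave q0 v n (z + Z.of_nat i) J t y)%C))%C) M =
    Cmean (fun y => (g y * (wave q0 v n z J t y * scaled P t y))%C)).
  { intros t g Hg.
    rewrite (Cmean_ext _ (fun y => csum (fun i => (c i * (g y * wave q0 v n (z + Z.of_nat i) J t y))%C) M)).
    - rewrite (Cmean_csum (fun i y => (c i * (g y * wave q0 v n (z + Z.of_nat i) J t y))%C)).
      + apply csum_ext. intros i _. symmetry. apply Cmean_scal, Ccont_mult; auto.
      + intros i. apply Ccont_mult; [apply Ccont_const|apply Ccont_mult; auto].
    - intros y _. unfold scaled. rewrite Hc. unfold poly. rewrite <- !csum_mult_l.
      apply csum_ext. intros i _. rewrite wave_add. ring. }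
  set (I := fun t => csum (fun i => (c i * Cmean (wave q0 v n (z + Z.of_nat i) J t))%C) M).
  assert (HI : forall t, I t = Cmean (fun y => (wave q0 v n z J t y * scaled P t y)%C)).
  { intros t. unfold I.
    rewrite (Cmean_ext _ (fun y => (RtoC 1 * (wave q0 v n z J t y * scaled P t y))%C)) by (intros; ring).
    rewrite <- (Hsum t (fun _ => RtoC 1)) by apply Ccont_const.
    apply csum_ext. intros i _. f_equal. apply Cmean_ext. intros; ring. }
  assert (HnA : 0 <= INR n * A) by (apply Rmult_le_pos; [apply pos_INR|exact HA]).
  pose proof (Cmod_le_of_derive_decay I
    (fun t => csum (fun i => (c i * Cmean (fun y => (RtoC (INR n) * dbar q0 v J t y * wave q0 v n (z +
        Z.of_nat i) J t y)%C))%C) M)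
    t0 (INR n * A) a Ht0 Ha HnA) as H.
  rewrite !HI in H.
  rewrite (Cmean_ext (fun y => (wave q0 v n z J 0 y * P (eith y))%C) (fun y => (wave q0 v n z J 0 y *
      scaled P 0 y)%C)).
  2:{ intros y _. unfold scaled. rewrite Ropp_0, exp_0, Cmult_1_l. reflexivity. }
  apply H; clear H.
  - intros t. apply (CD_csum (fun i t => (c i * Cmean (wave q0 v n (z + Z.of_nat i) J t))%C)).
    intros i. apply CD_scal, Cmean_wave_CD.
  - intros t Ht.
    rewrite (Hsum t (fun y => (RtoC (INR n) * dbar q0 v J t y)%C))
      by (apply Ccont_mult; [apply Ccont_const|apply Ccont_dbar]).
    assert (HPc : Ccont (scaled P t)) by (apply Ccont_scaled; exists M, c; exact Hc).
    rewrite (Cmean_ext _ (fun y => (RtoC (INR n) * (dbar q0 v J t y * (wave q0 v n z J t y * scaled P t y)))%C))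
      by (intros; ring).
    rewrite Cmean_scal by (apply Ccont_mult; [apply Ccont_dbar|apply Ccont_mult; [apply Ccont_wave|exact HPc]]).
    rewrite Cmod_mult, Cmod_R, Rabs_pos_eq by apply pos_INR. rewrite Rmult_assoc.
    apply Rmult_le_compat_l; [apply pos_INR|apply Hb, Ht].
Qed.

Lemma nrm_wave_mult_le n z J t f r : Ccont f ->
  (forall y, - PI <= y <= PI -> Cmod (wave q0 v n z J t y) <= r) -> 0 <= r ->
  nrm (fun y => (wave q0 v n z J t y * f y)%C) <= r * nrm f.
Proof.
  intros Hf Hr Hr0. rewrite <- (Rabs_pos_eq r Hr0), <- Cmod_R, <- nrm_scal by exact Hf.
  apply nrm_le.
  - apply Ccont_mult; [apply Ccont_wave|exact Hf].
  - apply Ccont_mult; [apply Ccont_const|exact Hf].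
  - intros y Hy. rewrite !Cmod_mult, Cmod_R, (Rabs_pos_eq r) by exact Hr0.
    apply Rmult_le_compat_r; [apply Cmod_ge_0|apply Hr, Hy].
Qed.

Lemma Cmod_Cmean_le_nrm f : Ccont f -> Cmod (Cmean f) <= nrm f.
Proof.
  intros Hf. rewrite <- (Rmult_1_l (nrm f)).
  rewrite (Cmean_ext f (fun t => (RtoC 1 * f t)%C)) by (intros; ring).
  eapply Rle_trans; [apply (Cmod_Cmean_mult_le (fun _ => RtoC 1) f); [apply Ccont_const|exact Hf]|].
  apply Rmult_le_compat_r; [apply nrm_ge0|]. apply nrm_bound; [apply Ccont_const|lra|].
  intros. rewrite Cmod_1. lra.
Qed.

Lemma pow_exp_decay_le x t : 0 < x -> 0 <= t -> t ^ q * exp (- (x * t)) <= INR (fact q) * (/ x) ^ q.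
Proof.
  intros Hx Ht. pose proof (pow_le_fact_exp q (x * t) ltac:(apply Rmult_le_pos; lra)) as H.
  pose proof (exp_pos (- (x * t))).
  assert (E : exp (x * t) * exp (- (x * t)) = 1) by (rewrite <- exp_plus, Rplus_opp_r; apply exp_0).
  assert (Hxq : 0 < (/ x) ^ q) by (apply pow_lt, Rinv_0_lt_compat, Hx).
  assert (Et : t ^ q = (/ x) ^ q * (x * t) ^ q).
  { rewrite <- Rpow_mult_distr. f_equal. field. lra. }
  rewrite Et.
  apply Rle_trans with ((/ x) ^ q * (INR (fact q) * exp (x * t)) * exp (- (x * t))).
  - apply Rmult_le_compat_r; [lra|]. apply Rmult_le_compat_l; lra.
  - right. transitivity ((/ x) ^ q * INR (fact q) * (exp (x * t) * exp (- (x * t)))); [ring|rewrite E; ring].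
Qed.

(** For s <= c0 n / 4 the factor e^{st} leaves the decay e^{-c0 n t / 4}. Half of it turns t^q into
    n^{-q}; the other half integrates to 8 / (c0 n), cancelling the factor n from
    differentiation. *)
Lemma wave_linear_bound : exists K J0, 0 <= K /\
  forall n s J P, (1 <= n)%nat -> INR s <= c0 / 4 * INR n -> (J0 <= J)%nat -> is_poly P ->
  Cmod (Cmean (fun y => (wave q0 v n (Z.of_nat n - Z.of_nat s) J 0 y * P (eith y))%C)) <=
  K * (/ INR n) ^ q * nrm (fun y => P (eith y)).
Proof.
  destruct ext_re_le as [t0 [J0 [Ht0 Hext]]].
  (* [K1] accounts for the inner circle t = t0, where the exponentially small bound is weakened to
     n^{-q}; [K2] accounts for the d-bar integral. *)
  set (K1 := INR (fact q) * (/ (c0 / 4 * t0)) ^ q).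
  set (K2 := 8 / c0 * (2 ^ S q * B * (INR (fact q) * (/ (c0 / 8)) ^ q))).
  assert (Hf : 0 < INR (fact q)) by apply INR_fact_pos.
  assert (Hct : 0 < c0 / 4 * t0) by (apply Rmult_lt_0_compat; lra).
  assert (HK1 : 0 <= K1).
  { apply Rmult_le_pos; [lra|]. apply pow_le, Rlt_le, Rinv_0_lt_compat, Hct. }
  assert (HK20 : 0 <= 2 ^ S q * B * (INR (fact q) * (/ (c0 / 8)) ^ q)).
  { apply Rmult_le_pos; [apply Rmult_le_pos; [apply pow_le; lra|exact HB0]|].
    apply Rmult_le_pos; [lra|]. apply pow_le, Rlt_le, Rinv_0_lt_compat. lra. }
  assert (HK2 : 0 <= K2).
  { apply Rmult_le_pos; [|exact HK20]. apply Rlt_le, Rdiv_lt_0_compat; lra. }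
  exists (K1 + K2), J0. split; [lra|].
  intros n s J P Hn Hs HJ HP.
  assert (HN : 1 <= INR n) by (apply (le_INR 1), Hn).
  set (N := INR n) in *. set (z := (Z.of_nat n - Z.of_nat s)%Z).
  set (p := nrm (fun y => P (eith y))). assert (Hp : 0 <= p) by apply nrm_ge0.
  assert (Hw : forall t y, 0 <= t <= t0 -> - PI <= y <= PI ->
     Cmod (wave q0 v n z J t y) <= exp (- (c0 / 4 * N * t))).
  { intros t y Ht Hy. rewrite Cmod_wave. apply exp_mono. fold N.
    unfold z. rewrite minus_IZR, <- !INR_IZR_INZ. fold N.
    pose proof (Hext J t y HJ Ht Hy) as H.
    assert (N * fst (ext q0 v J t y) <= N * (t - c0 / 2 * t)) by (apply Rmult_le_compat_l; lra).
    assert (INR s * t <= c0 / 4 * N * t) by (apply Rmult_le_compat_r; lra). lra. }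
  assert (HwP : forall t, 0 <= t <= t0 ->
     nrm (fun y => (wave q0 v n z J t y * scaled P t y)%C) <= exp (- (c0 / 4 * N * t)) * p).
  { intros t Ht. eapply Rle_trans; [apply (nrm_wave_mult_le n z J t (scaled P t) (exp (- (c0 / 4 * N * t))))|].
    - apply Ccont_scaled, HP.
    - intros y Hy. apply Hw; assumption.
    - apply Rlt_le, exp_pos.
    - apply Rmult_le_compat_l; [apply Rlt_le, exp_pos|]. apply nrm_scaled_le; [exact HP|lra]. }
  assert (HNq : forall x, 0 < x -> (/ (x * N)) ^ q = (/ x) ^ q * (/ N) ^ q).
  { intros x Hx. rewrite <- Rpow_mult_distr. f_equal. field. lra. }
  set (A := 2 ^ S q * B * (INR (fact q) * (/ (c0 / 8)) ^ q) * (/ N) ^ q * p).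
  assert (HNp : 0 <= (/ N) ^ q) by (apply pow_le, Rlt_le, Rinv_0_lt_compat; lra).
  assert (HA : 0 <= A) by (apply Rmult_le_pos; [apply Rmult_le_pos; assumption|exact Hp]).
  eapply Rle_trans; [apply (wave_mean_le n z J P t0 A (c0 / 8 * N)); try assumption; try lra|].
  - apply Rmult_lt_0_compat; lra.
  - intros t Ht.
    eapply Rle_trans; [apply Cmod_Cmean_mult_le; [apply Ccont_dbar|apply Ccont_mult; [apply
        Ccont_wave|apply Ccont_scaled, HP]]|].
    eapply Rle_trans; [apply Rmult_le_compat; [apply nrm_ge0|apply nrm_ge0|apply nrm_dbar_le; lra|apply
        HwP, Ht]|].
    (* One half of the decay is spent on t^q, the other is kept for the integration in t. *)
    replace (exp (- (c0 / 4 * N * t))) with (exp (- (c0 / 8 * N * t)) * exp (- (c0 / 8 * N) * t)).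
    2:{ rewrite <- exp_plus. f_equal. field. }
    pose proof (pow_exp_decay_le (c0 / 8 * N) t ltac:(apply Rmult_lt_0_compat; lra) ltac:(lra)) as H.
    rewrite HNq in H by lra. unfold A.
    replace (2 ^ S q * B * t ^ q * (exp (- (c0 / 8 * N * t)) * exp (- (c0 / 8 * N) * t) * p))
      with ((2 ^ S q * B) * (t ^ q * exp (- (c0 / 8 * N * t))) * (p * exp (- (c0 / 8 * N) * t))) by ring.
    replace (2 ^ S q * B * (INR (fact q) * (/ (c0 / 8)) ^ q) * (/ N) ^ q * p * exp (- (c0 / 8 * N) * t))
      with ((2 ^ S q * B) * (INR (fact q) * ((/ (c0 / 8)) ^ q * (/ N) ^ q)) * (p * exp (- (c0 / 8 * N) *
          t))) by ring.
    apply Rmult_le_compat_r; [apply Rmult_le_pos; [exact Hp|apply Rlt_le, exp_pos]|].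
    apply Rmult_le_compat_l; [apply Rmult_le_pos; [apply pow_le; lra|exact HB0]|exact H].
  - fold N. rewrite !Rmult_plus_distr_r. apply Rplus_le_compat.
    + eapply Rle_trans; [apply Cmod_Cmean_le_nrm, Ccont_mult; [apply Ccont_wave|apply Ccont_scaled, HP]|].
      eapply Rle_trans; [apply HwP; lra|]. apply Rmult_le_compat_r; [exact Hp|].
      pose proof (pow_exp_decay_le (c0 / 4 * t0 * N) 1 ltac:(apply Rmult_lt_0_compat; lra) ltac:(lra)) as H.
      rewrite pow1, Rmult_1_l, HNq in H by exact Hct. unfold K1. rewrite <- Rmult_assoc in H.
      eapply Rle_trans; [|exact H]. right. f_equal. ring.
    + right. unfold A, K2. field. lra.
Qed.

(** Both polynomials are measured in L^2, so [dbar] and [wave] are bounded pointwise. The inner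
    circle and the d-bar integral contribute a quarter each. *)
Lemma wave_bilinear_bound : exists n1 J0,
  forall n J P U, (n1 <= n)%nat -> (J0 <= J)%nat -> is_poly P -> is_poly U ->
  Cmod (Cmean (fun y => (wave q0 v n (Z.of_nat n) J 0 y * (P (eith y) * U (eith y)))%C)) <=
  / 2 * (nrm (fun y => P (eith y)) * nrm (fun y => U (eith y))).
Proof.
  destruct ext_re_le as [t1 [J0 [Ht1 Hext]]].
  (* Chosen so that n (c0 / 8) / (c0 n / 2) = 1/4. *)
  destruct (Cmod_dbar_small (c0 / 8)) as [t2 [Ht2 Hdb]]; [lra|].
  set (t0 := Rmin t1 t2). assert (Ht0 : 0 < t0) by (apply Rmin_pos; assumption).
  assert (Ht01 : t0 <= t1) by apply Rmin_l. assert (Ht02 : t0 <= t2) by apply Rmin_r.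
  assert (Hct : 0 < c0 / 2 * t0) by (apply Rmult_lt_0_compat; lra).
  (* Makes c0 n t0 / 2 >= 4, so e^{-c0 n t0 / 2} <= 1/4 by 1 + x <= e^x. *)
  destruct (INR_unbounded (4 / (c0 / 2 * t0))) as [n1 Hn1].
  exists (S n1), J0. intros n J P U Hn HJ HP HR.
  assert (HN1 : INR n1 <= INR n) by (apply le_INR; lia).
  assert (HN : 1 <= INR n) by (apply (le_INR 1); lia).
  set (N := INR n) in *.
  set (p := nrm (fun y => P (eith y))). assert (Hp : 0 <= p) by apply nrm_ge0.
  set (r := nrm (fun y => U (eith y))). assert (Hr : 0 <= r) by apply nrm_ge0.
  assert (Hpr : 0 <= p * r) by (apply Rmult_le_pos; assumption).
  assert (Hw : forall t y, 0 <= t <= t0 -> - PI <= y <= PI ->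
     Cmod (wave q0 v n (Z.of_nat n) J t y) <= exp (- (c0 / 2 * N * t))).
  { intros t y Ht Hy. rewrite Cmod_wave, <- INR_IZR_INZ. apply exp_mono. fold N.
    pose proof (Hext J t y HJ ltac:(lra) Hy) as H.
    assert (N * fst (ext q0 v J t y) <= N * (t - c0 / 2 * t)) by (apply Rmult_le_compat_l; lra). lra. }
  assert (Cw : forall t, Ccont (wave q0 v n (Z.of_nat n) J t)) by (intros; apply Ccont_wave).
  assert (HPR : forall t, 0 <= t <= t0 -> Rmean (fun y => Cmod (scaled P t y) * Cmod (scaled U t y)) <= p * r).
  { intros t Ht. eapply Rle_trans; [apply Rmean_cauchy_schwarz; apply Ccont_scaled; assumption|].
    apply Rmult_le_compat; try apply nrm_ge0; apply nrm_scaled_le; (assumption || lra). }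
  assert (Cscal : forall t, Ccont (fun y => scaled (fun w => (P w * U w)%C) t y)).
  { intros t. apply Ccont_scaled, is_poly_mult; assumption. }
  assert (Hmean : forall t k (g : R -> C), 0 <= t <= t0 -> 0 <= k -> Ccont g ->
    (forall y, - PI <= y <= PI -> Cmod (g y) <= k) ->
    Cmod (Cmean (fun y => (g y * scaled (fun w => (P w * U w)%C) t y)%C)) <= k * (p * r)).
  { intros t k g Ht Hk Hg Hgk. eapply Rle_trans; [apply Cmod_Cmean_le, Ccont_mult; [exact Hg|apply Cscal]|].
    assert (Cm : forall y, continuous (fun y => Cmod (scaled P t y) * Cmod (scaled U t y)) y).
    { intros y. apply continuous_Rmult; apply continuous_Cmod, Ccont_scaled; assumption. }
    apply Rle_trans with (Rmean (fun y => k * (Cmod (scaled P t y) * Cmod (scaled U t y)))).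
    - apply Rmean_le.
      + apply continuous_Cmod, Ccont_mult; [exact Hg|apply Cscal].
      + intros y. apply continuous_Rmult; [apply continuous_const|apply Cm].
      + intros y Hy. unfold scaled. rewrite !Cmod_mult. apply Rmult_le_compat_r; [|apply Hgk, Hy].
        apply Rmult_le_pos; apply Cmod_ge_0.
    - rewrite Rmean_scal by exact Cm. apply Rmult_le_compat_l; [exact Hk|apply HPR, Ht]. }
  eapply Rle_trans; [apply (wave_mean_le n (Z.of_nat n) J (fun w => (P w * U w)%C) t0 (c0 / 8 * (p * r))
      (c0 / 2 * N))|].
  - apply is_poly_mult; assumption.
  - lra.
  - apply Rmult_lt_0_compat; lra.
  - apply Rmult_le_pos; lra.
  - intros t Ht.
    rewrite (Cmean_ext _ (fun y => (dbar q0 v J t y * wave q0 v n (Z.of_nat n) J t y * scaled (fun w => (P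
        w * U w)%C) t y)%C)) by (intros; ring).
    eapply Rle_trans; [apply (Hmean t (c0 / 8 * exp (- (c0 / 2 * N) * t)))|].
    + exact Ht.
    + apply Rmult_le_pos; [lra|apply Rlt_le, exp_pos].
    + apply Ccont_mult; [apply Ccont_dbar|apply Cw].
    + intros y Hy. rewrite Cmod_mult. apply Rmult_le_compat; try apply Cmod_ge_0; [apply Hdb; lra|].
      eapply Rle_trans; [apply Hw; assumption|]. right. f_equal. ring.
    + right. ring.
  - fold N. apply Rle_trans with (/ 4 * (p * r) + / 4 * (p * r)); [|lra]. apply Rplus_le_compat.
    + apply Hmean; [lra|lra|apply Cw|]. intros y Hy. eapply Rle_trans; [apply Hw; [lra|exact Hy]|].
      rewrite exp_Ropp. apply Rinv_le_contravar; [lra|].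
      apply Rle_trans with (1 + c0 / 2 * N * t0); [|apply exp_ineq1_le].
      assert (4 <= c0 / 2 * t0 * N); [|lra].
      apply Rle_trans with (c0 / 2 * t0 * (4 / (c0 / 2 * t0))); [right; field; lra|].
      apply Rmult_le_compat_l; lra.
    + right. field. lra.
Qed.

(** At t = 0 the extension is the truncated N - conj N, which converges uniformly on the circle.
    [J0] depends on [n], which is harmless since the bounds for waves are uniform in [J]. *)
Lemma wave_to_osc n eps : 0 < eps -> exists J0, forall J s y, (J0 <= J)%nat ->
  Cmod (wave q0 v n (Z.of_nat n - Z.of_nat s) J 0 y - osc v n y * eith (- INR s * y)) <= eps.
Proof.
  intros He. pose proof (pos_INR n) as HN.
  (* 11 is the Lipschitz constant of [Cexp] for increments of modulus at most 1, at a purely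
     imaginary point. *)
  set (e1 := Rmin 1 (eps / 11)). assert (He1 : 0 < e1) by (apply Rmin_pos; lra).
  destruct (is_series_rsum _ summable_coef (e1 / (2 * (INR n + 1)))) as [J0 HJ0].
  { apply Rdiv_lt_0_compat; lra. }
  exists J0. intros J s y HJ. specialize (HJ0 J HJ). apply Rabs_def2 in HJ0.
  set (NJ := csum (fun j => (v j * eith (- INR (S j) * y))%C) J).
  assert (Hext : ext q0 v J 0 y = (NJ - Cconj NJ)%C).
  { unfold ext, ext_term, NJ. rewrite csum_conj. unfold Cminus.
    replace (- csum (fun i => Cconj (v i * eith (- INR (S i) * y))) J)%C with
      (- RtoC 1 * csum (fun i => Cconj (v i * eith (- INR (S i) * y))) J)%C by ring.
    rewrite <- csum_mult_l, <- csum_plus. apply csum_ext. intros j _.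
    assert (Hcut : cutoff (S q0) 0 = 1).
    { pose proof (cutoff'_0 q0) as H. unfold cutoff' in H. rewrite tail_term_0 in H. lra. }
    rewrite Rmult_0_r, Ropp_0, exp_0, Hcut, Cmult_conj, eith_conj.
    replace (- (- INR (S j) * y)) with (INR (S j) * y) by ring. ring. }
  assert (HNJ : Cmod (Nbd v y - NJ) <= e1 / (2 * (INR n + 1))).
  { eapply Rle_trans; [apply (CSeries_tail _ (fun j => Cmod (v j)))|lra].
    - intros j. rewrite Cmod_mult, Cmod_eith. lra.
    - apply summable_coef. }
  set (u := (RtoC (INR n) * (Nbd v y - Cconj (Nbd v y)))%C).
  set (d := (RtoC (INR n) * (NJ - Nbd v y - Cconj (NJ - Nbd v y)))%C).
  assert (Hd : Cmod d <= e1).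
  { unfold d. rewrite Cmod_mult, Cmod_R, Rabs_pos_eq by exact HN.
    pose proof (Cmod_minus_le (NJ - Nbd v y)%C (Cconj (NJ - Nbd v y))) as H.
    rewrite Cmod_conj, (Cmod_minus_sym NJ (Nbd v y)) in H.
    apply Rle_trans with ((INR n + 1) * (2 * (e1 / (2 * (INR n + 1))))).
    - apply Rmult_le_compat; try lra. apply Cmod_ge_0.
    - right. field. lra. }
  assert (E1 : wave q0 v n (Z.of_nat n - Z.of_nat s) J 0 y = (Cexp (u + d) * eith (INR n * y + - INR s * y))%C).
  { unfold wave. rewrite Hext, Rmult_0_r, Ropp_0, exp_0, Cmult_1_l. f_equal.
    - f_equal. unfold u, d. rewrite Cminus_conj. ring.
    - f_equal. rewrite minus_IZR, <- !INR_IZR_INZ. ring. }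
  assert (E2 : (osc v n y * eith (- INR s * y))%C = (Cexp u * eith (INR n * y + - INR s * y))%C).
  { unfold osc. fold u. rewrite eith_plus. ring. }
  rewrite E1, E2.
  replace (Cexp (u + d) * eith (INR n * y + - INR s * y) - Cexp u * eith (INR n * y + - INR s * y))%C
    with ((Cexp (u + d) - Cexp u) * eith (INR n * y + - INR s * y))%C by ring.
  rewrite Cmod_mult, Cmod_eith, Rmult_1_r.
  assert (e1 <= 1) by apply Rmin_l. assert (e1 <= eps / 11) by apply Rmin_r.
  eapply Rle_trans; [apply Cexp_lipschitz_local; lra|].
  replace (fst u) with 0.
  - rewrite exp_0. lra.
  - unfold u. destruct (Nbd v y). simpl. ring.
Qed.

(** Removes the truncation: since [k] is the same for all large [J], the bound survives J ->
    infinity. *)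
Lemma osc_mean_limit n s f k J0 : Ccont f ->
  (forall J, (J0 <= J)%nat -> Cmod (Cmean (fun y => (wave q0 v n (Z.of_nat n - Z.of_nat s) J 0 y * f y)%C))
      <= k) ->
  Cmod (Cmean (fun y => (osc v n y * eith (- INR s * y) * f y)%C)) <= k.
Proof.
  intros Hf H. apply le_of_le_eps with (nrm f). intros eps [He _].
  destruct (wave_to_osc n eps He) as [J1 H1]. set (J := (J0 + J1)%nat).
  specialize (H J ltac:(unfold J; lia)).
  set (w := wave q0 v n (Z.of_nat n - Z.of_nat s) J 0) in *.
  assert (Cw : Ccont w) by apply Ccont_wave.
  assert (Co : Ccont (fun y => (osc v n y * eith (- INR s * y))%C)) by (apply Ccont_mult; [apply Ccont_osc,
      summable_coef|apply Ccont_eith]).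
  rewrite (Cmean_ext _ (fun y => (w y * f y + (osc v n y * eith (- INR s * y) - w y) * f y)%C)) by (intros;
      ring).
  assert (Cd : Ccont (fun y => (osc v n y * eith (- INR s * y) - w y)%C)) by (apply Ccont_minus; assumption).
  rewrite Cmean_plus by (apply Ccont_mult; assumption).
  eapply Rle_trans; [apply Cmod_triangle|]. apply Rplus_le_compat; [exact H|].
  eapply Rle_trans; [apply (Cmod_Cmean_mult_le (fun y => (osc v n y * eith (- INR s * y) - w y)%C));
      assumption|].
  rewrite Rmult_comm. apply Rmult_le_compat_l; [apply nrm_ge0|].
  apply nrm_bound; [exact Cd|lra|]. intros y _. rewrite Cmod_minus_sym. apply H1. unfold J; lia.
Qed.

Theorem osc_bilinear_bound : exists n1, forall n F G, (n1 <= n)%nat -> disc_alg F -> disc_alg G ->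
  Cmod (Cmean (fun y => (osc v n y * (F (eith y) * G (eith y)))%C)) <=
  / 2 * (nrm (fun y => F (eith y)) * nrm (fun y => G (eith y))).
Proof.
  destruct wave_bilinear_bound as [n1 [J0 H]]. exists n1. intros n F G Hn HF HG.
  apply disc_alg_bilinear_bound; try assumption.
  - apply Ccont_osc, summable_coef.
  - lra.
  - intros P R HP HR.
    rewrite (Cmean_ext _ (fun y => (osc v n y * eith (- INR 0 * y) * (P (eith y) * R (eith y)))%C)).
    2:{ intros y _. simpl INR. replace (- 0 * y) with 0 by ring. rewrite eith_0. ring. }
    apply osc_mean_limit with J0.
    + apply Ccont_mult; apply Ccont_poly; assumption.
    + intros J HJ. change (Z.of_nat 0) with 0%Z. rewrite Z.sub_0_r. apply H; assumption.
Qed.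

(** For s <= c0 n / 4 the wave estimate applies. For larger s, Cauchy-Schwarz with a unimodular
    kernel suffices, because the claimed factor is then at least 1. *)
Theorem osc_linear_bound : exists K, 0 <= K /\ forall n s F, (1 <= n)%nat -> disc_alg F ->
  Cmod (Cmean (fun y => (osc v n y * eith (- INR s * y) * F (eith y))%C)) <=
  K * ((INR s + 1) / INR n) ^ q * nrm (fun y => F (eith y)).
Proof.
  destruct wave_linear_bound as [K [J0 [HK H]]].
  assert (Hc4 : 0 <= (4 / c0) ^ q) by (apply pow_le, Rlt_le, Rdiv_lt_0_compat; lra).
  exists (K + (4 / c0) ^ q). split; [lra|]. intros n s F Hn HF.
  assert (HN : 1 <= INR n) by (apply (le_INR 1), Hn). pose proof (pos_INR s) as Hs.
  assert (Co : Ccont (fun y => (osc v n y * eith (- INR s * y))%C)) by (apply Ccont_mult; [apply Ccont_osc,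
      summable_coef|apply Ccont_eith]).
  assert (Hmod : forall y, Cmod (osc v n y * eith (- INR s * y)) = 1).
  { intros y. rewrite Cmod_mult, Cmod_osc, Cmod_eith. ring. }
  pose proof (nrm_ge0 (fun y => F (eith y))) as HnF.
  assert (Hsn : 0 <= ((INR s + 1) / INR n) ^ q) by (apply pow_le, Rlt_le, Rdiv_lt_0_compat; lra).
  rewrite Rmult_plus_distr_r, Rmult_plus_distr_r.
  assert (H0 : 0 <= (4 / c0) ^ q * ((INR s + 1) / INR n) ^ q * nrm (fun y => F (eith y)))
    by (apply Rmult_le_pos; [apply Rmult_le_pos|]; assumption).
  assert (H0' : 0 <= K * ((INR s + 1) / INR n) ^ q * nrm (fun y => F (eith y)))
    by (apply Rmult_le_pos; [apply Rmult_le_pos|]; assumption).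
  destruct (Rle_dec (INR s) (c0 / 4 * INR n)) as [Hle|Hgt].
  - apply Rle_trans with (K * ((INR s + 1) / INR n) ^ q * nrm (fun y => F (eith y))); [|lra].
    assert (HKn : 0 <= K * (/ INR n) ^ q).
    { apply Rmult_le_pos; [exact HK|]. apply pow_le, Rlt_le, Rinv_0_lt_compat. lra. }
    apply Rle_trans with (K * (/ INR n) ^ q * nrm (fun y => F (eith y))).
    + apply (disc_alg_linear_bound (fun y => (osc v n y * eith (- INR s * y))%C)); try assumption.
      intros P HP. apply osc_mean_limit with J0; [apply Ccont_poly, HP|].
        intros J HJ. apply H; assumption.
    + apply Rmult_le_compat_r; [exact HnF|]. apply Rmult_le_compat_l; [exact HK|].
      assert (0 < / INR n) by (apply Rinv_0_lt_compat; lra).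
      apply pow_incr. unfold Rdiv. nra.
  (* Here s > c0 n / 4, so (4 / c0)(s + 1) / n >= 1, and any power of it absorbs the constant 1. *)
  - apply Rle_trans with ((4 / c0) ^ q * ((INR s + 1) / INR n) ^ q * nrm (fun y => F (eith y))); [|lra].
    apply Rle_trans with (1 * nrm (fun y => F (eith y))).
    + eapply Rle_trans; [apply (Cmod_Cmean_mult_le (fun y => (osc v n y * eith (- INR s * y))%C)); [exact
        Co|apply Ccont_disc_alg, HF]|].
      apply Rmult_le_compat_r; [exact HnF|]. apply nrm_bound; [exact Co|lra|]. intros; rewrite Hmod; lra.
    + apply Rmult_le_compat_r; [exact HnF|]. rewrite <- Rpow_mult_distr. apply pow_R1_Rle.
      apply Rle_trans with (4 / c0 * (c0 / 4 * INR n / INR n)); [right; field; lra|].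
      apply Rmult_le_compat_l; [apply Rlt_le, Rdiv_lt_0_compat; lra|].
      apply Rmult_le_compat_r; [apply Rlt_le, Rinv_0_lt_compat; lra|]. lra.
Qed.

End Estimates.

(** * The Riemann-Hilbert factorization in Hankel form *)

Lemma unimodular_conj_mult (w : C) : Cmod w = 1 -> (w * Cconj w)%C = RtoC 1.
Proof. intros H. rewrite Cmult_conj_r, H. f_equal. ring. Qed.

Section Hankel.

Context (Q : R -> C) (A al b be : C -> C) (k0 : R).
Hypothesis HQ : Ccont Q.
Hypothesis HQ1 : forall t, Cmod (Q t) = 1.
Hypothesis DA : disc_alg A.
Hypothesis Dal : disc_alg al.
Hypothesis Db : disc_alg b.
Hypothesis Dbe : disc_alg be.
Hypothesis HA0 : A (RtoC 0) = RtoC 1.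
Hypothesis Hb0 : b (RtoC 0) = RtoC 0.
(** [A] stands for the conjugate of the overview's A, so that all the unknowns lie in the disc
    algebra; [be] is later instantiated by pi_n e^{-n conj N}. *)
Hypothesis H1 : forall t, Cconj (A (eith t)) = (al (eith t) + Cconj (Q t) * Cconj (b (eith t)))%C.
Hypothesis H2 : forall t, (Q t * Cconj (A (eith t)))%C = be (eith t).
Hypothesis Hbil : forall F G, disc_alg F -> disc_alg G ->
  Cmod (Cmean (fun y => (Q y * (F (eith y) * G (eith y)))%C)) <=
  / 2 * (nrm (fun y => F (eith y)) * nrm (fun y => G (eith y))).
Hypothesis Hlin : forall F, disc_alg F ->
  Cmod (Cmean (fun y => (Q y * F (eith y))%C)) <= k0 * nrm (fun y => F (eith y)).

Let al1 := fun w => (al w - RtoC 1)%C.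
Let A1 := fun w => (A w - RtoC 1)%C.

Let Dal1 : disc_alg al1.
Proof. apply disc_alg_minus; [exact Dal|apply disc_alg_const]. Qed.

Let DA1 : disc_alg A1.
Proof. apply disc_alg_minus; [exact DA|apply disc_alg_const]. Qed.

(** Multiply [H2] by b and insert [H1]: since Q conj Q = 1, this isolates |b|^2. The mean of b times
    [be] is zero because b vanishes at 0, and the two remaining means are bounded by [Hlin] and
    [Hbil]. *)
Lemma hankel_first : Cmod (RtoC (nrm (fun t => b (eith t)) ^ 2)) <=
  k0 * nrm (fun t => b (eith t)) + / 2 * (nrm (fun t => al1 (eith t)) * nrm (fun t => b (eith t))).
Proof.
  pose proof (Ccont_disc_alg b Db) as Cb. pose proof (Ccont_disc_alg al1 Dal1) as Cal1.
  pose proof (Ccont_disc_alg be Dbe) as Cbe.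
  rewrite nrm_sqr_Cmean by exact Cb.
  rewrite (Cmean_ext _ (fun t => (b (eith t) * be (eith t) - Q t * b (eith t) - Q t * (al1 (eith t) * b
      (eith t)))%C)).
  2:{ intros t _. unfold al1. rewrite <- H2, H1.
      pose proof (unimodular_conj_mult (Q t) (HQ1 t)) as HU.
      transitivity (Q t * Cconj (Q t) * (b (eith t) * Cconj (b (eith t))))%C;
        [rewrite HU; ring|ring]. }
  assert (C1 : Ccont (fun t => (b (eith t) * be (eith t))%C)) by (apply Ccont_mult; assumption).
  assert (C2 : Ccont (fun t => (Q t * b (eith t))%C)) by (apply Ccont_mult; assumption).
  assert (C3 : Ccont (fun t => (Q t * (al1 (eith t) * b (eith t)))%C))
    by (apply Ccont_mult; [|apply Ccont_mult]; assumption).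
  rewrite Cmean_minus by (try apply Ccont_minus; assumption).
  rewrite Cmean_minus by assumption.
  rewrite (Cmean_disc_alg (fun w => (b w * be w)%C)) by (apply disc_alg_mult; assumption).
  rewrite Hb0.
  match goal with |- Cmod (?Z - ?X - ?Y) <= _ =>
    replace (Z - X - Y)%C with (- (X + Y))%C by ring end.
  rewrite Cmod_opp. eapply Rle_trans; [apply Cmod_triangle|].
  apply Rplus_le_compat; [apply Hlin, Db|apply (Hbil al1 b); assumption].
Qed.

(** Multiply [H1], with 1 subtracted from both sides, by the conjugate of [al1]. The mean of [A1]
    times [al1] is zero because A is 1 at the origin, leaving one bilinear term. *)
Lemma hankel_second : Cmod (RtoC (nrm (fun t => al1 (eith t)) ^ 2)) <=
  / 2 * (nrm (fun t => b (eith t)) * nrm (fun t => al1 (eith t))).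
Proof.
  pose proof (Ccont_disc_alg b Db) as Cb. pose proof (Ccont_disc_alg al1 Dal1) as Cal1.
  pose proof (Ccont_disc_alg A1 DA1) as CA1.
  assert (C1 : Ccont (fun t => (A1 (eith t) * al1 (eith t))%C)) by (apply Ccont_mult; assumption).
  assert (C3 : Ccont (fun t => (Q t * (b (eith t) * al1 (eith t)))%C))
    by (apply Ccont_mult; [|apply Ccont_mult]; assumption).
  rewrite nrm_sqr_Cmean by exact Cal1.
  rewrite (Cmean_ext _ (fun t => (Cconj (A1 (eith t) * al1 (eith t)) - Cconj (Q t * (b (eith t) * al1 (eith
      t))))%C)).
  2:{ intros t _. rewrite !Cmult_conj.
      replace (Cconj (A1 (eith t))) with (al1 (eith t) + Cconj (Q t) * Cconj (b (eith t)))%C.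
      - ring.
      - unfold A1. rewrite Cminus_conj, H1, Cconj_RtoC. unfold al1. ring. }
  rewrite Cmean_minus by (apply Ccont_conj; assumption).
  rewrite (Cmean_conj _ C1), (Cmean_conj _ C3).
  rewrite (Cmean_disc_alg (fun w => (A1 w * al1 w)%C)) by (apply disc_alg_mult; assumption).
  replace (A1 (RtoC 0)) with (RtoC 0) by (unfold A1; rewrite HA0; ring).
  rewrite Cmult_0_l, Cconj_RtoC.
  match goal with |- Cmod (?Z - ?X) <= _ => replace (Z - X)%C with (- X)%C by ring end.
  rewrite Cmod_opp, Cmod_conj. apply (Hbil b al1); assumption.
Qed.

(** With x = ||b|| and y = ||al - 1||, the second relation gives y <= x / 2; the first then gives
    x^2 <= k0 x + x^2 / 4, hence x <= 4 k0 / 3. *)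
Lemma hankel_nrm_le : nrm (fun t => b (eith t)) <= 2 * k0.
Proof.
  pose proof hankel_first as F1. pose proof hankel_second as F2.
  rewrite Cmod_R, Rabs_pos_eq in F1 by apply pow2_ge_0.
  rewrite Cmod_R, Rabs_pos_eq in F2 by apply pow2_ge_0.
  set (x := nrm (fun t => b (eith t))) in *. set (y := nrm (fun t => al1 (eith t))) in *.
  assert (Hx : 0 <= x) by apply nrm_ge0. assert (Hy : 0 <= y) by apply nrm_ge0.
  assert (Hyx : y <= x / 2).
  { destruct (Rle_lt_or_eq_dec _ _ Hy) as [Hp|Hz]; [|lra].
    apply Rmult_le_reg_l with y; [exact Hp|]. nra. }
  (* Nonnegativity of [k0], for the case x = 0, comes from testing [Hlin] on the constant 1. *)
  assert (Hk : 0 <= k0).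
  { pose proof (Hlin (fun _ => RtoC 1) (disc_alg_const _)) as H.
    pose proof (Cmod_ge_0 (Cmean (fun y => (Q y * RtoC 1)%C))) as H'.
    assert (E : nrm (fun y => RtoC 1) = 1).
    { unfold nrm. rewrite Rmean_const, Cmod_1. simpl. rewrite !Rmult_1_r. apply sqrt_1. }
    cbv beta in H. rewrite E in H. lra. }
  destruct (Rle_lt_or_eq_dec _ _ Hx) as [Hp|Hz]; [|lra].
  apply Rmult_le_reg_l with x; [exact Hp|]. nra.
Qed.

(** Conjugating [H1] gives A - 1 = conj (al - 1) + Q b. For s >= 1 the first summand has no mode s,
    since (al - 1) z^s is analytic and vanishes at 0. *)
Lemma hankel_coef s : (1 <= s)%nat ->
  four (fun t => A1 (eith t)) (Z.of_nat s) = Cmean (fun t => (Q t * eith (- INR s * t) * b (eith t))%C).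
Proof.
  intros Hs.
  pose proof (Ccont_disc_alg b Db) as Cb. pose proof (Ccont_disc_alg al1 Dal1) as Cal1.
  assert (C1 : Ccont (fun t => (al1 (eith t) * Cpow (eith t) s)%C)).
  { apply (Ccont_disc_alg (fun w => (al1 w * Cpow w s)%C)), disc_alg_mult; [exact Dal1|apply disc_alg_Cpow]. }
  unfold four.
  rewrite (Cmean_ext _ (fun t => (Cconj (al1 (eith t) * Cpow (eith t) s) + Q t * eith (- INR s * t) * b
      (eith t))%C)).
  2:{ intros t _. rewrite <- INR_IZR_INZ, Cmult_conj, eith_pow, eith_conj, Ropp_mult_distr_l.
      unfold A1. rewrite <- (Cconj_conj (A (eith t))), H1, Cplus_conj, Cmult_conj, !Cconj_conj.
      unfold al1. rewrite Cminus_conj, Cconj_RtoC. ring. }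
  rewrite Cmean_plus.
  - rewrite (Cmean_conj _ C1).
    rewrite (Cmean_disc_alg (fun w => (al1 w * Cpow w s)%C)) by (apply disc_alg_mult; [exact Dal1|apply
        disc_alg_Cpow]).
    destruct s as [|s]; [lia|]. rewrite Cpow_S, Cmult_0_l, Cmult_0_r, Cconj_RtoC. ring.
  - apply Ccont_conj, C1.
  - apply Ccont_mult; [apply Ccont_mult; [exact HQ|apply Ccont_eith]|exact Cb].
Qed.

End Hankel.

Lemma disc_alg_reflect F : disc_alg F -> disc_alg (fun w => Cconj (F (Cconj w))).
Proof.
  intros HF eps He. destruct (HF eps He) as [P [[n [c Hc]] H]].
  exists (fun w => Cconj (P (Cconj w))). split.
  - exists n, (fun j => Cconj (c j)). intros w. rewrite Hc. unfold poly. rewrite csum_conj.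
    apply csum_ext. intros j _. rewrite Cmult_conj, Cpow_conj, Cconj_conj. reflexivity.
  - intros w Hw. rewrite <- Cminus_conj, Cmod_conj. apply H. rewrite Cmod_conj. exact Hw.
Qed.

(** * Derivatives of power series in [1/z] *)

(** Coefficients in powers of 1/z of the z-derivative of the sum of a_j z^{-j}: the factor -j
    appears and the index moves up by one. *)
Definition dcoef (a : nat -> C) (j : nat) : C :=
  match j with O => RtoC 0 | S j => (- RtoC (INR j) * a j)%C end.

(** A derivative costs one power of j + 1 and leaves M unchanged; M is what carries the decay in
    n. *)
Lemma dcoef_bound a M m : 0 <= M -> (forall j, Cmod (a j) <= M * (INR j + 1) ^ m) ->
  forall j, Cmod (dcoef a j) <= M * (INR j + 1) ^ S m.
Proof.
  intros HM Ha [|j].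
  - simpl dcoef. rewrite Cmod_0. apply Rmult_le_pos; [exact HM|]. apply pow_le. simpl. lra.
  - simpl dcoef. rewrite Cmod_mult, Cmod_opp, Cmod_R, Rabs_pos_eq by apply pos_INR.
    pose proof (pos_INR j). pose proof (Ha j) as H1. rewrite S_INR.
    assert (H2 : (INR j + 1) ^ m <= (INR j + 1 + 1) ^ m) by (apply pow_incr; lra).
    assert (H3 : M * (INR j + 1) ^ m <= M * (INR j + 1 + 1) ^ m) by (apply Rmult_le_compat_l; assumption).
    assert (0 <= M * (INR j + 1 + 1) ^ m) by (apply Rmult_le_pos; [exact HM|apply pow_le; lra]).
    simpl. pose proof (Cmod_ge_0 (a j)).
    apply Rle_trans with (INR j * (M * (INR j + 1 + 1) ^ m)); [apply Rmult_le_compat_l; lra|]. nra.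
Qed.

(** Write r = e^{-2x}. Half of the decay absorbs the power, since (j+1)^m <= m! x^{-m} e^{x(j+1)},
    and a geometric series of ratio e^{-x} remains. *)
Lemma ex_series_pow_geom m r : 0 < r < 1 -> ex_series (fun j => (INR j + 1) ^ m * r ^ j).
Proof.
  intros Hr. set (x := - ln r / 2).
  assert (Hln : ln r < 0) by (rewrite <- ln_1; apply ln_increasing; lra).
  assert (Hx : 0 < x) by (unfold x; lra).
  assert (He : exp x * r = exp (- x)).
  { replace r with (exp (ln r)) at 1 by (apply exp_ln; lra). rewrite <- exp_plus. f_equal. unfold x. field. }
  assert (He1 : exp (- x) < 1) by (rewrite <- exp_0; apply exp_increasing; lra).
  apply (ex_series_le (fun j => (INR j + 1) ^ m * r ^ j) (fun j => (INR (fact m) * (/ x) ^ m * exp x) * exp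
      (- x) ^ j)).
  - intros j. unfold norm; simpl; unfold abs; simpl.
    pose proof (pos_INR j).
    rewrite Rabs_pos_eq by (apply Rmult_le_pos; apply pow_le; lra).
    pose proof (pow_le_fact_exp m (x * (INR j + 1)) ltac:(apply Rmult_le_pos; lra)) as H0.
    rewrite Rpow_mult_distr in H0.
    assert (Hxm : 0 < x ^ m) by (apply pow_lt, Hx).
    assert (H1 : (INR j + 1) ^ m <= INR (fact m) * (/ x) ^ m * (exp x * exp x ^ j)).
    { apply Rmult_le_reg_l with (x ^ m); [exact Hxm|]. eapply Rle_trans; [exact H0|].
      right. rewrite Rmult_plus_distr_l, Rmult_1_r, exp_plus, (Rmult_comm x), exp_INR_mult.
      rewrite pow_inv. field. lra. }
    apply Rle_trans with (INR (fact m) * (/ x) ^ m * (exp x * exp x ^ j) * r ^ j).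
    + apply Rmult_le_compat_r; [apply pow_le; lra|exact H1].
    + right. rewrite <- He, Rpow_mult_distr. ring.
  - apply (ex_series_scal_l (INR (fact m) * (/ x) ^ m * exp x) (fun j => exp (- x) ^ j)).
    apply ex_series_geom. rewrite Rabs_pos_eq; [exact He1|apply Rlt_le, exp_pos].
Qed.

(** A quadratic remainder implies complex differentiability; a power series can then be
    differentiated by summing explicit remainder bounds. *)
Lemma is_derive_C_quadratic (f : C -> C) z l M d : 0 < d ->
  (forall z', Cmod (z' - z) < d ->
     Cmod (f z' - f z - l * (z' - z)) <= M * Cmod (z' - z) ^ 2) ->
  @is_derive C_AbsRing C_NormedModule f z l.
Proof.
  intros Hd H. split; [apply is_linear_scal_l|].
  intros x Hx. apply (is_filter_lim_locally_unique (V := AbsRing_NormedModule C_AbsRing) z x) in Hx. subst x.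
  intros [eps He]. simpl.
  assert (HM : 0 < eps / (Rabs M + 1)) by (apply Rdiv_lt_0_compat; [exact He|pose proof (Rabs_pos M); lra]).
  set (r := Rmin d (eps / (Rabs M + 1))). assert (Hr : 0 < r) by (apply Rmin_pos; assumption).
  apply (locally_le_locally_norm (V := AbsRing_NormedModule C_AbsRing) z).
  exists (mkposreal r Hr). intros y Hy.
  change (Cmod (y - z) < r) in Hy.
  change (Cmod (f y - f z - (y - z) * l) <= eps * Cmod (y - z)).
  assert (Hyd : Cmod (y - z) < d) by (eapply Rlt_le_trans; [exact Hy|apply Rmin_l]).
  assert (Hye : Cmod (y - z) < eps / (Rabs M + 1)) by (eapply Rlt_le_trans; [exact Hy|apply Rmin_r]).
  specialize (H y Hyd). rewrite (Cmult_comm (y - z)%C l).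
  eapply Rle_trans; [exact H|]. set (u := Cmod (y - z)) in *.
  assert (Hu : 0 <= u) by apply Cmod_ge_0. pose proof (Rle_abs M). pose proof (Rabs_pos M).
  replace (M * u ^ 2) with ((M * u) * u) by ring. apply Rmult_le_compat_r; [exact Hu|].
  apply Rle_trans with ((Rabs M + 1) * (eps / (Rabs M + 1))); [nra|]. right. field. lra.
Qed.

(** First- and second-order remainders of the power function, proved together since the second step
    uses the first bound. The factors r and r^2 stand on the left to avoid the exponents n - 1 and n
    - 2; at n = 0 the truncated n - 1 is multiplied by 0. *)
Lemma Cpow_diff_lin_le a b r n : 0 <= r -> Cmod a <= r -> Cmod b <= r ->
  Cmod (Cpow b n - Cpow a n) * r <= INR n * r ^ n * Cmod (b - a) /\
  Cmod (Cpow b n - Cpow a n - RtoC (INR n) * (Cpow a (n - 1) * (b - a))) * r ^ 2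
    <= INR n ^ 2 * r ^ n * Cmod (b - a) ^ 2.
Proof.
  intros Hr Ha Hb. pose proof (Cmod_ge_0 (b - a)%C) as Hd. set (d := Cmod (b - a)) in *.
  induction n as [|n [IH1 IH2]].
  - split.
    + simpl. replace (RtoC 1 - RtoC 1)%C with (RtoC 0) by ring. rewrite Cmod_0. lra.
    + simpl. match goal with |- Cmod ?X * _ <= _ => replace X with (RtoC 0) by ring end. rewrite Cmod_0. lra.
  - pose proof (pos_INR n) as Hn. pose proof (pow_le r n Hr) as Hrn.
    assert (Han : Cmod a ^ n <= r ^ n) by (apply pow_incr; split; [apply Cmod_ge_0|exact Ha]).
    assert (H1 : Cmod (Cpow b (S n) - Cpow a (S n)) * r <= INR (S n) * r ^ S n * d).
    { rewrite !Cpow_S.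
      replace (b * Cpow b n - a * Cpow a n)%C with
        (b * (Cpow b n - Cpow a n) + (b - a) * Cpow a n)%C by ring.
      apply Rle_trans with ((Cmod b * Cmod (Cpow b n - Cpow a n) + d * Cmod a ^ n) * r).
      { apply Rmult_le_compat_r; [exact Hr|]. eapply Rle_trans; [apply Cmod_triangle|].
        rewrite !Cmod_mult, Cmod_pow. fold d. lra. }
      rewrite S_INR. simpl pow.
      assert (Cmod b * (Cmod (Cpow b n - Cpow a n) * r) <= r * (INR n * r ^ n * d)).
      { apply Rmult_le_compat; try apply Cmod_ge_0; try assumption.
        apply Rmult_le_pos; [apply Cmod_ge_0|exact Hr]. }
      assert (d * Cmod a ^ n * r <= d * r ^ n * r).
      { apply Rmult_le_compat_r; [exact Hr|]. apply Rmult_le_compat_l; assumption. }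
      lra. }
    split; [exact H1|].
    rewrite S_INR. replace (S n - 1)%nat with n by lia.
    replace (Cpow b (S n) - Cpow a (S n) - RtoC (INR n + 1) * (Cpow a n * (b - a)))%C
      with (a * (Cpow b n - Cpow a n - RtoC (INR n) * (Cpow a (n - 1) * (b - a))) + (b - a) * (Cpow b n -
          Cpow a n))%C.
    2:{ rewrite !Cpow_S, RtoC_plus. destruct n as [|n'].
        - simpl. ring.
        - replace (S n' - 1)%nat with n' by lia. rewrite !Cpow_S. ring. }
    set (X := (Cpow b n - Cpow a n - RtoC (INR n) * (Cpow a (n - 1) * (b - a)))%C) in *.
    apply Rle_trans with ((Cmod a * Cmod X + d * Cmod (Cpow b n - Cpow a n)) * r ^ 2).
    { apply Rmult_le_compat_r; [apply pow2_ge_0|]. eapply Rle_trans; [apply Cmod_triangle|].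
      rewrite !Cmod_mult. fold d. lra. }
    assert (P1 : Cmod a * (Cmod X * r ^ 2) <= r * (INR n ^ 2 * r ^ n * d ^ 2)).
    { apply Rmult_le_compat; try apply Cmod_ge_0; try assumption.
      apply Rmult_le_pos; [apply Cmod_ge_0|apply pow2_ge_0]. }
    assert (P2 : (d * r) * (Cmod (Cpow b n - Cpow a n) * r) <= (d * r) * (INR n * r ^ n * d)).
    { apply Rmult_le_compat_l; [apply Rmult_le_pos; assumption|exact IH1]. }
    assert (P3 : 0 <= r * r ^ n * d ^ 2 * (INR n + 1)).
    { repeat apply Rmult_le_pos; try assumption; try lra. }
    simpl pow in *. nra.
Qed.

Lemma summable_poly_geom a M m w : (forall j, Cmod (a j) <= M * (INR j + 1) ^ m) -> Cmod w < 1 ->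
  summable (fun j => (a j * Cpow w j)%C).
Proof.
  intros Ha Hw. set (r := (Cmod w + 1) / 2). pose proof (Cmod_ge_0 w).
  apply ex_series_Cmod_le with (fun j => M * ((INR j + 1) ^ m * r ^ j)).
  - intros j. rewrite Cmod_mult, Cmod_pow, <- Rmult_assoc.
    apply Rmult_le_compat; [apply Cmod_ge_0|apply pow_le; lra|apply Ha|].
    apply pow_incr. unfold r. lra.
  - apply (ex_series_scal_l M (fun j => (INR j + 1) ^ m * r ^ j)), ex_series_pow_geom. unfold r. lra.
Qed.

Lemma summable_plus a b : summable a -> summable b -> summable (fun j => (a j + b j)%C).
Proof.
  intros Ha Hb. apply ex_series_Cmod_le with (fun j => Cmod (a j) + Cmod (b j)); [intros; apply Cmod_triangle|].
  apply (ex_series_plus (fun j => Cmod (a j)) (fun j => Cmod (b j))); assumption.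
Qed.

Lemma summable_scal c a : summable a -> summable (fun j => (c * a j)%C).
Proof.
  intros Ha. apply ex_series_ext with (fun j => Cmod c * Cmod (a j)); [intros; symmetry; apply Cmod_mult|].
  apply (ex_series_scal_l (Cmod c) (fun j => Cmod (a j))), Ha.
Qed.

Lemma CSeries_plus a b : summable a -> summable b ->
  CSeries (fun j => (a j + b j)%C) = (CSeries a + CSeries b)%C.
Proof.
  intros Ha Hb.
  apply (Clim_unique (csum (fun j => (a j + b j)%C))); [apply CSeries_lim, summable_plus; assumption|].
  intros eps He. destruct (Clim_plus _ _ _ _ (CSeries_lim a Ha) (CSeries_lim b Hb) eps He) as [M0 H0].
  exists M0. intros M HM. rewrite csum_plus. apply H0, HM.
Qed.

Lemma CSeries_remainder a b c d : summable a -> summable b -> summable c ->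
  (CSeries a - CSeries b - d * CSeries c)%C = CSeries (fun j => (a j - b j - d * c j)%C).
Proof.
  intros Ha Hb Hc. pose proof (summable_scal (- RtoC 1)%C b Hb) as Hb'. pose proof (summable_scal (- d)%C c
      Hc) as Hc'.
  rewrite (CSeries_ext (fun j => (a j - b j - d * c j)%C) (fun j => ((a j + - RtoC 1 * b j) + - d * c
      j)%C)) by (intros; ring).
  rewrite (CSeries_plus _ _ (summable_plus _ _ Ha Hb') Hc'), (CSeries_plus _ _ Ha Hb'), !CSeries_mult_l by
      assumption.
  ring.
Qed.

Lemma Cmod_CSeries_le_partial a B : summable a -> (forall M, Cmod (csum a M) <= B) -> Cmod (CSeries a) <= B.
Proof.
  intros Ha HB. apply Rle_plus_epsilon. intros eps He. destruct (CSeries_lim a Ha eps He) as [M HM].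
  specialize (HM M (le_n M)). rewrite Cmod_minus_sym in HM.
  replace (CSeries a) with (csum a M + (CSeries a - csum a M))%C by ring.
  eapply Rle_trans; [apply Cmod_triangle|]. specialize (HB M). lra.
Qed.

(** Term by term, the second-order remainder in D = z' - z is at most 2 M (j+1)^{m+2} r^j |D|^2, and
    these bounds are summable for r < 1. *)
Lemma is_derive_pseries_inv a M m z : 0 <= M -> (forall j, Cmod (a j) <= M * (INR j + 1) ^ m) -> 1 < Cmod z ->
  @is_derive C_AbsRing C_NormedModule (fun z => pseries a (Cinv z)) z (pseries (dcoef a) (Cinv z)).
Proof.
  intros HM Ha Hz.
  (* Halfway between 1 and |z|: points within (|z| - 1) / 2 of z have modulus at least [R0], so
     their inverses stay within r < 1. *)
  set (R0 := (1 + Cmod z) / 2). set (r := / R0).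
  assert (HR0 : 1 < R0) by (unfold R0; lra).
  assert (Hr : 0 < r < 1).
  { split; [apply Rinv_0_lt_compat; lra|]. rewrite <- Rinv_1. apply Rinv_lt_contravar; lra. }
  assert (Hinv : forall z', R0 <= Cmod z' -> z' <> RtoC 0 /\ Cmod (Cinv z') <= r).
  { intros z' Hz'. assert (z' <> RtoC 0) by (apply Cmod_gt_0; lra).
    split; [assumption|]. rewrite Cmod_inv by assumption. apply Rinv_le_contravar; lra. }
  destruct (Hinv z) as [Hz0 Hwr]; [unfold R0; lra|].
  set (S0 := Series (fun j => (INR j + 1) ^ (m + 2) * r ^ j)).
  assert (HS : ex_series (fun j => (INR j + 1) ^ (m + 2) * r ^ j)) by (apply ex_series_pow_geom, Hr).
  apply is_derive_C_quadratic with (M := (2 * M * S0)) (d := (Cmod z - 1) / 2); [lra|].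
  intros z' Hz'.
  assert (Hz'R : R0 <= Cmod z').
  { assert (Cmod z <= Cmod z' + Cmod (z' - z)); [|unfold R0; lra].
    replace z with (z' - (z' - z))%C at 1 by ring. apply Cmod_minus_le. }
  destruct (Hinv z' Hz'R) as [Hz'0 Hw'r].
  set (w := Cinv z) in *. set (w' := Cinv z') in *. set (D := (z' - z)%C) in *.
  assert (Hww : (w' - w)%C = (- (D * (w * w')))%C).
  { unfold w, w', D. field. split; assumption. }
  assert (Sw : forall b m' w0, (forall j, Cmod (b j) <= M * (INR j + 1) ^ m') -> Cmod w0 <= r ->
     summable (fun j => (b j * Cpow w0 j)%C)).
  { intros b m' w0 Hb Hw0. apply summable_poly_geom with M m'; [exact Hb|lra]. }
  assert (Sd : summable (fun j => (a j * (- RtoC (INR j) * Cpow w (S j)))%C)).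
  { assert (S1 := Sw _ _ w (dcoef_bound a M m HM Ha) Hwr).
    apply (ex_series_incr_1 (fun j => Cmod (dcoef a j * Cpow w j))) in S1.
    apply ex_series_ext with (fun j => Cmod (dcoef a (S j) * Cpow w (S j))); [|exact S1].
    intros j. f_equal. cbn [dcoef]. ring. }
  assert (Hd : pseries (dcoef a) w = CSeries (fun j => (a j * (- RtoC (INR j) * Cpow w (S j)))%C)).
  { assert (S1 := Sw _ _ w (dcoef_bound a M m HM Ha) Hwr).
    symmetry. apply (Clim_unique (csum (fun j => (a j * (- RtoC (INR j) * Cpow w (S j)))%C)));
      [apply CSeries_lim, Sd|].
    intros eps He. destruct (CSeries_lim _ S1 eps He) as [M1 HM1]. exists M1. intros M2 HM2.
    specialize (HM1 (S M2) ltac:(lia)). rewrite csum_first in HM1.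
    eapply Rle_lt_trans; [|exact HM1]. right. f_equal. unfold pseries. cbn [dcoef].
    rewrite (csum_ext _ (fun i => (- RtoC (INR i) * a i * Cpow w (S i))%C)) by (intros; ring). ring. }
  set (T := fun j => (a j * (Cpow w' j - Cpow w j - - RtoC (INR j) * Cpow w (S j) * D))%C).
  assert (HT : (pseries a w' - pseries a w - pseries (dcoef a) w * D)%C = CSeries T).
  { rewrite Hd, (Cmult_comm _ D). unfold pseries.
    rewrite CSeries_remainder by (assumption || apply (Sw a m); assumption).
    apply CSeries_ext. intros j. unfold T. ring. }
  rewrite HT.
  set (u := Cmod D). assert (Hu : 0 <= u) by apply Cmod_ge_0.
  eapply Rle_trans; [apply (Cmod_CSeries_le T (fun j => (2 * M * u ^ 2) * ((INR j + 1) ^ (m + 2) * r ^ j)))|].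
  - intros j. unfold T. rewrite Cmod_mult.
    (* With w = 1/z one has w' - w = -D w^2 + D^2 w^2 w'. The remainder thus splits into the Taylor
       remainder of the j-th power and a second-order term from the inversion. *)
    replace (Cpow w' j - Cpow w j - - RtoC (INR j) * Cpow w (S j) * D)%C with
      (Cpow w' j - Cpow w j - RtoC (INR j) * (Cpow w (j - 1) * (w' - w)) + RtoC (INR j) * (Cpow w (j + 1) *
          (D * D * w')))%C.
    2:{ rewrite Hww. destruct j as [|j]; [simpl; ring|]. replace (S j - 1)%nat with j by lia.
        replace (S j + 1)%nat with (S (S j)) by lia. rewrite !Cpow_S.
        assert (E : w' = (w - D * (w * w'))%C) by (transitivity (w + (w' - w))%C; [ring|rewrite Hww; ring]).
        set (W := Cpow w' j).
        transitivity (w' * W - w * Cpow w j - - RtoC (INR (S j)) * (w * (w * Cpow w j)) * D + RtoC (INR (S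
            j)) * (D * w * Cpow w j) * (w' - (w - D * (w * w'))))%C;
          [ring|].
        rewrite <- E. ring. }
    destruct (Cpow_diff_lin_le w w' r j ltac:(lra) Hwr Hw'r) as [_ HP].
    set (X := (Cpow w' j - Cpow w j - RtoC (INR j) * (Cpow w (j - 1) * (w' - w)))%C) in *.
    assert (Hdw : Cmod (w' - w) <= u * r ^ 2).
    { rewrite Hww, Cmod_opp, !Cmod_mult. fold u. replace (u * r ^ 2) with (u * (r * r)) by ring.
      apply Rmult_le_compat_l; [exact Hu|]. apply Rmult_le_compat; try apply Cmod_ge_0; assumption. }
    pose proof (pos_INR j) as Hj. pose proof (pow_le r j ltac:(lra)) as Hrj.
    assert (HX : Cmod X <= INR j ^ 2 * r ^ j * u ^ 2).
    { apply Rmult_le_reg_r with (r ^ 2); [apply pow_lt; lra|]. eapply Rle_trans; [exact HP|].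
      assert (E1 : Cmod (w' - w) ^ 2 <= (u * r ^ 2) ^ 2) by (apply pow_incr; split; [apply Cmod_ge_0|exact
          Hdw]).
      assert (E2 : (u * r ^ 2) ^ 2 <= u ^ 2 * r ^ 2).
      { rewrite Rpow_mult_distr. apply Rmult_le_compat_l; [apply pow2_ge_0|].
        assert (r ^ 2 <= 1) by (apply Rpow_le_1; lra). assert (0 <= r ^ 2) by apply pow2_ge_0. simpl in *.
            nra. }
      assert (0 <= INR j ^ 2 * r ^ j) by (apply Rmult_le_pos; [apply pow2_ge_0|exact Hrj]).
      apply Rle_trans with (INR j ^ 2 * r ^ j * (u ^ 2 * r ^ 2)); [apply Rmult_le_compat_l; lra|]. right;
          ring. }
    assert (HY : Cmod (RtoC (INR j) * (Cpow w (j + 1) * (D * D * w'))) <= INR j * r ^ j * u ^ 2).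
    { rewrite !Cmod_mult, Cmod_R, Rabs_pos_eq, Cmod_pow by exact Hj. fold u. rewrite (Rmult_assoc (INR j)
        (r ^ j)).
      apply Rmult_le_compat_l; [exact Hj|]. rewrite Nat.add_1_r.
      assert (Q1 : Cmod w ^ S j <= r ^ j).
      { simpl. rewrite <- (Rmult_1_l (r ^ j)). pose proof (Cmod_ge_0 w). apply Rmult_le_compat; try lra;
          [apply pow_le; lra|].
        apply pow_incr; lra. }
      assert (Q2 : u * u * Cmod w' <= u ^ 2).
      { pose proof (Cmod_ge_0 w'). assert (0 <= u * u) by nra. simpl. nra. }
      apply Rmult_le_compat; try assumption; [apply pow_le, Cmod_ge_0|].
      apply Rmult_le_pos; [nra|apply Cmod_ge_0]. }
    assert (HXY : Cmod (X + RtoC (INR j) * (Cpow w (j + 1) * (D * D * w'))) <=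
                  2 * (INR j + 1) ^ 2 * (r ^ j * u ^ 2)).
    { eapply Rle_trans; [apply Cmod_triangle|].
      assert (0 <= r ^ j * u ^ 2) by (apply Rmult_le_pos; [exact Hrj|apply pow2_ge_0]).
      apply Rle_trans with ((INR j ^ 2 + INR j) * (r ^ j * u ^ 2)); [lra|].
      apply Rmult_le_compat_r; [assumption|]. nra. }
    eapply Rle_trans; [apply Rmult_le_compat; [apply Cmod_ge_0|apply Cmod_ge_0|apply Ha|exact HXY]|].
    right. rewrite pow_add. ring.
  - apply (ex_series_scal_l (2 * M * u ^ 2) (fun j => (INR j + 1) ^ (m + 2) * r ^ j)), HS.
  - rewrite Series_scal_l. fold S0. right. ring.
Qed.

(** * The potential *)

Lemma Cinv_2PI : Cinv (RtoC 2 * RtoC PI) = RtoC (/ (2 * PI)).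
Proof. pose proof PI_pos2. rewrite <- RtoC_mult, <- RtoC_inv by lra. reflexivity. Qed.

Lemma fourier_four V j : fourier V j = four (fun t => RtoC (V t)) j.
Proof. unfold fourier. rewrite Cinv_2PI. reflexivity. Qed.

(** The Fourier coefficient of index -(j + 1), that is, the coefficient of z^{-(j+1)} in N. *)
Definition coef (V : R -> R) (j : nat) : C := four (fun t => RtoC (V t)) (- Z.of_nat (S j)).

Lemma lipschitz_continuous (f : R -> R) L : (forall x y, Rabs (f x - f y) <= L * Rabs (x - y)) ->
  forall t, continuous f t.
Proof.
  intros HL t. apply continuity_pt_filterlim. intros eps He. pose proof (Rabs_pos L). pose proof (Rle_abs L).
  exists (eps / (Rabs L + 1)). split; [apply Rdiv_lt_0_compat; lra|].
  intros x [_ Hx]. simpl in *. unfold Rdist in *.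
  eapply Rle_lt_trans; [apply HL|]. pose proof (Rabs_pos (x - t)).
  apply Rle_lt_trans with ((Rabs L + 1) * Rabs (x - t)); [nra|].
  apply Rlt_le_trans with ((Rabs L + 1) * (eps / (Rabs L + 1))); [apply Rmult_lt_compat_l; lra|].
  right. field. lra.
Qed.

Lemma C_Lip_smooth q V : (1 <= q)%nat -> C_Lip q V ->
  exists dV, (forall t, is_derive V t (dV t)) /\ (forall t, continuous dV t).
Proof.
  intros Hq [d [H0 [HD [L HL]]]]. exists (d 1%nat). split.
  - intros t. apply is_derive_ext with (d 0%nat); [exact H0|apply HD; lia].
  - intros t. destruct (Nat.eq_dec q 1) as [->|Hq1].
    + apply (lipschitz_continuous (d 1%nat) L HL).
    + eapply continuous_derivable, HD. lia.
Qed.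

(** The q derivatives give the factor (j+1)^q, and the Lipschitz form of Bessel's inequality one
    more, with B equal to the Lipschitz constant. As V is real, negative modes have the modulus of
    the positive ones. *)
Lemma C_Lip_coef_decay q V : periodic2pi V -> C_Lip q V ->
  exists B, 0 <= B /\ forall n, rsum (fun j => (INR (S j) ^ S q * Cmod (coef V j)) ^ 2) n <= B ^ 2.
Proof.
  intros Hper [d [H0 [HD [L HL]]]].
  assert (HL0 : 0 <= L).
  { specialize (HL 1 0). pose proof (Rabs_pos (d q 1 - d q 0)). rewrite Rminus_0_r, Rabs_R1 in HL. lra. }
  pose proof (lipschitz_continuous (d q) L HL) as Hc.
  assert (Hp0 : forall t, d 0%nat (t + 2 * PI) = d 0%nat t) by (intros; rewrite !H0; apply Hper).
  exists L. split; [exact HL0|]. intros n.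
  destruct (Cmod_four_iterated_derive d q 0 Hp0 HD Hc) as [Hpq _].
  eapply Rle_trans; [|apply (bessel_lipschitz (fun t => RtoC (d q t)) 1 n L)].
  - apply Req_le, rsum_ext. intros j _. f_equal.
    destruct (Cmod_four_iterated_derive d q (1 + Z.of_nat j) Hp0 HD Hc) as [_ E]. rewrite E.
    replace (1 + Z.of_nat j)%Z with (Z.of_nat (S j)) by lia.
    rewrite <- INR_IZR_INZ, Rabs_pos_eq by apply pos_INR.
    assert (E2 : Cmod (coef V j) = Cmod (four (fun t => RtoC (d 0%nat t)) (Z.of_nat (S j)))).
    { unfold coef.
      assert (Cd : Ccont (fun t => RtoC (d 0%nat t))).
      { apply Ccont_RtoC. destruct q as [|q']; [exact Hc|]. intros t. eapply continuous_derivable, HD. lia. }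
      rewrite (four_ext (fun t => RtoC (V t)) (fun t => Cconj (RtoC (d 0%nat t)))).
      - rewrite four_conj by exact Cd. rewrite Cmod_conj, Z.opp_involutive. reflexivity.
      - intros t _. rewrite Cconj_RtoC, H0. reflexivity. }
    rewrite E2. simpl. ring.
  - apply Ccont_RtoC, Hc.
  - intros t. rewrite Hpq. reflexivity.
  - exact HL0.
  - intros x y. rewrite <- RtoC_minus, Cmod_R. apply HL.
Qed.

Lemma Cinv_Cpow z n : z <> RtoC 0 -> Cinv (Cpow z n) = Cpow (Cinv z) n.
Proof.
  intros Hz. induction n as [|n IH].
  - simpl. field.
  - rewrite !Cpow_S, <- IH. field. split; [apply Cpow_nz|]; exact Hz.
Qed.

Lemma Nfun_pseries V z : summable (coef V) -> 1 <= Cmod z -> Nfun V z = pseries (shift0 (coef V)) (Cinv z).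
Proof.
  intros Hv Hz. assert (Hz0 : z <> RtoC 0) by (apply Cmod_gt_0; lra).
  rewrite <- CSeries_shift0; [|exact Hv|].
  - apply (CSeries_ext (Nterm V z)). intros j. unfold Nterm. rewrite fourier_four, pow_n_Cpow, Cinv_Cpow by
      exact Hz0. reflexivity.
  - rewrite Cmod_inv by exact Hz0. rewrite <- Rinv_1. apply Rinv_le_contravar; lra.
Qed.

Lemma Nfun_Nbd V t : summable (coef V) -> Nfun V (eith t) = Nbd (coef V) t.
Proof.
  intros Hv. rewrite Nbd_pseries, Nfun_pseries, eith_inv by (assumption || (rewrite Cmod_eith; lra)).
      reflexivity.
Qed.

(** Quadratic for small x and linear for large x, in the minimum form that [min_weight_small]
    sums. *)
Lemma eith_taylor x : Cmod (eith x - RtoC 1 - (0, x)%R) <= 10 * (Rabs x * Rmin 1 (Rabs x)).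
Proof.
  assert (Hx : Cmod (0, x) = Rabs x).
  { unfold Cmod; simpl. rewrite <- sqrt_Rsqr_abs. f_equal. unfold Rsqr. ring. }
  pose proof (Rabs_pos x). unfold Rmin. destruct (Rle_dec 1 (Rabs x)) as [H1|H1].
  - eapply Rle_trans; [apply Cmod_minus_le|]. rewrite Hx.
    pose proof (Cmod_minus_le (eith x) (RtoC 1)) as H2. rewrite Cmod_eith, Cmod_1 in H2. lra.
  - rewrite eith_Cexp. eapply Rle_trans; [apply Cexp_taylor2; rewrite Hx; lra|]. rewrite Hx. right; ring.
Qed.

(** Termwise differentiation: the remainder is at most 10 |h| times the sum of (j+1) |v_j| min(1,
    (j+1) |h|), which is o(h). The derivative of N is -i times the weighted series, whose imaginary
    part is minus a real part. *)
Lemma Nbd_im_derive v y : summable (fun j => (RtoC (INR (S j)) * v j)%C) -> summable v ->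
  is_derive (fun y => snd (Nbd v y)) y
    (- fst (CSeries (fun j => (RtoC (INR (S j)) * v j * eith (- INR (S j) * y))%C))).
Proof.
  intros Hw Hv.
  set (S1 := CSeries (fun j => (RtoC (INR (S j)) * v j * eith (- INR (S j) * y))%C)).
  assert (Hww : ex_series (fun j => INR (S j) * Cmod (v j))).
  { apply ex_series_ext with (fun j => Cmod (RtoC (INR (S j)) * v j)); [|exact Hw].
    intros j. rewrite Cmod_mult, Cmod_R, Rabs_pos_eq by apply pos_INR. reflexivity. }
  apply is_derive_Reals. intros eps He.
  (* The 20 compensates the 10 of [eith_taylor] and leaves eps / 2, for a strict inequality. *)
  destruct (min_weight_small (fun j => INR (S j) * Cmod (v j))
     (fun j => Rmult_le_pos _ _ (pos_INR _) (Cmod_ge_0 _)) Hww (eps / 20)) as [t0 [Ht0 Hmin]]; [lra|].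
  exists (mkposreal t0 Ht0). intros h Hh Hht. simpl in Hht.
  pose proof (Rabs_pos_lt h Hh) as Hhp.
  assert (Key : Cmod (Nbd v (y + h) - Nbd v y - (0, - h)%R * S1) <= Rabs h * (eps / 2)).
  { set (T := fun j => (v j * eith (- INR (S j) * y) * (eith (- INR (S j) * h) - RtoC 1 - (0, - INR (S j) *
      h)%R))%C).
    assert (Hterm : forall j, Cmod (T j) <= 10 * (Rabs h * (INR (S j) * Cmod (v j) * Rmin 1 (INR (S j) *
        Rabs h)))).
    { intros j. unfold T. rewrite !Cmod_mult, Cmod_eith, Rmult_1_r.
      pose proof (eith_taylor (- INR (S j) * h)) as H.
      rewrite Rabs_mult, Rabs_Ropp, (Rabs_pos_eq (INR (S j))) in H by apply pos_INR.
      pose proof (Cmod_ge_0 (v j)).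
      apply Rle_trans with (Cmod (v j) * (10 * (INR (S j) * Rabs h * Rmin 1 (INR (S j) * Rabs h)))).
      - apply Rmult_le_compat_l; assumption.
      - right; ring. }
    assert (Hpart : forall M, Cmod (csum T M) <= Rabs h * (eps / 2)).
    { intros M. eapply Rle_trans; [apply Cmod_csum|].
      eapply Rle_trans; [apply rsum_le; intros j _; apply Hterm|].
      rewrite rsum_mult_l, rsum_mult_l. pose proof (Hmin (Rabs h) M ltac:(lra)) as H.
      cbv beta in H. nra. }
    assert (Hsum : forall b x, summable b -> summable (fun j => (b j * eith (- INR (S j) * x))%C)).
    { intros b x Hb. apply summable_mult; [exact Hb|]. intros; rewrite Cmod_eith; lra. }
    unfold Nbd, S1. rewrite CSeries_remainder by (apply Hsum; assumption).
    rewrite (CSeries_ext _ T).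
    - apply Cmod_CSeries_le_partial; [|exact Hpart].
      apply ex_series_Cmod_le with (fun j => 10 * Rabs h * (INR (S j) * Cmod (v j))).
      + intros j. eapply Rle_trans; [apply Hterm|].
        pose proof (Rmin_l 1 (INR (S j) * Rabs h)).
        assert (0 <= Rabs h * (INR (S j) * Cmod (v j)))
          by (apply Rmult_le_pos; [lra|apply Rmult_le_pos; [apply pos_INR|apply Cmod_ge_0]]).
        nra.
      + apply (ex_series_scal_l (10 * Rabs h) (fun j => INR (S j) * Cmod (v j))), Hww.
    - intros j. unfold T.
      replace (0, - INR (S j) * h) with ((0, - h)%R * RtoC (INR (S j)))%C.
      2:{ unfold Cmult, RtoC; cbn [fst snd]. f_equal; ring. }
      rewrite (Rmult_plus_distr_l (- INR (S j)) y h), eith_plus. ring. }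
  pose proof (Rabs_snd_le (Nbd v (y + h) - Nbd v y - (0, - h)%R * S1)%C) as H.
  change (snd (Nbd v (y + h) - Nbd v y - (0, - h)%R * S1)%C) with
    (snd (Nbd v (y + h)) - snd (Nbd v y) - (0 * snd S1 + - h * fst S1)) in H.
  replace ((snd (Nbd v (y + h)) - snd (Nbd v y)) / h - - fst S1) with
    ((snd (Nbd v (y + h)) - snd (Nbd v y) - (0 * snd S1 + - h * fst S1)) / h) by (field; exact Hh).
  unfold Rdiv. rewrite Rabs_mult, Rabs_inv.
  apply Rle_lt_trans with (Rabs h * (eps / 2) * / Rabs h).
  - apply Rmult_le_compat_r; [apply Rlt_le, Rinv_0_lt_compat, Hhp|lra].
  - replace (Rabs h * (eps / 2) * / Rabs h) with (eps / 2) by (field; lra). lra.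
Qed.

(** The series expression is continuous and equals kappa' by uniqueness of derivatives; its minimum
    over the compact period is a value of kappa', hence positive. *)
Lemma kappa_lower_bound V : summable (fun j => (RtoC (INR (S j)) * coef V j)%C) -> summable (coef V) ->
  (forall t, exists d, is_derive (kappa V) t d /\ 0 < d) ->
  exists c0, 0 < c0 /\ forall y, - PI <= y <= PI ->
    c0 <= 1 - 2 * fst (CSeries (fun j => (RtoC (INR (S j)) * coef V j * eith (- INR (S j) * y))%C)).
Proof.
  intros Hw Hv Hk.
  set (g := fun y => 1 - 2 * fst (CSeries (fun j => (RtoC (INR (S j)) * coef V j * eith (- INR (S j) * y))%C))).
  assert (Hg : forall y, continuous g y).
  { intros y. apply continuous_Rminus; [apply continuous_const|]. apply continuous_Rmult; [apply
      continuous_const|].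
    apply (Ccont_Nbd (fun j => (RtoC (INR (S j)) * coef V j)%C) Hw y). }
  assert (Hder : forall y, is_derive (kappa V) y (g y)).
  { intros y. unfold kappa, Omega.
    apply is_derive_ext with (fun t => t + 2 * snd (Nbd (coef V) t)).
    { intros t. rewrite Nfun_Nbd by exact Hv. reflexivity. }
    eapply is_derive_eq; [apply is_derive_Rplus; [apply is_derive_id|]|].
    - apply (is_derive_scal (fun t => snd (Nbd (coef V) t)) y 2), Nbd_im_derive; assumption.
    - unfold g, one; simpl. ring. }
  destruct (continuity_ab_min g (- PI) PI PI_le) as [m [Hm Hmr]].
  { intros c _. apply continuity_pt_filterlim, Hg. }
  exists (g m). split; [|exact Hm].
  destruct (Hk m) as [d [Hd Hd0]].
  rewrite <- (is_derive_unique _ _ _ (Hder m)), (is_derive_unique _ _ _ Hd). exact Hd0.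
Qed.

Lemma CSeries_drop n a : summable a -> (forall j, (j < n)%nat -> a j = RtoC 0) ->
  CSeries a = CSeries (fun l => a (n + l)%nat).
Proof.
  intros Ha Hz.
  assert (Ha' : summable (fun l => a (n + l)%nat)) by (apply (ex_series_incr_n (fun j => Cmod (a j))), Ha).
  symmetry. apply (Clim_unique (csum (fun l => a (n + l)%nat))); [apply CSeries_lim, Ha'|].
  intros eps He. destruct (CSeries_lim a Ha eps He) as [M0 H0]. exists M0. intros M HM.
  specialize (H0 (n + M)%nat ltac:(lia)). rewrite csum_app, (csum_zero a n Hz), Cplus_0_l in H0. exact H0.
Qed.

(** Fourier inversion for V: the negative modes sum to N, and since V is real the positive ones sum
    to its conjugate. *)
Lemma potential_splitting V : periodic2pi V ->
  (exists dV, (forall t, is_derive V t (dV t)) /\ (forall t, continuous dV t)) ->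
  forall t, RtoC (V t) = (four (fun t => RtoC (V t)) 0 + (Cconj (Nbd (coef V) t) + Nbd (coef V) t))%C.
Proof.
  intros Hper [dV [HD Hc]] t.
  assert (HDc : forall t, CD (fun t => RtoC (V t)) t (RtoC (dV t))) by (intros; apply CD_RtoC, HD).
  assert (Hdc : Ccont (fun t => RtoC (dV t))) by (apply Ccont_RtoC, Hc).
  assert (Hpc : forall t, RtoC (V (t + 2 * PI)) = RtoC (V t)) by (intros; rewrite Hper; reflexivity).
  assert (Cf : Ccont (fun t => RtoC (V t))) by (eapply CD_cont; exact HDc).
  pose proof (summable_four_pos _ _ HDc Hdc Hpc) as Sp.
  pose proof (summable_four_neg _ _ HDc Hdc Hpc) as Sn.
  rewrite (fourier_inversion _ _ HDc Hdc Hpc t) at 1.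
  change (CSeries (fun j => (four (fun t => RtoC (V t)) (- Z.of_nat (S j)) * eith (- INR (S j) * t))%C))
    with (Nbd (coef V) t).
  rewrite Cplus_assoc. f_equal.
  assert (Hconj : forall j, Cconj (coef V j) = four (fun t => RtoC (V t)) (Z.of_nat (S j))).
  { intros j. unfold coef. rewrite <- four_conj by exact Cf.
    apply four_ext. intros; apply Cconj_RtoC. }
  set (a := fun j => (four (fun t => RtoC (V t)) (Z.of_nat j) * eith (INR j * t))%C).
  assert (Sa : summable a) by (apply summable_mult; [exact Sp|intros; rewrite Cmod_eith; lra]).
  apply (Clim_unique (csum a)); [apply CSeries_lim, Sa|].
  unfold Nbd. rewrite <- CSeries_conj.
  assert (Sb : summable (fun j => Cconj (coef V j * eith (- INR (S j) * t)))).
  { apply summable_conj, summable_mult; [exact Sn|intros; rewrite Cmod_eith; lra]. }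
  intros eps He. destruct (CSeries_lim _ Sb eps He) as [M0 H0]. exists (S M0). intros M HM.
  destruct M as [|M]; [lia|]. specialize (H0 M ltac:(lia)). rewrite csum_first.
  eapply Rle_lt_trans; [|exact H0]. right. f_equal.
  rewrite (csum_ext (fun i => a (S i)) (fun j => Cconj (coef V j * eith (- INR (S j) * t)))).
  - unfold a at 1. change (IZR (Z.of_nat 0)) with 0. simpl INR. rewrite Rmult_0_l, eith_0. simpl Z.of_nat. ring.
  - intros i _. unfold a. rewrite Cmult_conj, Hconj, eith_conj. do 2 f_equal. ring.
Qed.

(** * Orthogonal polynomials *)

Section Error.

Context (V : R -> R) (n : nat) (P : C -> C) (c : nat -> C).
Hypothesis Hper : periodic2pi V.
Hypothesis HV : exists dV, (forall t, is_derive V t (dV t)) /\ (forall t, continuous dV t).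
Hypothesis Hv : summable (coef V).
Hypothesis Hcn : c n = RtoC 1.
Hypothesis HP : forall z, P z = sum_n (fun m => (c m * pow_n z m)%C) n.
Hypothesis Horth : forall j, (j < n)%nat ->
  inner (fun t => exp (- INR n * V t)) P (fun z => pow_n z j) = RtoC 0.

Let N := RtoC (INR n).

Lemma P_poly z : P z = poly c (S n) z.
Proof.
  rewrite HP, sum_n_csum. unfold poly. apply csum_ext. intros; rewrite pow_n_Cpow; reflexivity.
Qed.

(* [z^{-n} P(z)] as a polynomial in [w = 1/z] *)
Definition revP (w : C) : C := csum (fun m => (c m * Cpow w (n - m))%C) (S n).

Lemma revP_inv z : z <> RtoC 0 -> revP (Cinv z) = (P z * Cinv (Cpow z n))%C.
Proof.
  intros Hz. rewrite P_poly. unfold revP, poly. rewrite <- csum_mult_r. apply csum_ext. intros m Hm.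
  rewrite <- Cmult_assoc. f_equal.
  assert (E : Cpow z n = (Cpow z m * Cpow z (n - m))%C) by (rewrite <- Cpow_add_r; f_equal; lia).
  rewrite E, <- Cinv_Cpow by exact Hz. field. split; apply Cpow_nz, Hz.
Qed.

(** This is where monicity enters: only m = n contributes to the constant term in w = 1/z. *)
Lemma revP_0 : revP (RtoC 0) = RtoC 1.
Proof.
  unfold revP. rewrite (csum_delta _ (S n) n).
  - rewrite Nat.sub_diag, Hcn. simpl. ring.
  - lia.
  - intros i Hi Hin. destruct (n - i)%nat eqn:E; [lia|]. simpl. ring.
Qed.

(** The function pi_n z^{-n} e^{-nN} in the variable w = 1/z, which makes it analytic in the unit
    disc; [Astar] is its Schwarz reflection, whose conjugate on the circle is the original
    function. *)
Definition Ahat (w : C) : C := (revP w * Cexp (- N * pseries (shift0 (coef V)) w))%C.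
Definition Astar (w : C) : C := Cconj (Ahat (Cconj w)).

Lemma disc_alg_Ahat : disc_alg Ahat.
Proof.
  apply disc_alg_mult.
  - apply disc_alg_poly. apply (is_poly_csum (fun m w => (c m * Cpow w (n - m))%C)).
    intros m. apply is_poly_monomial.
  - apply disc_alg_Cexp, disc_alg_mult; [apply disc_alg_const|].
    apply disc_alg_pseries, summable_shift0, Hv.
Qed.

Lemma Ahat_0 : Ahat (RtoC 0) = RtoC 1.
Proof.
  unfold Ahat. rewrite revP_0, pseries_0 by (apply summable_shift0, Hv). cbn [shift0].
  rewrite Cmult_0_r, Cexp_0. ring.
Qed.

Lemma OPerr_Ahat z : 1 <= Cmod z -> OPerr V P n z = (Ahat (Cinv z) - RtoC 1)%C.
Proof.
  intros Hz. assert (Hz0 : z <> RtoC 0) by (apply Cmod_gt_0; lra).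
  unfold OPerr, Ahat. rewrite revP_inv, <- Nfun_pseries by assumption.
  rewrite pow_n_Cpow. reflexivity.
Qed.

Lemma Astar_circle t : Cconj (Astar (eith t)) =
  (P (eith t) * eith (- INR n * t) * Cexp (- N * Nbd (coef V) t))%C.
Proof.
  unfold Astar. rewrite Cconj_conj, eith_conj. unfold Ahat.
  rewrite <- Nbd_pseries by exact Hv. f_equal.
  rewrite <- eith_inv, revP_inv by apply eith_neq_0. f_equal.
  rewrite eith_pow, eith_inv. f_equal. ring.
Qed.

Definition betaf (w : C) : C := (P w * Cexp (- N * pseries (shift0 (fun j => Cconj (coef V j))) w))%C.

Lemma disc_alg_betaf : disc_alg betaf.
Proof.
  apply disc_alg_mult.
  - apply disc_alg_poly. exists (S n), c. apply P_poly.
  - apply disc_alg_Cexp, disc_alg_mult; [apply disc_alg_const|].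
    apply disc_alg_pseries, summable_shift0, summable_conj, Hv.
Qed.

Lemma osc_Astar t : (osc (coef V) n t * Cconj (Astar (eith t)))%C = betaf (eith t).
Proof.
  rewrite Astar_circle. unfold osc, betaf. rewrite <- Nbd_conj by exact Hv. fold N.
  set (x := Nbd (coef V) t).
  transitivity (P (eith t) * (eith (INR n * t) * eith (- INR n * t)) * (Cexp (N * (x - Cconj x)) * Cexp (-
      N * x)))%C; [ring|].
  rewrite <- eith_plus, <- Cexp_plus. replace (INR n * t + - INR n * t) with 0 by ring.
  rewrite eith_0, Cmult_1_r. f_equal. f_equal. ring.
Qed.

Definition Psi (t : R) : C := (P (eith t) * eith (- INR n * t) * RtoC (exp (- INR n * V t)))%C.

(** Continuous differentiability is what Fourier inversion and the summability of the modes of [Psi]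
    require. *)
Lemma Psi_smooth : exists dPsi, (forall t, CD Psi t (dPsi t)) /\ Ccont dPsi.
Proof.
  destruct HV as [dV [HD Hc]].
  set (e := fun t => RtoC (exp (- INR n * V t))).
  set (de := fun t => RtoC (- INR n * dV t * exp (- INR n * V t))).
  assert (He : forall t, CD e t (de t)).
  { intros t. apply CD_RtoC. eapply is_derive_eq.
    - apply (is_derive_Rcomp exp (fun t => - INR n * V t)); [apply is_derive_Reals, derivable_pt_lim_exp|].
      apply (is_derive_scal V t (- INR n)), HD.
    - cbv beta. reflexivity. }
  assert (Hde : Ccont de).
  { apply Ccont_RtoC. intros t. apply continuous_Rmult.
    - apply continuous_Rmult; [apply continuous_const|apply Hc].
    - apply (CD_cont e de He t). }
  set (f := trig (- Z.of_nat n) c (S n)).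
  set (df := fun t => csum (fun i => (c i * ((0, IZR (- Z.of_nat n + Z.of_nat i))%R * eith (IZR (- Z.of_nat
      n + Z.of_nat i) * t)))%C) (S n)).
  assert (Hf : forall t, CD f t (df t)).
  { intros t. apply (CD_csum (fun i t => (c i * eith (IZR (- Z.of_nat n + Z.of_nat i) * t))%C)).
    intros i. apply CD_scal, CD_eith. }
  assert (Hdf : Ccont df).
  { apply (Ccont_csum (fun i t => (c i * ((0, IZR (- Z.of_nat n + Z.of_nat i))%R * eith (IZR (- Z.of_nat n
      + Z.of_nat i) * t)))%C)).
    intros i. do 2 (apply Ccont_mult; [apply Ccont_const|]). apply Ccont_eith. }
  exists (fun t => (df t * e t + f t * de t)%C). split.
  - intros t. apply CD_ext with (fun t => (f t * e t)%C).
    + intros x. unfold Psi. f_equal. rewrite P_poly. unfold f, trig, poly.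
      rewrite <- csum_mult_r. apply csum_ext. intros i _.
      rewrite eith_pow, <- Cmult_assoc, <- eith_plus. do 2 f_equal.
      rewrite plus_IZR, opp_IZR, <- !INR_IZR_INZ. ring.
    + apply CD_mult; [apply Hf|apply He].
  - apply Ccont_plus; apply Ccont_mult; try assumption.
    + apply (CD_cont e de He).
    + apply (CD_cont f df Hf).
Qed.

Lemma Psi_periodic t : Psi (t + 2 * PI) = Psi t.
Proof.
  unfold Psi. rewrite Hper.
  assert (E : forall m, eith (IZR m * (t + 2 * PI)) = eith (IZR m * t)).
  { intros m. rewrite Rmult_plus_distr_l, eith_plus, eith_2PI_Z. ring. }
  pose proof (E 1%Z) as E1. rewrite !Rmult_1_l in E1. rewrite E1.
  pose proof (E (- Z.of_nat n)%Z) as En. rewrite opp_IZR, <- INR_IZR_INZ in En. rewrite En. reflexivity.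
Qed.

(** The mode -(m + 1) of z^{-n} pi_n e^{-nV} is the inner product of pi_n with z^{n-m-1}, an
    exponent between 0 and n - 1. *)
Lemma four_Psi_gap m : (m < n)%nat -> four Psi (- Z.of_nat (S m)) = RtoC 0.
Proof.
  intros Hm. rewrite <- (Horth (n - S m)) by lia.
  unfold inner. rewrite Cinv_2PI.
  change (four Psi (- Z.of_nat (S m)) = Cmean (fun t => (P (eith t) * Cconj (pow_n (eith t) (n - S m)) *
      RtoC (exp (- INR n * V t)))%C)).
  unfold four. apply Cmean_ext. intros t _. unfold Psi. rewrite pow_n_Cpow, eith_pow, eith_conj.
  replace (eith (- (INR (n - S m) * t))) with (eith (- INR n * t) * eith (- IZR (- Z.of_nat (S m)) * t))%C.
  - ring.
  - rewrite <- eith_plus. f_equal. rewrite opp_IZR, <- INR_IZR_INZ, minus_INR by lia. ring.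
Qed.

Definition gap_coef (l : nat) : C := four Psi (- Z.of_nat (S (n + l))).

Lemma summable_Psi_pos : summable (fun j => four Psi (Z.of_nat j)).
Proof.
  destruct Psi_smooth as [dPsi [HD Hc]]. apply (summable_four_pos Psi dPsi HD Hc Psi_periodic).
Qed.

Lemma summable_Psi_neg : summable (fun j => four Psi (- Z.of_nat (S j))).
Proof.
  destruct Psi_smooth as [dPsi [HD Hc]]. apply (summable_four_neg Psi dPsi HD Hc Psi_periodic).
Qed.

Lemma summable_gap_coef : summable gap_coef.
Proof.
  apply (ex_series_incr_n (fun j => Cmod (four Psi (- Z.of_nat (S j)))) n), summable_Psi_neg.
Qed.

Definition Splus (w : C) : C := pseries (fun j => four Psi (Z.of_nat j)) w.
Definition Sminus (w : C) : C := pseries (shift0 (fun l => Cconj (gap_coef l))) w.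

(** Beyond the gap, the modes -(n + l + 1) with l >= 0 form z^{-n} times the conjugate of an
    analytic function that vanishes at 0. *)
Lemma Psi_splitting t : Psi t = (Splus (eith t) + eith (- INR n * t) * Cconj (Sminus (eith t)))%C.
Proof.
  destruct Psi_smooth as [dPsi [HD Hc]].
  rewrite (fourier_inversion Psi dPsi HD Hc Psi_periodic t). f_equal.
  - unfold Splus, pseries. apply CSeries_ext. intros j. rewrite eith_pow. reflexivity.
  - rewrite (CSeries_drop n).
    + unfold Sminus. rewrite <- Nbd_conj by apply summable_gap_coef. rewrite Cconj_conj. unfold Nbd.
      rewrite <- CSeries_mult_l.
      * apply CSeries_ext. intros l. unfold gap_coef.
        replace (- INR (S (n + l)) * t) with (- INR n * t + - INR (S l) * t)
          by (rewrite <- Nat.add_succ_r, plus_INR; ring).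
        rewrite eith_plus. ring.
      * apply summable_mult; [apply summable_gap_coef|intros; rewrite Cmod_eith; lra].
    + apply summable_mult; [apply summable_Psi_neg|intros; rewrite Cmod_eith; lra].
    + intros j Hj. rewrite four_Psi_gap by exact Hj. ring.
Qed.

Definition alphaf (w : C) : C :=
  (Cexp (N * four (fun t => RtoC (V t)) 0) * Cexp (N * pseries (shift0 (fun j => Cconj (coef V j))) w) *
      Splus w)%C.
(** The mean of V enters conjugated, so that after conjugation on the circle the prefactor is the
    same as the one in [alphaf]. *)
Definition bhat (w : C) : C :=
  (Cexp (N * Cconj (four (fun t => RtoC (V t)) 0)) * Cexp (N * pseries (shift0 (fun j => Cconj (coef V j)))
      w) * Sminus w)%C.

Lemma disc_alg_prefactor a : disc_alg (fun w =>
  (Cexp a * Cexp (N * pseries (shift0 (fun j => Cconj (coef V j))) w))%C).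
Proof.
  apply disc_alg_mult; [apply disc_alg_const|]. apply disc_alg_Cexp, disc_alg_mult; [apply disc_alg_const|].
  apply disc_alg_pseries, summable_shift0, summable_conj, Hv.
Qed.

Lemma disc_alg_alphaf : disc_alg alphaf.
Proof. apply disc_alg_mult; [apply disc_alg_prefactor|apply disc_alg_pseries, summable_Psi_pos]. Qed.

Lemma disc_alg_bhat : disc_alg bhat.
Proof.
  apply disc_alg_mult; [apply disc_alg_prefactor|].
  apply disc_alg_pseries, summable_shift0, summable_conj, summable_gap_coef.
Qed.

Lemma bhat_0 : bhat (RtoC 0) = RtoC 0.
Proof.
  unfold bhat, Sminus. rewrite (pseries_0 (shift0 (fun l => Cconj (gap_coef l))))
    by (apply summable_shift0, summable_conj, summable_gap_coef).
  cbn [shift0]. ring.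
Qed.

(** Since V = V_0 + N + conj N, the left side is e^{n V_0 + n conj N} times [Psi]. In the second
    part of [Psi], e^{n conj N} z^{-n} is written as e^{nN} times conj Q. *)
Lemma Astar_splitting t : Cconj (Astar (eith t)) =
  (alphaf (eith t) + Cconj (osc (coef V) n t) * Cconj (bhat (eith t)))%C.
Proof.
  assert (HN : Cconj N = N) by apply Cconj_RtoC.
  rewrite Astar_circle. unfold alphaf, bhat, osc. rewrite <- Nbd_conj by exact Hv. fold N.
  set (x := Nbd (coef V) t). set (v0 := four (fun t => RtoC (V t)) 0).
  rewrite !Cmult_conj, <- !Cexp_conj, !Cmult_conj, Cminus_conj, !Cconj_conj, HN, eith_conj.
  replace (- (INR n * t)) with (- INR n * t) by ring.
  transitivity (Cexp (N * v0 + N * Cconj x) * Psi t)%C.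
  - unfold Psi.
    replace (RtoC (exp (- INR n * V t))) with (Cexp (- N * (v0 + (Cconj x + x)))).
    + transitivity (P (eith t) * eith (- INR n * t) * (Cexp (N * v0 + N * Cconj x) * Cexp (- N * (v0 +
        (Cconj x + x)))))%C; [|ring].
      rewrite <- Cexp_plus. f_equal. f_equal. ring.
    + unfold v0, x. rewrite <- potential_splitting by assumption.
      unfold N. rewrite <- RtoC_opp, <- RtoC_mult, Cexp_RtoC. reflexivity.
  - rewrite Psi_splitting, Cexp_plus.
    transitivity (Cexp (N * v0) * Cexp (N * Cconj x) * Splus (eith t) + Cexp (N * (Cconj x - x)) * Cexp (N
        * x) * eith (- INR n * t) * (Cexp (N * v0) * Cconj (Sminus (eith t))))%C; [|ring].
    rewrite <- (Cexp_plus (N * (Cconj x - x))%C).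
    replace (N * (Cconj x - x) + N * x)%C with (N * Cconj x)%C by ring. ring.
Qed.

(** The outer conjugate undoes the reflection: these are the coefficients of [Ahat] - 1 in powers of
    1/z. *)
Definition err_coef (j : nat) : C := Cconj (four (fun t => (Astar (eith t) - RtoC 1)%C) (Z.of_nat j)).

Lemma disc_alg_Astar : disc_alg Astar.
Proof. apply disc_alg_reflect, disc_alg_Ahat. Qed.

Lemma Astar_0 : Astar (RtoC 0) = RtoC 1.
Proof. unfold Astar. rewrite Cconj_RtoC, Ahat_0. apply Cconj_RtoC. Qed.

Lemma OPerr_expansion z : 1 < Cmod z -> OPerr V P n z = pseries err_coef (Cinv z).
Proof.
  intros Hz. assert (Hz0 : z <> RtoC 0) by (apply Cmod_gt_0; lra).
  rewrite OPerr_Ahat by lra. set (w := Cinv z).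
  assert (Hw : Cmod w < 1).
  { unfold w. rewrite Cmod_inv by exact Hz0. rewrite <- Rinv_1. apply Rinv_lt_contravar; lra. }
  transitivity (Cconj (Astar (Cconj w) - RtoC 1)).
  - unfold Astar. rewrite Cminus_conj, !Cconj_conj, Cconj_RtoC. reflexivity.
  - rewrite (disc_alg_pseries_expansion (fun w => (Astar w - RtoC 1)%C) (Cconj w)).
    + unfold pseries. rewrite <- CSeries_conj. apply CSeries_ext. intros j.
      unfold err_coef. rewrite Cmult_conj, Cpow_conj, Cconj_conj. reflexivity.
    + apply disc_alg_minus; [apply disc_alg_Astar|apply disc_alg_const].
    + rewrite Cmod_conj. exact Hw.
Qed.

(** The linear bound enters twice: with s = 0 it gives ||b|| <= 2 K n^{-q}, and with s = j, applied
    to b, it bounds the coefficient by a further factor K ((j+1)/n)^q. *)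
Lemma err_coef_bound q K : 0 <= K -> (1 <= n)%nat ->
  (forall F G, disc_alg F -> disc_alg G ->
     Cmod (Cmean (fun y => (osc (coef V) n y * (F (eith y) * G (eith y)))%C)) <=
     / 2 * (nrm (fun y => F (eith y)) * nrm (fun y => G (eith y)))) ->
  (forall s F, disc_alg F ->
     Cmod (Cmean (fun y => (osc (coef V) n y * eith (- INR s * y) * F (eith y))%C)) <=
     K * ((INR s + 1) / INR n) ^ q * nrm (fun y => F (eith y))) ->
  forall j, Cmod (err_coef j) <= 2 * K ^ 2 / INR n ^ (2 * q) * (INR j + 1) ^ q.
Proof.
  intros HK Hn Hbil Hlin j.
  assert (HN : 1 <= INR n) by (apply (le_INR 1), Hn).
  assert (Hk0 : forall F, disc_alg F ->
     Cmod (Cmean (fun y => (osc (coef V) n y * F (eith y))%C)) <= K * (/ INR n) ^ q * nrm (fun y => F (eith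
         y))).
  { intros F HF. eapply Rle_trans; [|eapply Rle_trans; [apply (Hlin O F HF)|]].
    - right. f_equal. apply Cmean_ext. intros y _. simpl INR. replace (- 0 * y) with 0 by ring. rewrite
        eith_0. ring.
    - right. simpl INR. do 3 f_equal. field. lra. }
  pose proof (hankel_nrm_le (osc (coef V) n) Astar alphaf bhat betaf (K * (/ INR n) ^ q)
    (Ccont_osc _ n Hv) (Cmod_osc _ n) disc_alg_Astar disc_alg_alphaf disc_alg_bhat disc_alg_betaf
    Astar_0 bhat_0 Astar_splitting osc_Astar Hbil Hk0) as Hb.
  unfold err_coef. rewrite Cmod_conj.
  assert (HKn : 0 <= 2 * K ^ 2 / INR n ^ (2 * q) * (INR j + 1) ^ q).
  { pose proof (pos_INR j). apply Rmult_le_pos; [apply Rmult_le_pos|apply pow_le; lra].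
    - pose proof (pow2_ge_0 K). lra.
    - apply Rlt_le, Rinv_0_lt_compat, pow_lt. lra. }
  (* The coefficient of index 0 vanishes because [Astar] is 1 at the origin; [hankel_coef] covers
     the positive indices. *)
  destruct j as [|j].
  - assert (E : four (fun t => (Astar (eith t) - RtoC 1)%C) (Z.of_nat 0) = RtoC 0).
    { unfold four. rewrite (Cmean_ext _ (fun t => (Astar (eith t) - RtoC 1)%C)).
      - rewrite (Cmean_disc_alg (fun w => (Astar w - RtoC 1)%C)).
        + rewrite Astar_0. ring.
        + apply disc_alg_minus; [apply disc_alg_Astar|apply disc_alg_const].
      - intros t _. change (IZR (Z.of_nat 0)) with 0. replace (- 0 * t) with 0 by ring. rewrite eith_0. ring. }
    rewrite E, Cmod_0. exact HKn.
  - rewrite (hankel_coef (osc (coef V) n) Astar alphaf bhat) by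
      first [apply Ccont_osc, Hv | apply disc_alg_alphaf | apply disc_alg_bhat | apply Astar_splitting | lia].
    eapply Rle_trans; [apply (Hlin (S j) bhat disc_alg_bhat)|].
    set (x := INR (S j) + 1). assert (Hx : 0 <= x) by (unfold x; pose proof (pos_INR (S j)); lra).
    assert (Hxn : 0 <= (x / INR n) ^ q) by (apply pow_le, Rmult_le_pos; [exact Hx|apply Rlt_le,
        Rinv_0_lt_compat; lra]).
    apply Rle_trans with (K * (x / INR n) ^ q * (2 * (K * (/ INR n) ^ q))).
    + apply Rmult_le_compat_l; [apply Rmult_le_pos; assumption|exact Hb].
    + right. unfold Rdiv. rewrite Rpow_mult_distr.
      replace (2 * q)%nat with (q + q)%nat by lia. rewrite pow_add, pow_inv. field. apply pow_nonzero. lra.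
Qed.

End Error.

(** * Iterated derivatives and the final estimate *)

Fixpoint dcoef_iter (a : nat -> C) (i : nat) : nat -> C :=
  match i with O => a | S i => dcoef (dcoef_iter a i) end.

Lemma dcoef_iter_bound a M m i : 0 <= M -> (forall j, Cmod (a j) <= M * (INR j + 1) ^ m) ->
  forall j, Cmod (dcoef_iter a i j) <= M * (INR j + 1) ^ (m + i).
Proof.
  intros HM Ha. induction i as [|i IH]; intros j.
  - rewrite Nat.add_0_r. apply Ha.
  - rewrite Nat.add_succ_r. apply (dcoef_bound _ M (m + i) HM IH).
Qed.

Theorem theorem4p1 (p k : nat) (V : R -> R) (pi : nat -> C -> C) :
  (2 * p + 2 <= k)%nat ->
  periodic2pi V ->
  C_Lip (k - 1) V ->
  (forall t, exists d, is_derive (kappa V) t d /\ 0 < d) ->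
  (forall n, is_monic_OPUC V n (pi n)) ->
  forall rho : R, 1 < rho ->
  exists K : R, 0 < K /\
  exists n0 : nat, forall n : nat, (n0 <= n)%nat ->
    (* g j = j-th complex derivative of pi_n(z) z^{-n} e^{-nN(z)} - 1 on |z| > 1 *)
    exists g : nat -> C -> C,
      (forall z, 1 < Cmod z -> g 0%nat z = OPerr V (pi n) n z) /\
      (forall j z, (j < p)%nat -> 1 < Cmod z ->
         @is_derive C_AbsRing C_NormedModule (g j) z (g (S j) z)) /\
      (forall z, rho <= Cmod z ->
         Cmod (g p z) <= K * ln (INR n) / INR n ^ (2 * (k - 1))).
Proof.
  intros Hpk Hper HLip Hkap Hpi rho Hrho.
  (* As k >= 2, the smoothness order k - 1 is the [S q0] of the oscillatory estimates. *)
  destruct k as [|[|q0]]; [lia|lia|]. replace (S (S q0) - 1)%nat with (S q0) in * by lia.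
  destruct (C_Lip_coef_decay (S q0) V Hper HLip) as [B [HB0 Hreg]].
  assert (HV : exists dV, (forall t, is_derive V t (dV t)) /\ (forall t, continuous dV t)).
  { apply (C_Lip_smooth (S q0)); [lia|exact HLip]. }
  pose proof (summable_weighted q0 (coef V) B Hreg) as Hw.
  pose proof (summable_coef q0 (coef V) B Hreg) as Hv.
  destruct (kappa_lower_bound V Hw Hv Hkap) as [c0 [Hc0 Hc]].
  destruct (osc_bilinear_bound q0 (coef V) B c0 Hreg Hc0 Hc) as [n1 Hbil].
  destruct (osc_linear_bound q0 (coef V) B c0 HB0 Hreg Hc0 Hc) as [K [HK Hlin]].
  set (r := / rho).
  assert (Hr : 0 < r < 1).
  { split; [apply Rinv_0_lt_compat; lra|]. rewrite <- Rinv_1. apply Rinv_lt_contravar; lra. }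
  pose proof (ex_series_pow_geom (S q0 + p) r Hr) as HS.
  set (S0 := Series (fun j => (INR j + 1) ^ (S q0 + p) * r ^ j)) in *.
  assert (HS0 : 0 <= S0).
  { apply (rsum_le_Series _ 0) in HS; [exact HS|]. intros j. pose proof (pos_INR j).
    apply Rmult_le_pos; apply pow_le; lra. }
  (* [S0] sums the growth (j+1)^{q+p} of the p-th derivative's coefficients against rho^{-j}; the
     added 1 makes the constant positive. *)
  exists (2 * K ^ 2 * S0 + 1). split; [pose proof (pow2_ge_0 K); nra|].
  exists (n1 + 3)%nat. intros n Hn.
  destruct (Hpi n) as [[c [Hcn HP]] Horth].
  set (e := err_coef V n c).
  assert (HN : 3 <= INR n).
  { replace 3 with (INR 3) by (simpl; ring). apply le_INR. lia. }
  assert (HNq : 0 < INR n ^ (2 * S q0)) by (apply pow_lt; lra).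
  assert (He : forall j, Cmod (e j) <= 2 * K ^ 2 / INR n ^ (2 * S q0) * (INR j + 1) ^ S q0).
  { apply (err_coef_bound V n (pi n) c Hper HV Hv Hcn HP Horth); try assumption.
    - lia.
    - intros F G. apply Hbil. lia.
    - intros s F. apply Hlin. lia. }
  assert (HM : 0 <= 2 * K ^ 2 / INR n ^ (2 * S q0)).
  { apply Rmult_le_pos; [pose proof (pow2_ge_0 K); lra|apply Rlt_le, Rinv_0_lt_compat, HNq]. }
  (* The derivatives are the power series in 1/z with iterated coefficients. *)
  exists (fun i z => pseries (dcoef_iter e i) (Cinv z)). split; [|split].
  - intros z Hz. symmetry. apply (OPerr_expansion V n (pi n) c Hv HP z Hz).
  - intros j z _ Hz. simpl dcoef_iter.
    apply (is_derive_pseries_inv _ _ _ z HM (dcoef_iter_bound e _ _ j HM He) Hz).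
  - intros z Hz. assert (Hz0 : z <> RtoC 0) by (apply Cmod_gt_0; lra).
    assert (Hwr : Cmod (Cinv z) <= r) by (rewrite Cmod_inv by exact Hz0; apply Rinv_le_contravar; lra).
    unfold pseries.
    eapply Rle_trans; [apply (Cmod_CSeries_le _ (fun j => 2 * K ^ 2 / INR n ^ (2 * S q0) * ((INR j + 1) ^
        (S q0 + p) * r ^ j)))|].
    + intros j. rewrite Cmod_mult, Cmod_pow, <- Rmult_assoc.
      apply Rmult_le_compat; [apply Cmod_ge_0|apply pow_le, Cmod_ge_0|apply dcoef_iter_bound; assumption|].
      apply pow_incr. split; [apply Cmod_ge_0|exact Hwr].
    + apply (ex_series_scal_l (2 * K ^ 2 / INR n ^ (2 * S q0)) (fun j => (INR j + 1) ^ (S q0 + p) * r ^ j)), HS.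
    + rewrite Series_scal_l. fold S0.
      (* The coefficient bounds already sum to a multiple of n^{-2(k-1)}; n >= 3 >= e makes the
         logarithm at least 1. *)
      assert (Hln : 1 <= ln (INR n)).
      { rewrite <- (ln_exp 1). apply Rcomplements.ln_le; [apply exp_pos|]. pose proof exp_le_3. lra. }
      assert (0 <= 2 * K ^ 2 * S0) by (pose proof (pow2_ge_0 K); nra).
      unfold Rdiv.
      replace (2 * K ^ 2 * / INR n ^ (2 * S q0) * S0) with (2 * K ^ 2 * S0 * / INR n ^ (2 * S q0)) by ring.
      apply Rmult_le_compat_r; [apply Rlt_le, Rinv_0_lt_compat, HNq|]. nra.
Qed.
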